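(* Let $\Delta$ be a finite simplicial complex with $\operatorname{depth}\Delta=d-1$, and let $r$ be an integer with $2\le r\le d/2$. Let $\mathcal{A}$ be an intersecting family of $r$-element faces of $\Delta$. Suppose $\Delta$ is shifted with respect to $\{v_1<\cdots<v_{r+1}\}$ and $\mathcal{A}$ has no common intersection (no vertex lies in every member of $\mathcal{A}$). Then \[|\mathcal{A}|\le f_{r-1}(\operatorname{link}_\Delta v_1)-\beta+1,\] where $\beta$ is the number of $r$-element faces of $\Delta$ containing $v_1$ but no element of $\{v_2,\dots,v_{r+1}\}$.
   Context: A simplicial complex is a nonempty finite family of sets closed under subsets; $f_k(\Gamma)$ is the number of $k$-element faces of $\Gamma$; $\operatorname{link}_\Delta A=\{B\in\Delta:A\cap B=\emptyset,A\cup B\in\Delta\}$. Fix a field $\mathbb{F}$. $\Gamma$ is Cohen-Macaulay if $\tilde H_i(\operatorname{link}_\Gamma A;\mathbb{F})=0$ for all faces $A$ (including $\emptyset$) and all $i<\dim\operatorname{link}_\Gamma A$ (dimension of a face $A$ is $|A|-1$, of a complex the maximum face dimension). The depth of $\Delta$ is the largest $k$ such that the subcomplex of faces of dimension at most $k$ is Cohen-Macaulay. $\Delta$ is shifted with respect to the ordered vertex set $\{v_1<\cdots<v_t\}$ if for every $i\le t$, every face $B$, and every $w\in B$ with $w\notin\{v_1,\dots,v_i\}$ and $v_i\notin B$, the set $(B\setminus\{w\})\cup\{v_i\}$ is a face of $\Delta$. A family is intersecting if any two of its members intersect. *)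

(* Defs.v *)
From HB Require Import structures.
From mathcomp Require Import all_boot all_order all_algebra.
Set Implicit Arguments. Unset Strict Implicit. Unset Printing Implicit Defensive.
Import GRing.Theory.


Section Defs.
Variable T : finType.
Implicit Types (D G : {set {set T}}) (A B : {set T}).

Definition is_complex D : Prop :=
  D != set0 /\ forall A B, A \in D -> B \subset A -> B \in D.

Definition faces_of D (k : nat) : {set {set T}} := [set A in D | #|A| == k].

Definition fnum D (k : nat) : nat := #|faces_of D k|.

Definition link D A : {set {set T}} :=
  [set B in D | (A :&: B == set0) && (A :|: B \in D)].

Definition maxsz D : nat := \max_(B in D) #|B|.

Definition face D k (i : 'I_#|faces_of D k|) : {set T} := enum_val i.

Definition bsign (F : fieldType) (I : {set T}) (x : T) : F :=
  ((-1) ^+ #|[set w in I | (enum_rank w < enum_rank x)%N]|)%R.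

(* boundary map C_k -> C_{k-1} (chains indexed by faces of size k, i.e. of
   dimension k-1), acting on row vectors; reduced (C_{-1} is never reached:
   for k = 0 the map is 0, so every 0-chain (multiple of the empty face)
   is a cycle, and it is a boundary iff hit by the augmentation bd 1). *)
Definition bd (F : fieldType) D (k : nat)
  : 'M[F]_(#|faces_of D k|, #|faces_of D k.-1|) :=
  \matrix_(i, j)
    (let I := face i in let J := face j in
     if (J \subset I) && (#|I :\: J| == 1%N)
     then (\sum_(x in I :\: J) bsign F I x)%R else 0%R).

(* reduced homology in dimension k-1 vanishes: ker bd_k <= im bd_(k+1) *)
Definition hvanish (F : fieldType) D (k : nat) : bool :=
  (kermx (bd F D k) <= bd F D k.+1)%MS.

(* Cohen-Macaulay over F: for every face A and every i < dim link A,
   H~_i(link A; F) = 0.  (Here k = i+1 ranges over 0 .. maxsz-1.) *)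
Definition cohen_macaulay (F : fieldType) D : bool :=
  [forall A in D, forall k : 'I_(maxsz (link D A)), hvanish F (link D A) k].

Definition skel D (m : nat) : {set {set T}} := [set B in D | #|B| <= m].

(* depth: largest k (<= dim D) such that the k-skeleton is Cohen-Macaulay;
   with m = k+1, m ranges over 0 .. maxsz D *)
Definition depth (F : fieldType) D : int :=
  ((\max_(m < (maxsz D).+1 | cohen_macaulay F (skel D m)) (m : nat))%:Z - 1)%R.

(* shifted w.r.t. the ordered vertices v_1 < ... < v_t (here v : 'I_t -> T,
   with v_(i+1) = v i) *)
Definition shifted_wrt D (t : nat) (v : 'I_t -> T) : Prop :=
  forall (i : 'I_t) B w, B \in D -> w \in B ->
    w \notin [set v j | j : 'I_t & (j <= i)%N] -> v i \notin B ->
    (B :\ w) :|: [set v i] \in D.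

Definition intersecting (AA : {set {set T}}) : Prop :=
  forall A B, A \in AA -> B \in AA -> A :&: B != set0.

End Defs.

(* Main.v *)
(** Let [V] be the set of the distinguished vertices and [o = v ord0].

    A nontrivial intersecting family is compressed towards the vertices of [V].
    If a compression from [w] to [x] would make it trivial, every member meets
    [{x, w}]; one then adds all faces containing both and compresses away from
    [x] and [w] (Frankl).  The outcome is an intersecting family, at least as
    large, containing all [r]-subsets of [V].

    Every member of such a family is a subset of [V] together with a face of
    [link V].  On the link one shifts algebraically: over an algebraically
    closed field, contract chains with the linear forms [w |-> (t w) ^ i],
    [i = 0, 1, ...], and record, for each chain, the lexicographically first set
    of contractions that does not kill it.  This keeps cardinalities and the
    intersection property.  A nonzero combination of the first [j] forms vanishes
    at fewer than [j] vertices, and the contraction by a form vanishing at few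
    vertices is exact in low degrees because the links have vanishing homology;
    hence the shifted link contains, with a small face [C], also the union of
    [C] with an initial segment.

    Ordinary compression makes the outcome shifted with all facets of size at
    least [2 r], and for shifted complexes the bound follows by induction on the
    number of vertices, deleting the last one. *)

Require Import Defs.
From Stdlib Require Import Classical_Prop.
From HB Require Import structures.
From mathcomp Require Import all_boot all_order all_algebra all_field.
From mathcomp Require Import zify ring.
Set Implicit Arguments. Unset Strict Implicit. Unset Printing Implicit Defensive.
Import GRing.Theory.

(** * Compression *)

(** The main obstacle: exactness of each single contraction does not by itself give exactness on the
    common kernel of several forms. Comparing the contraction by [p] with that by the power ['X^l]
    yields an operator on a finite-dimensional obstruction space. Every [p - r *: 'X^l] has as few
    zeros as [p] is allowed to have, so this operator has no eigenvalue, and over an algebraically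
    closed field the space must vanish. In this way the explicit powers of an injective [t] do the
    work of generic forms. Changing the field is harmless because vanishing of homology is a
    condition on ranks.

    The constants fit exactly. The set [V] has [r + 1] vertices, so the link of [V] still has depth
    bound [2 r - (r + 1) = r - 1], counted in vertices. Joining back the simplex on [V] gives facets
    of size at least [2 r], the size at which complementary pairs of [r]-sets start the final
    induction. Members have the required form because each meets [V] and so has fewer than [r]
    vertices outside it. Algebraic shifting acts outside [V] only, hence preserves the number of
    faces with a given trace on [V], and the bound counts faces by that trace. *)

Section Complexes.
Variables (T : finType).
Implicit Types (S A B : {set T}) (D G : {set {set T}}).

Lemma complex_set0 G : is_complex G -> set0 \in G.
Proof. by case=> /set0Pn[A AG] h; apply: h AG _; apply: sub0set. Qed.

Lemma complexS G A B : is_complex G -> A \in G -> B \subset A -> B \in G.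
Proof. by case=> _; apply. Qed.

Lemma linkP G A B :
  reflect [/\ B \in G, [disjoint A & B] & A :|: B \in G] (B \in link G A).
Proof.
rewrite inE -setI_eq0; apply: (iffP and3P) => -[]; by split.
Qed.

Lemma in_link G A B : is_complex G ->
  (B \in link G A) = [disjoint A & B] && (A :|: B \in G).
Proof.
move=> cG; apply/linkP/andP => [[] //|[dAB AB]]; split=> //.
by apply: complexS cG AB _; apply: subsetUr.
Qed.

Lemma link_complex G A : is_complex G -> A \in G -> is_complex (link G A).
Proof.
move=> cG AG; split.
  by apply/set0Pn; exists set0; rewrite in_link // setU0 AG disjoint_sym disjoints_subset sub0set.
move=> B C; rewrite !in_link // => /andP[dAB ABG] sCB; apply/andP; split.
  exact: disjointWr sCB dAB.
by apply: complexS cG ABG _; apply: setUS.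
Qed.

Lemma link_sub G A : link G A \subset G.
Proof. by apply/subsetP => B /linkP[]. Qed.

Lemma link_link G A B : is_complex G -> A \in G -> B \in link G A ->
  link (link G A) B = link G (A :|: B).
Proof.
move=> cG AG BL; have cL := link_complex cG AG.
apply/setP => C; rewrite !in_link //.
move: BL; rewrite in_link // => /andP[dAB ABG].
rewrite ![[disjoint A & B :|: C]]disjoint_sym ![[disjoint A :|: B & C]]disjoint_sym.
rewrite -!setI_eq0 setIUl setIUr !setU_eq0 !setI_eq0 setUA.
rewrite [[disjoint B & A]]disjoint_sym dAB /= [[disjoint B & C]]disjoint_sym.
by rewrite andbA [_ && [disjoint C & A]]andbC.
Qed.

Lemma link0 G : is_complex G -> link G set0 = G.
Proof.
move=> cG; apply/setP => B.
by rewrite in_link // set0U disjoints_subset sub0set.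
Qed.

Lemma mem_faces G k A : (A \in faces_of G k) = (A \in G) && (#|A| == k).
Proof. by rewrite inE. Qed.

Lemma link1_face G w S : is_complex G -> w \notin S ->
  (S \in link G [set w]) = (w |: S \in G).
Proof. by move=> cG wS; rewrite in_link // disjoints1 wS. Qed.

End Complexes.

Section Compression.
Variable T : finType.
Implicit Types (x y u w : T) (A B C : {set T}) (F G D : {set {set T}}).

Definition swap x y B := x |: (B :\ y).

Lemma in_swap x y B u : (u \in swap x y B) = (u == x) || (u != y) && (u \in B).
Proof. by rewrite !inE. Qed.

Lemma card_swap x y B : y \in B -> x \notin B -> #|swap x y B| = #|B|.
Proof.
move=> yB xB; rewrite cardsU1 !inE (negPf xB) andbF (cardsD1 y B) yB; lia.
Qed.

Lemma swapK x y B : y \in B -> x \notin B -> swap y x (swap x y B) = B.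
Proof.
move=> yB xB; apply/setP => u; rewrite !in_swap.
case: (u =P y) => [->|_] /=; first by rewrite yB.
by case: (u =P x) => [->|//]; rewrite (negPf xB).
Qed.

Lemma swap_sub x y A B : A \subset B -> swap x y A \subset swap x y B.
Proof. by move=> AB; apply: setUS; apply: setSD. Qed.

Definition movable x y B := (y \in B) && (x \notin B).

Definition closed_swap x y F :=
  forall B, B \in F -> movable x y B -> swap x y B \in F.

(** A move is blocked when its target is already in [F]; this makes the map injective on [F], so
    compression keeps cardinalities. *)
Definition move_set x y F B :=
  if movable x y B && (swap x y B \notin F) then swap x y B else B.

Definition compress x y F := move_set x y F @: F.

Lemma movable_swap x y B : x != y -> movable x y B -> movable y x (swap x y B).
Proof.
by move=> xy _; rewrite /movable !in_swap eqxx /= eqxx eq_sym (negPf xy).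
Qed.

Lemma not_movable_swap x y B : movable x y B -> ~~ movable x y (swap x y B).
Proof. by move=> _; rewrite /movable !in_swap !eqxx /= andbF. Qed.

Lemma in_compress x y F B : x != y ->
  (B \in compress x y F) =
  if movable x y B then (B \in F) && (swap x y B \in F)
  else if movable y x B then (B \in F) || (swap y x B \in F) else B \in F.
Proof.
move=> xy; apply/imsetP/idP => [[C CF ->]|].
  rewrite /move_set; case: (boolP (movable x y C && (swap x y C \notin F))) => [/andP[mC sC]|].
    rewrite (negPf (not_movable_swap mC)) movable_swap //.
    by case/andP: mC => yC xC; rewrite swapK // CF orbT.
  rewrite negb_and negbK; case: ifP => [/= _ ->|_ _]; first by rewrite CF.
  by rewrite CF /=; case: ifP.
case: ifPn => [mB /andP[BF sB]|mB].
  by exists B; rewrite // /move_set mB sB.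
have BB : B \in F -> exists2 C, C \in F & B = move_set x y F C.
  by move=> BF; exists B; rewrite // /move_set (negPf mB).
case: ifPn => // /andP[xB yB]; case: (boolP (B \in F)) => [/BB//|BF] /= sB.
exists (swap y x B) => //; rewrite /move_set swapK // BF.
by rewrite movable_swap // 1?eq_sym // /movable xB.
Qed.

Lemma compress_notF x y F B : x != y -> B \in compress x y F -> B \notin F ->
  movable y x B /\ swap y x B \in F.
Proof.
move=> xy; rewrite in_compress //; case: ifP => _; first by case/andP=> ->.
by case: ifP => [_ /orP[->//|]|_ ->].
Qed.

Lemma compress_movable x y F B : x != y -> B \in compress x y F ->
  movable x y B -> B \in F /\ swap x y B \in F.
Proof. by move=> xy; rewrite in_compress // => + mB; rewrite mB => /andP. Qed.

Lemma move_set_inj x y F : x != y -> {in F &, injective (move_set x y F)}.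
Proof.
move=> xy B C BF CF; rewrite /move_set.
case: ifPn => [/andP[/andP[yB xB] sB]|_]; case: ifPn => [/andP[/andP[yC xC] sC]|_] //.
- by move=> e; rewrite -(swapK yB xB) e swapK.
- by move=> e; rewrite e CF in sB.
- by move=> e; rewrite -e BF in sC.
Qed.

Lemma card_compress x y F : x != y -> #|compress x y F| = #|F|.
Proof. by move=> xy; rewrite card_in_imset //; apply: move_set_inj. Qed.

Lemma compressS x y F G : x != y -> F \subset G -> compress x y F \subset compress x y G.
Proof.
move=> xy /subsetP FG; apply/subsetP => B; rewrite !in_compress //.
case: ifP => _; first by case/andP => /FG -> /FG ->.
by case: ifP => _; [case/orP => /FG ->; rewrite ?orbT|apply: FG].
Qed.

Lemma compress_closed_sub x y F D : x != y -> F \subset D -> closed_swap x y D ->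
  compress x y F \subset D.
Proof.
move=> xy /subsetP FD cD; apply/subsetP => _ /imsetP[B BF ->].
by rewrite /move_set; case: ifP => [/andP[mB _]|_]; [apply: cD|]; rewrite ?FD.
Qed.

Lemma compress_size x y F k : x != y -> (forall B, B \in F -> #|B| = k) ->
  forall B, B \in compress x y F -> #|B| = k.
Proof.
move=> xy Fk _ /imsetP[B BF ->]; rewrite /move_set.
by case: ifP => [/andP[/andP[yB xB] _]|_]; rewrite ?card_swap // Fk.
Qed.

(** Two moved sets share [x]. If [B] moves and [C] stays, the critical case is [y \in C] and
    [x \notin C]: then the swap of [C] is in [F] too, and a point that it shares with [B] lies in
    both [swap x y B] and [C]. *)
Lemma compress_intersecting x y F : x != y -> intersecting F ->
  intersecting (compress x y F).
Proof.
move=> xy iF.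
have half B C : B \in F -> C \in F -> movable x y B ->
    ~~ (movable x y C && (swap x y C \notin F)) -> swap x y B :&: C != set0.
  move=> BF CF /andP[yB xB]; rewrite negb_and negbK.
  case: (boolP (x \in C)) => [xC _|xC].
    by apply/set0Pn; exists x; rewrite inE in_swap eqxx.
  case: (boolP (y \in C)) => [yC|yC _].
    rewrite /movable yC xC /= => /(iF B _ BF)/set0Pn[z]; rewrite inE in_swap.
    case/andP=> zB /orP[/eqP e|/andP[zy zC]]; first by rewrite -e zB in xB.
    by apply/set0Pn; exists z; rewrite inE in_swap zy zB zC orbT.
  have /set0Pn[z] := iF _ _ BF CF; rewrite inE => /andP[zB zC].
  apply/set0Pn; exists z; rewrite inE in_swap zB zC andbT.
  by rewrite (contraNneq _ yC) ?orbT // => <-.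
move=> _ _ /imsetP[B BF ->] /imsetP[C CF ->]; rewrite /move_set.
case: ifPn => [/andP[mB _]|hB]; case: ifPn => [/andP[mC _]|hC].
- by apply/set0Pn; exists x; rewrite inE !in_swap eqxx.
- exact: half.
- by rewrite setIC; apply: half.
- exact: iF.
Qed.

(** For a face that arrived by a move, the set swapped back is in [D] and supplies the subsets. A
    movable face that stayed has its swap in [D] as well, which keeps its movable subsets in
    place. *)
Lemma compress_complex x y D : x != y -> is_complex D -> is_complex (compress x y D).
Proof.
move=> xy cD; split.
  have : (0 < #|compress x y D|)%N.
    by rewrite card_compress // card_gt0; case: cD.
  by rewrite card_gt0.
move=> A B AD BA.
have sw u w : swap u w B \subset swap u w A by apply: swap_sub.
have yx : y != x by rewrite eq_sym.
case: (boolP (A \in D)) => [AD'|AnD]; last first.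
  have [/andP[xA yA] sA] := compress_notF xy AD AnD.
  have yB : y \notin B by apply: contra yA; apply: (subsetP BA).
  rewrite in_compress // /movable (negPf yB) /=.
  case: (boolP (x \in B)) => xB /=.
    by rewrite (complexS cD sA (sw y x)) orbT.
  apply: complexS cD sA _; apply/subsetP => u uB; rewrite in_swap (subsetP BA) // andbT.
  by rewrite (contraNneq _ xB) ?orbT // => <-.
have BD : B \in D by apply: complexS cD AD' BA.
rewrite in_compress // BD /=; case: ifP => // mB.
  case: (boolP (x \in A)) => xA.
    apply: complexS cD AD' _; apply/subsetP => u; rewrite in_swap.
    by case/orP => [/eqP->//|/andP[_ /(subsetP BA)]].
  have mA : movable x y A by rewrite /movable xA (subsetP BA) //; case/andP: mB.
  by have [_ sA] := compress_movable xy AD mA; apply: complexS cD sA _.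
by rewrite if_same.
Qed.

Lemma fnum_compress x y D k : x != y -> fnum (compress x y D) k = fnum D k.
Proof.
move=> xy; rewrite /fnum -(card_compress (faces_of D k) xy); congr (#|pred_of_set _|).
apply/setP => B; rewrite mem_faces !in_compress // !mem_faces.
case: ifP => [/andP[yB xB]|_].
  by rewrite card_swap //; case: (B \in D); case: (#|B| == k); rewrite ?andbF.
case: ifP => [/andP[xB yB]|//]; rewrite card_swap //.
by case: (#|B| == k); rewrite ?andbF ?andbT.
Qed.

Variable rk : T -> nat.

(** Termination measure: every effective compression towards a smaller rank lowers it. *)
Definition weight F := \sum_(B in F) \sum_(u in B) rk u.

Lemma weight_swap x y B : movable x y B ->
  (\sum_(u in swap x y B) rk u + rk y = \sum_(u in B) rk u + rk x)%N.
Proof.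
case/andP => yB xB; rewrite big_setU1 ?inE ?(negPf xB) ?andbF //=.
by rewrite (big_setD1 y yB) /=; lia.
Qed.

Lemma weight_compress x y F : rk x < rk y -> ~ closed_swap x y F ->
  weight (compress x y F) < weight F.
Proof.
move=> ltxy nclo; have xy : x != y by apply: contraTneq ltxy => ->; rewrite ltnn.
case: (pickP (fun B => [&& B \in F, movable x y B & swap x y B \notin F])) => [B|none]; last first.
  case: nclo => B BF mB; have := none B; rewrite BF mB /=.
  by move/negbFE.
case/and3P => BF mB sB.
rewrite /weight big_imset /=; last exact: move_set_inj.
rewrite [ltnRHS](bigD1 B) //= [ltnLHS](bigD1 B) //=.
rewrite {1}/move_set mB sB /= -addSn; apply: leq_add.
  by have := weight_swap mB; lia.
apply: leq_sum => C /andP[CF _]; rewrite /move_set; case: ifP => // /andP[mC _].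
by have := weight_swap mC; lia.
Qed.

End Compression.

(** * The Hilton-Milner bound for shifted complexes *)

Section Ranked.
Variables (T : finType) (rk : T -> nat).
Hypotheses (rk_inj : injective rk) (rk_lt : forall u, rk u < #|T|).
Implicit Types (x y u w p : T) (A B C G : {set T}) (F D AA : {set {set T}}).

Definition shifted F := forall x y, rk x < rk y -> closed_swap x y F.

Definition seg a b : {set T} := [set u | a <= rk u < b].

Lemma rk_surj i : i < #|T| -> exists u, rk u = i.
Proof.
move=> lt; pose f u := Ordinal (rk_lt u).
have f_inj : injective f by move=> u w /(congr1 val) /rk_inj.
have := inj_card_onto f_inj; rewrite card_ord leqnn => /(_ isT (Ordinal lt)).
by case/codomP => u /(congr1 val) /= ->; exists u.
Qed.

Lemma card_seg a b : b <= #|T| -> #|seg a b| = b - a.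
Proof.
elim: b => [|b IH] lt; first by apply: eq_card0 => u; rewrite inE ltn0 andbF.
have [p ep] := rk_surj lt.
have [ab|ba] := leqP a b; last first.
  rewrite (_ : b.+1 - a = 0); last by lia.
  by apply: eq_card0 => u; rewrite !inE; lia.
have -> : seg a b.+1 = p |: seg a b.
  apply/setP => u; rewrite !inE -(inj_eq rk_inj) ep; lia.
rewrite cardsU1 IH ?inE ?ep; lia.
Qed.

(** Among the members of this size inside [seg a #|T|], one of least total rank must be the segment,
    since otherwise a swap would lower the total. *)
Lemma shifted_seg F B a : shifted F -> B \in F -> B \subset seg a #|T| ->
  seg a (a + #|B|) \in F.
Proof.
move=> sF BF Ba.
pose P C := [&& C \in F, #|C| == #|B| & C \subset seg a #|T|].
have PB : P B by rewrite /P BF eqxx Ba.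
case: (arg_minnP (fun C : {set T} => \sum_(u in C) rk u) PB) => C /and3P[CF /eqP cC Ca] minC.
(* For empty [B] the number [a] may exceed [#|T|], where [card_seg] does not apply. *)
have le : a + #|B| <= #|T| \/ B = set0.
  case: (eqVneq B set0) => [|B0]; [by right|left].
  have B1 : 0 < #|B| by rewrite card_gt0.
  by have := subset_leq_card Ba; rewrite card_seg //; lia.
case: le => [le|B0]; last first.
  by rewrite {1}B0 cards0 addn0 (_ : seg a a = B) // B0; apply/setP => u; rewrite !inE; lia.
have cS : #|seg a (a + #|B|)| = #|B| by rewrite card_seg //; lia.
suff -> : seg a (a + #|B|) = C by [].
apply/eqP; rewrite eqEcard cS cC leqnn andbT; apply: contraT => /subsetPn[x xS xC].
have [y yC yS] : exists2 y, y \in C & y \notin seg a (a + #|B|).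
  apply/subsetPn; apply: contra xC => CS.
  by have /eqP -> : C == seg a (a + #|B|) by rewrite eqEcard CS cS cC leqnn.
have ya := subsetP Ca y yC; rewrite !inE in xS yS ya.
have ltxy : rk x < rk y by lia.
have mC : movable x y C by rewrite /movable yC xC.
have sC := sF x y ltxy C CF mC.
have := minC (swap x y C); rewrite /P sC card_swap // cC eqxx /=.
have -> : swap x y C \subset seg a #|T|.
  apply/subsetP => u; rewrite in_swap => /orP[/eqP ->|/andP[_ /(subsetP Ca)//]].
  by rewrite inE rk_lt; clear -xS; lia.
by move=> /(_ isT); have := weight_swap rk mC; clear -ltxy; lia.
Qed.

(** The Hilton-Milner family consists of this star and the single set [seg 1 r.+1]; hence the [+ 1]
    in the bounds. *)
Definition star D r : {set {set T}} :=
  [set B in faces_of D r | ~~ [disjoint B & seg 0 1] && ~~ [disjoint B & seg 1 r.+1]].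

Lemma in_star D r B : (B \in star D r) =
  [&& B \in D, #|B| == r, ~~ [disjoint B & seg 0 1] & ~~ [disjoint B & seg 1 r.+1]].
Proof. by rewrite /star in_set mem_faces -andbA. Qed.

Definition facets_ge D m := forall B, B \in D -> exists2 G, G \in D & (B \subset G) && (m <= #|G|).

Lemma star_seg1 B p : rk p = 0 -> ~~ [disjoint B & seg 0 1] = (p \in B).
Proof.
move=> p0; rewrite (_ : seg 0 1 = [set p]) 1?disjoint_sym ?disjoints1 ?negbK //.
by apply/setP => u; rewrite !inE -(inj_eq rk_inj) p0; lia.
Qed.

(** The facets force [n = 2 * r] and make [D] the full simplex on [seg 0 n], so [r]-sets come in
    complementary pairs, and an intersecting family has at most one set of each. The map [phi] picks
    the one containing [p]; it lies in the star unless it misses [seg 1 r.+1], and then it is the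
    complement of that segment. *)
Lemma hilton_milner_base n r D AA : n <= #|T| -> n <= 2 * r -> is_complex D ->
  (forall B, B \in D -> B \subset seg 0 n) -> facets_ge D (2 * r) ->
  AA \subset faces_of D r -> intersecting AA -> seg 1 r.+1 \in AA ->
  #|AA| <= #|star D r| + 1.
Proof.
move=> nT n2r cD Dn fD AD iA HA.
have [G GD /andP[_ cG]] := fD _ (complex_set0 cD).
have n2 : n = 2 * r.
  have := subset_leq_card (Dn G GD); rewrite card_seg //; lia.
have eG : seg 0 n = G.
  by apply/esym/eqP; rewrite eqEcard Dn // card_seg //; lia.
have AAP B : B \in AA -> [/\ B \in D, #|B| = r & B \subset seg 0 n].
  by move=> /(subsetP AD); rewrite mem_faces => /andP[BD /eqP]; split=> //; apply: Dn.
have [_ cH _] := AAP _ HA.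
have [r0|r0] := posnP r.
  by have := iA _ _ HA HA; rewrite setIid -card_gt0 cH r0.
have [p p0] : exists p, rk p = 0 by apply: rk_surj; lia.
have pn : p \in seg 0 n by rewrite inE p0; lia.
pose phi B := if p \in B then B else seg 0 n :\: B.
have phi_inj : {in AA &, injective phi}.
  have cross B C : B \in AA -> C \in AA -> B = seg 0 n :\: C -> False.
    move=> BA CA e; have := iA _ _ BA CA.
    by rewrite e setIC setIDA setIC -setIDA setDv setI0 eqxx.
  move=> B C BA CA; rewrite /phi; case: ifP => pB; case: ifP => pC //.
  - by move/(cross _ _ BA CA).
  - by move/esym/(cross _ _ CA BA).
  have [_ _ Bn] := AAP _ BA; have [_ _ Cn] := AAP _ CA.
  move/(congr1 (fun X => seg 0 n :\: X)); rewrite !setDDr !setDv !set0U.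
  by rewrite (setIidPr Bn) (setIidPr Cn).
rewrite -(card_in_imset phi_inj) addn1 -add1n.
rewrite -(cards1 (seg 0 n :\: seg 1 r.+1)).
apply: leq_trans (leq_card_setU _ _).1.
apply/subset_leq_card/subsetP => _ /imsetP[B BA ->]; rewrite inE /phi.
have [BD cB Bn] := AAP _ BA.
case: ifPn => pB.
  rewrite in_star BD cB eqxx (star_seg1 _ p0) pB /= orbC.
  by rewrite -setI_eq0 iA.
case: (eqVneq B (seg 1 r.+1)) => [->|BH]; first by rewrite set11.
rewrite in_star (star_seg1 _ p0) [p \in _]inE pB pn /=.
have -> : seg 0 n :\: B \in D by rewrite eG in GD *; apply: complexS cD GD (subsetDl _ _).
have := cardsID B (seg 0 n); rewrite (setIidPr Bn) cB card_seg // => cDB.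
have -> : #|seg 0 n :\: B| == r by apply/eqP; clear -cDB n2; lia.
rewrite /= -setI_eq0 orbC; apply/orP; left; apply: contraNneq BH => e.
rewrite eq_sym eqEcard cH cB leqnn andbT; apply/subsetP => u uH.
apply: contraT => uB; have := in_set0 u; rewrite -e !inE uB /=.
by move: uH; rewrite !inE; clear -n2 r0; lia.
Qed.

Definition avoiding p F : {set {set T}} := [set B in F | p \notin B].
Definition through p F : {set {set T}} := [set C : {set T} | (p \notin C) && (p |: C \in F)].

Lemma in_avoiding p F B : (B \in avoiding p F) = (B \in F) && (p \notin B).
Proof. by rewrite in_set. Qed.

Lemma in_through p F C : (C \in through p F) = (p \notin C) && (p |: C \in F).
Proof. by rewrite in_set. Qed.

Lemma card_avoiding_through p F : #|F| = #|avoiding p F| + #|through p F|.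
Proof.
rewrite -(cardsID [set B : {set T} | p \notin B] F); congr (_ + _).
  by apply: eq_card => B; rewrite !inE.
rewrite -(card_in_imset (f := fun C => p |: C) (D := mem (through p F))); last first.
  move=> B C; rewrite !in_through => /andP[pB _] /andP[pC _] e.
  by rewrite -(setU1K pB) e setU1K.
apply: eq_card => B; rewrite in_setD in_set negbK.
apply/andP/imsetP => [[pB BA]|[C]].
  by exists (B :\ p); rewrite ?in_through ?setD11 setD1K.
by rewrite in_through => /andP[_ CA] ->; rewrite setU11.
Qed.

(** A face [G] through the last vertex [p] need not lose size: if an earlier vertex is missing from
    [G], it takes the place of [p]; otherwise [G :\ p] contains [seg 0 n], which has [n >= m]
    elements. *)
Lemma facets_avoiding n p D m : is_complex D -> rk p = n -> m <= n ->
  (forall B, B \in D -> B \subset seg 0 n.+1) -> shifted D ->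
  facets_ge D m -> facets_ge (avoiding p D) m.
Proof.
move=> cD ep mn Dn sD fD B; rewrite in_avoiding => /andP[BD pB].
have [G GD /andP[BG mG]] := fD _ BD.
case: (boolP (p \in G)) => pG; last by exists G; rewrite ?in_avoiding ?GD ?pG ?BG.
have BGp : B \subset G :\ p by rewrite subsetD1 BG.
have nT : n <= #|T| by rewrite -ep ltnW.
case: (boolP (seg 0 n \subset G :\ p)) => [full|/subsetPn[x xn xG]].
  exists (G :\ p); first by rewrite in_avoiding setD11 (complexS cD GD (subD1set _ _)).
  by rewrite BGp; have := subset_leq_card full; rewrite card_seg //; lia.
have ltxp : rk x < rk p by move: xn; rewrite ep inE.
have xp : x != p by apply: contraTneq ltxp => ->; rewrite ltnn.
have mG' : movable x p G by rewrite /movable pG; move: xG; rewrite !inE xp.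
exists (swap x p G).
  by rewrite in_avoiding (sD _ _ ltxp) // in_swap eq_sym (negPf xp) eqxx.
rewrite card_swap ?mG ?andbT; try by case/andP: mG'.
by apply: subset_trans BGp _; apply: subsetUr.
Qed.

Lemma through_shifted n p F : rk p = n ->
  (forall B, B \in F -> B \subset seg 0 n.+1) -> shifted F -> shifted (through p F).
Proof.
move=> ep Fn sF x y ltxy C; rewrite in_through => /andP[pC CF] /andP[yC xC].
have yn : rk y < n.+1.
  have := subsetP (Fn _ CF) y; rewrite !inE yC orbT => /(_ isT); lia.
have xp : x != p by rewrite -(inj_eq rk_inj) ep; lia.
have yp : y != p by apply: contraNneq pC => <-.
have mC : movable x y (p |: C) by rewrite /movable !inE yC orbT (negPf xp) xC.
have := sF x y ltxy _ CF mC.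
have -> : swap x y (p |: C) = p |: swap x y C.
  apply/setP => u; rewrite !inE; case: (u =P p) => [->|_]; rewrite ?orbT //=.
  by rewrite [p == y]eq_sym yp orbT.
by rewrite in_through in_swap (negPf pC) andbF orbF eq_sym xp => ->.
Qed.

(** Disjoint [B] and [C] would have [2 r - 2 < n] elements together, so an earlier vertex lies
    outside both; putting it in place of [p] in [p |: B] gives a member of [F] disjoint from
    [p |: C]. *)
Lemma through_intersecting n r p F : rk p = n -> (2 * r).-2 < n -> shifted F ->
  (forall B, B \in F -> #|B| = r) -> intersecting F -> intersecting (through p F).
Proof.
move=> ep rn sF Fr iF B C; rewrite !in_through => /andP[pB BF] /andP[pC CF].
apply/negP => /eqP BC0.
have nT : n <= #|T| by rewrite -ep ltnW.
have cB := Fr _ BF; have cC := Fr _ CF; rewrite !cardsU1 pB pC in cB cC.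
have /subsetPn[x xn xBC] : ~~ (seg 0 n \subset B :|: C).
  apply/negP => /subset_leq_card; rewrite card_seg //.
  by have := cardsUI B C; rewrite BC0 cards0; lia.
move: xBC; rewrite !inE negb_or => /andP[xB xC].
have ltxp : rk x < rk p by move: xn; rewrite ep inE.
have xp : x != p by apply: contraTneq ltxp => ->; rewrite ltnn.
have mB : movable x p (p |: B) by rewrite /movable setU11 !inE (negPf xp).
have := iF _ _ (sF x p ltxp _ BF mB) CF.
case/set0Pn => u; rewrite inE in_swap !inE => /andP[/orP[/eqP ->|]].
  by rewrite (negPf xp) (negPf xC).
case/andP => up; rewrite (negPf up) /= => uB uC.
by have := in_set0 u; rewrite -BC0 inE uB uC.
Qed.

(** The members avoiding the last vertex [p] already use up the [+ 1], so those through [p] have to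
    be bounded by the star alone. *)
Theorem shifted_hilton_milner n r D AA : 2 <= r -> n <= #|T| -> is_complex D ->
  (forall B, B \in D -> B \subset seg 0 n) -> shifted D -> facets_ge D (2 * r) ->
  AA \subset faces_of D r -> shifted AA -> intersecting AA -> seg 1 r.+1 \in AA ->
  #|AA| <= #|star D r| + 1.
Proof.
elim: n r D AA => [|n IH] r D AA r2 nT cD Dn sD fD AD sA iA HA.
  by apply: (hilton_milner_base (n := 0)).
have [le|n2r] := leqP n.+1 (2 * r); first exact: (hilton_milner_base (n := n.+1)).
have [p ep] := rk_surj nT.
have AAP B : B \in AA -> B \in D /\ #|B| = r.
  by move=> /(subsetP AD); rewrite mem_faces => /andP[BD /eqP].
have HP : p \notin seg 1 r.+1 by rewrite inE ep; lia.
have [_ cH] := AAP _ HA.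
have p1 : p \notin seg 0 1 by rewrite inE ep; lia.
pose D1 := avoiding p D; pose D2 := link D [set p].
rewrite (card_avoiding_through p AA) (card_avoiding_through p (star D r)).
have -> : avoiding p (star D r) = star D1 r.
  apply/setP => B; rewrite in_avoiding !in_star in_avoiding.
  by case: (p \notin B); rewrite ?andbF ?andbT.
have memD2 C : p \notin C -> (C \in D2) = (p |: C \in D) by move=> pC; apply: link1_face.
have D2P C : C \in D2 -> p \notin C by case/linkP => _; rewrite disjoints1.
have D2E : D2 = through p D.
  apply/setP => C; rewrite in_through; case: (boolP (p \in C)) => pC /=.
    by apply/negP => /D2P; rewrite pC.
  exact: memD2.
have below F : (forall B, B \in F -> B \in D) ->
    forall C, C \in through p F -> C \subset seg 0 n.
  move=> FD C; rewrite in_through => /andP[pC /FD /Dn/subsetP h]; apply/subsetP => u uC.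
  have := h u; rewrite !inE uC orbT => /(_ isT).
  have : u != p by apply: contraNneq pC => <-.
  by rewrite -(inj_eq rk_inj) ep; clear; lia.
have le1 : #|avoiding p AA| <= #|star D1 r| + 1.
  apply: IH => //; try exact: ltnW.
  - split=> [|B C]; first by apply/set0Pn; exists set0; rewrite in_avoiding complex_set0 ?inE.
    rewrite !in_avoiding => /andP[BD pB] CB; rewrite (complexS cD BD CB) /=.
    by apply: contra pB; apply: (subsetP CB).
  - move=> B; rewrite in_avoiding => /andP[BD pB]; apply/subsetP => u uB.
    have : u != p by apply: contraNneq pB => <-.
    by have := subsetP (Dn B BD) u uB; rewrite -(inj_eq rk_inj) ep !inE; clear; lia.
  - move=> x y ltxy B; rewrite !in_avoiding => /andP[BD pB] mB.
    have := mB; case/andP => yB xB.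
    rewrite (sD x y) //= in_swap negb_or (negPf pB) andbF andbT eq_sym.
    have := subsetP (Dn B BD) y yB; rewrite inE -(inj_eq rk_inj) ep; clear -ltxy; lia.
  - by apply: (facets_avoiding (n := n)).
  - by apply/subsetP => B; rewrite mem_faces !in_avoiding => /andP[/AAP[-> ->] ->]; rewrite eqxx.
  - move=> x y ltxy B; rewrite !in_avoiding => /andP[BA pB] mB.
    have := mB; case/andP => yB xB; have [BD _] := AAP _ BA.
    rewrite (sA x y) //= in_swap negb_or (negPf pB) andbF andbT eq_sym.
    have := subsetP (Dn B BD) y yB; rewrite inE -(inj_eq rk_inj) ep; clear -ltxy; lia.
  - by move=> B C; rewrite !in_avoiding => /andP[BA _] /andP[CA _]; apply: iA.
  - by rewrite in_avoiding HA.
suff le2 : #|through p AA| <= #|through p (star D r)| by clear -le1 le2; lia.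
pose A2 := through p AA.
have A2D C : C \in A2 -> C \in D2.
  by rewrite D2E !in_through => /andP[-> /AAP[]].
have A2c C : C \in A2 -> #|C| = r.-1.
  by rewrite in_through => /andP[pC /AAP[_]]; rewrite cardsU1 pC; clear; lia.
have iA2 : intersecting A2.
  by apply: (through_intersecting (n := n) (r := r)) => //; [clear -n2r r2; lia|move=> B /AAP[]].
have sA2 : shifted A2.
  by apply: (through_shifted ep) => // B /AAP[/Dn].
have sD2 : shifted D2 by rewrite D2E; apply: (through_shifted ep).
have dpU C (E : {set T}) : p \notin E -> [disjoint p |: C & E] = [disjoint C & E].
  by move=> pE; rewrite -setI_eq0 setIUl setU_eq0 !setI_eq0 disjoints1 pE.
have star2 C : p \notin C -> (p |: C \in star D r) =
    [&& C \in D2, #|C| == r.-1, ~~ [disjoint C & seg 0 1] & ~~ [disjoint C & seg 1 r.+1]].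
  move=> pC; rewrite in_star memD2 // !dpU // cardsU1 pC.
  by congr (_ && (_ && _)); clear -r2; lia.
have [p0 rk0] : exists p0, rk p0 = 0 by apply: rk_surj; clear -nT; lia.
(* If every [C] contains the first vertex, it is counted by the star, because [p |: C] meets
   [seg 1 r.+1]. Otherwise shiftedness puts [seg 1 r] into [A2], and induction for [r.-1] on the
   link of [p] applies, with a surplus of one to be absorbed. *)
case: (boolP [forall C in A2, p0 \in C]) => [/forall_inP all0|].
  apply/subset_leq_card/subsetP => C CA; have := CA; rewrite !in_through => /andP[pC pCA].
  rewrite pC star2 // A2D // A2c // eqxx (star_seg1 _ rk0) all0 //=.
  by rewrite -(dpU _ _ HP) -setI_eq0 iA.
rewrite negb_forall_in => /exists_inP[C0 C0A pC0].
have C01 : C0 \subset seg 1 #|T|.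
  apply/subsetP => u uC; rewrite inE rk_lt andbT lt0n; apply: contraNneq pC0 => u0.
  by rewrite (_ : p0 = u) //; apply: rk_inj; rewrite rk0.
have := shifted_seg sA2 C0A C01; rewrite (A2c _ C0A) (_ : 1 + r.-1 = r); last by clear -r2; lia.
move=> H2A.
(* For [r = 2] the members of [A2] are singletons, and shifting one of them produces a disjoint
   one. *)
have [r3|r3] := leqP r 2.
  have er : r = 2 by clear -r2 r3; lia.
  have [p1' rk1] : exists p1, rk p1 = 1 by apply: rk_surj; clear -nT n2r r2; lia.
  have eH : seg 1 r = [set p1'].
    by apply/setP => u; rewrite !inE -(inj_eq rk_inj) rk1 er; clear; lia.
  rewrite eH in H2A.
  have lt01 : rk p0 < rk p1' by rewrite rk0 rk1.
  have ne01 : p0 != p1' by apply: contraTneq lt01 => ->; rewrite ltnn.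
  have m1 : movable p0 p1' [set p1'] by rewrite /movable !inE eqxx.
  have := iA2 _ _ H2A (sA2 _ _ lt01 _ H2A m1); case/set0Pn => u.
  rewrite inE in_swap !inE => /andP[/eqP ->]; rewrite eqxx orbF eq_sym.
  by rewrite (negPf ne01).
have cD2 : is_complex D2.
  apply: link_complex => //; have [C0D _] := AAP _ (andP (etrans (esym (in_through _ _ _)) C0A)).2.
  by apply: complexS cD C0D _; rewrite sub1set setU11.
have fD2 : facets_ge D2 (2 * r).-1.
  move=> C CD; have pC := D2P _ CD; move: CD; rewrite memD2 // => /fD[G GD /andP[CG cG]].
  have pG : p \in G by rewrite (subsetP CG) ?setU11.
  exists (G :\ p); first by rewrite memD2 ?setD11 // setD1K.
  rewrite subsetD1 pC (subset_trans (subsetUr _ _) CG) /=.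
  by have := cardsD1 p G; rewrite pG; move: cG; clear; lia.
have le2 : #|A2| <= #|star D2 r.-1| + 1.
  apply: IH => //; try exact: ltnW.
  - by clear -r3; lia.
  - by rewrite D2E; apply: below.
  - by move=> C /fD2[G GD /andP[CG cG]]; exists G => //; rewrite CG; move: cG; clear; lia.
  - by apply/subsetP => C CA; rewrite mem_faces A2D // A2c // eqxx.
  - by rewrite (ltn_predK r2).
apply: leq_trans le2 _.
(* a member of [through p (star D r)] outside [star D2 r.-1] *)
pose E := seg 0 1 :|: seg r (2 * r).-2.
have [G GD cG] : exists2 G, G \in D2 & #|G| = (2 * r).-1.
  have [G GD /andP[_ cG]] := fD2 _ (A2D _ C0A).
  have [s [us ss sG]] := card_geqP cG.
  exists [set u in s]; last by rewrite cardsE (card_uniqP us).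
  by apply: complexS cD2 GD _; apply/subsetP => u; rewrite inE => /sG.
have segD : seg 0 (2 * r).-1 \in D2.
  have G0 : G \subset seg 0 #|T| by apply/subsetP => u _; rewrite inE rk_lt.
  by have := shifted_seg sD2 GD G0; rewrite cG.
have ED : E \in D2.
  by apply: complexS cD2 segD _; apply/subsetP => u; rewrite !inE; clear -r3; lia.
have cE : #|E| = r.-1.
  have c1 : #|seg 0 1| = 1 by rewrite card_seg //; clear -nT; lia.
  have c2 : #|seg r (2 * r).-2| = r.-2 by rewrite card_seg; clear -r2 n2r nT; lia.
  have := cardsUI (seg 0 1) (seg r (2 * r).-2); rewrite (_ : _ :&: _ = set0); last first.
    by apply/setP => u; rewrite !inE; clear -r3; lia.
  by rewrite cards0 c1 c2 -/E; clear -r3; lia.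
have EnS : E \notin star D2 r.-1.
  rewrite in_star (ltn_predK r2).
  rewrite [X in ~~ X && _]disjoint_sym.
  have -> : [disjoint E & seg 1 r].
    by rewrite -setI_eq0; apply/eqP/setP => u; rewrite !inE; clear -r3; lia.
  by rewrite !andbF.
have := cardsU1 E (star D2 r.-1); rewrite EnS addnC => <-.
have [pr rkr] : exists pr, rk pr = r by apply: rk_surj; clear -nT n2r r2; lia.
apply/subset_leq_card/subsetP => C; rewrite in_setU1 in_through => /orP[/eqP ->|].
  have pE := D2P _ ED; rewrite pE star2 // ED cE eqxx (star_seg1 _ rk0) /=.
  rewrite !inE rk0 /= -setI_eq0; apply/set0Pn; exists pr.
  by rewrite !inE rkr; clear -r3; lia.
rewrite [_ \in star D2 _]in_star => /and4P[CD cC C0S CH].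
have pC := D2P _ CD; rewrite pC star2 // CD cC C0S /=.
apply: contra CH; rewrite (ltn_predK r2).
apply: disjointWr; apply/subsetP => u; rewrite !inE; clear; lia.
Qed.

End Ranked.

(** * Families split by their trace on [V] *)

Section Glue.
Variables (T : finType) (V : {set T}).
Implicit Types (S B C : {set T}) (G : {set {set T}}) (F : {set T} -> {set {set T}}).

(** Here [F S] holds the outer parts of the members with trace [S], so that an operation outside [V]
    can be carried out trace by trace. *)
Definition glue F : {set {set T}} := [set B : {set T} | B :\: V \in F (B :&: V)].

Lemma in_glue F B : (B \in glue F) = (B :\: V \in F (B :&: V)).
Proof. by rewrite inE. Qed.

Lemma setUIV S C : S \subset V -> C \subset ~: V -> (S :|: C) :&: V = S.
Proof.
move=> SV CV; rewrite setIUl (setIidPl SV); apply/setUidPl.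
by rewrite (_ : C :&: V = set0) ?sub0set //; apply/eqP; rewrite setI_eq0 disjoints_subset.
Qed.

Lemma setUDV S C : S \subset V -> C \subset ~: V -> (S :|: C) :\: V = C.
Proof.
move=> SV CV; rewrite setDUl (_ : S :\: V = set0) ?set0U; last by apply/eqP; rewrite setD_eq0.
by apply/setDidPl; rewrite disjoints_subset.
Qed.

Lemma card_glue F : (forall S, F S \subset powerset (~: V)) ->
  #|glue F| = \sum_(S in powerset V) #|F S|.
Proof.
move=> FV; rewrite -sum1_card (partition_big (fun B => B :&: V) (mem (powerset V))) /=; last first.
  by move=> B _; rewrite inE subsetIr.
apply: eq_bigr => S; rewrite inE => SV; rewrite sum1_card.
rewrite -(card_in_imset (f := fun C => S :|: C) (D := mem (F S))); last first.
  move=> C C' CF CF'; have := subsetP (FV S) _ CF; have := subsetP (FV S) _ CF'.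
  rewrite !inE => C'V CV e; by rewrite -(setUDV SV CV) e setUDV.
apply: eq_card => B; apply/andP/imsetP => [[]|[C CF ->]].
  rewrite in_glue => BF /eqP eS; exists (B :\: V); first by rewrite -eS.
  by rewrite -eS setID.
have := subsetP (FV S) _ CF; rewrite inE => CV.
by rewrite in_glue setUIV // setUDV // CF.
Qed.

Definition trace_family (A : {set {set T}}) S : {set {set T}} :=
  [set C : {set T} | (C \subset ~: V) && (S :|: C \in A)].

Lemma glue_trace A : glue (trace_family A) = A.
Proof.
apply/setP => B; rewrite in_glue inE setDE subsetIr /= -setDE.
by rewrite setID.
Qed.

(** For [G] without vertices in [V], this is the join of [G] with the full simplex on [V]. *)
Definition with_V (G : {set {set T}}) : {set {set T}} := glue (fun=> G).

Lemma in_with_V G B : (B \in with_V G) = (B :\: V \in G).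
Proof. exact: in_glue. Qed.

Lemma with_V_complex G : is_complex G -> is_complex (with_V G).
Proof.
move=> cG; split.
  by apply/set0Pn; exists set0; rewrite in_with_V set0D complex_set0.
by move=> B C; rewrite !in_with_V => BG CB; apply: complexS cG BG _; apply: setSD.
Qed.

(** Over a fixed trace [S] one counts the faces of [G] of size [r - #|S|], so only face numbers
    enter, and these survive shifting and compression. *)
Lemma card_with_V_faces (G G' : {set {set T}}) r (P : pred {set T}) :
  G \subset powerset (~: V) -> G' \subset powerset (~: V) ->
  (forall k, fnum G k = fnum G' k) ->
  #|[set B in faces_of (with_V G) r | P (B :&: V)]| =
  #|[set B in faces_of (with_V G') r | P (B :&: V)]|.
Proof.
move=> GV GV' fGG'.
pose F (H : {set {set T}}) S :=
  if P S && (#|S| <= r) then faces_of H (r - #|S|) else set0.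
have eF H : [set B in faces_of (with_V H) r | P (B :&: V)] = glue (F H).
  apply/setP => B; rewrite in_set mem_faces in_with_V in_glue /F.
  have := cardsID V B; case: (P _); rewrite ?andbF ?andbT /= ?in_set0 //.
  case: (leqP #|B :&: V| r) => le e; rewrite ?in_set0 ?mem_faces.
    by congr (_ && _); move: e le; clear; lia.
  by apply/negP => /andP[_]; move: e le; clear; lia.
have FV (H : {set {set T}}) : H \subset powerset (~: V) -> forall S, F H S \subset powerset (~: V).
  move=> HV S; rewrite /F; case: ifP => _; last exact: sub0set.
  by apply: subset_trans HV; apply/subsetP => B; rewrite mem_faces => /andP[].
rewrite !eF !card_glue; try exact: FV.
apply: eq_bigr => S _; rewrite /F; case: ifP => // _; exact: fGG'.
Qed.

End Glue.

(** * Compressing the complex and the family together *)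

Section Joint.
Variables (T : finType) (rk : T -> nat).
Hypotheses (rk_inj : injective rk) (rk_lt : forall u, rk u < #|T|).
Implicit Types (x y u w p : T) (A B C G : {set T}) (F D AA : {set {set T}}).
Notation seg := (seg rk).

Lemma setU_eqD A B C : A :\: C = B :\: C -> C :|: A = C :|: B.
Proof.
by move=> /setP e; apply/setP => u; have := e u; rewrite !inE; case: (u \in C).
Qed.

(** The trace that depth [m] leaves on an algebraically shifted complex; the quantity bounded by [m]
    is the size of the enlarged face. *)
Definition initial a m D := forall C j, C \in D -> a + j <= #|T| ->
  #|C :\: seg a (a + j)| + j <= m -> seg a (a + j) :|: C \in D.

(** Three cases. If [y] is in the segment [I], so is [x], and [I :|: C] cannot be moved in either
    direction. If only [x] is in [I], then [C :\ x] is in [D] and has the same union with [I]. If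
    neither is, swapping commutes with adding [I]. *)
Lemma compress_initial a m x y D : is_complex D -> a <= rk x -> rk x < rk y ->
  initial a m D -> initial a m (compress x y D).
Proof.
move=> cD ax ltxy iD C j CD aj; set I := seg a _ => le.
have xy : x != y by apply: contraTneq ltxy => ->; rewrite ltnn.
have mem u : (u \in I :|: C) = (u \in I) || (u \in C) by rewrite inE.
have ext B : B \in D -> B :\: I = C :\: I -> I :|: B \in D.
  by move=> BD e; apply: iD; rewrite // e.
case: (boolP (y \in I)) => yI.
  have xI : x \in I by move: yI ltxy ax; rewrite !inE; clear; lia.
  rewrite in_compress // /movable !mem xI yI /=.
  case: (boolP (C \in D)) => [CD'|nCD]; first exact: ext.
  have [/andP[xC yC] sC] := compress_notF xy CD nCD.
  have eC : swap y x C :\: I = C :\: I.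
    apply/setP => u; rewrite in_setD in_swap in_setD; case: (u =P y) => [->|_]; first by rewrite yI.
    by case: (u =P x) => [->|_] //=; rewrite xI.
  by rewrite -(setU_eqD eC); apply: ext.
case: (boolP (x \in I)) => xI.
  rewrite in_compress // /movable !mem (negPf yI) xI /= ?andbF /=.
  case: (boolP (C \in D)) => [CD'|nCD]; first by rewrite ext // if_same.
  have [/andP[xC yC] sC] := compress_notF xy CD nCD.
  have CxD : C :\ x \in D.
    apply: complexS cD sC _; apply/subsetP => u; rewrite in_setD1 in_swap => /andP[-> ->].
    by rewrite orbT.
  have eC : (C :\ x) :\: I = C :\: I.
    by apply/setP => u; rewrite !in_setD in_set1; case: (u =P x) => [->|_] //=; rewrite xI.
  by rewrite -(setU_eqD eC) ext // if_same.
have swI u w B : u \notin I -> w \notin I -> swap u w (I :|: B) = I :|: swap u w B.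
  move=> uI wI; apply/setP => z; rewrite in_setU !in_swap in_setU.
  case: (z =P u) => [_|_]; rewrite ?orbT //=.
  by case: (z =P w) => [->|_] //=; rewrite (negPf wI).
have swD u w B : u \notin I -> w \notin I -> swap u w B :\: I = swap u w (B :\: I).
  move=> uI wI; apply/setP => z; rewrite in_setD !in_swap in_setD.
  case: (z =P u) => [->|_]; rewrite ?uI //=.
  by case: (z =P w) => [->|_] //=; rewrite ?wI ?andbF.
have extw u w : u \notin I -> w \notin I -> movable u w C -> swap u w C \in D ->
    swap u w (I :|: C) \in D.
  move=> uI wI /andP[wC uC] sD; rewrite swI //; apply: iD => //.
  by rewrite swD // card_swap // in_setD ?wI ?wC ?(negPf uC) ?andbF.
have ext' : C \in D -> I :|: C \in D by move=> CD'; apply: ext.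
have mm u w : u \notin I -> w \notin I -> movable u w (I :|: C) = movable u w C.
  by move=> /negPf uI /negPf wI; rewrite /movable !in_setU uI wI.
move: CD; rewrite !in_compress // !mm //.
case: ifP => [mC /andP[/ext' -> sC]|_]; first by rewrite extw.
case: ifP => [mC /orP[/ext' ->//|sC]|_]; last exact: ext'.
by rewrite extw // orbT.
Qed.

(** Adding to [B] the first missing vertex [u] is the same as adding the whole segment up to [u], so
    [initial] lets [B] grow while [#|B| < m]. *)
Lemma initial_facets_ge a m D : is_complex D -> a + m <= #|T| ->
  (forall B, B \in D -> B \subset seg a #|T|) -> initial a m D -> facets_ge D m.
Proof.
move=> cD am Da iD B; move: {2}(m - #|B|) (leqnn (m - #|B|)) => n.
elim: n B => [|n IH] B le BD; first by exists B; rewrite // subxx /=; move: le; clear; lia.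
have [mB|Bm] := leqP m #|B|; first by exists B; rewrite // subxx.
have [u uW uB] : exists2 u, u \in seg a #|T| & u \notin B.
  apply/subsetPn/negP => /subset_leq_card; rewrite card_seg //.
  by move: am Bm; clear; lia.
pose P u := (u \in seg a #|T|) && (u \notin B).
have Pu : P u by rewrite /P uW.
case: (arg_minnP rk Pu) => {Pu uW uB}u /andP[uW uB] umin.
have au : a <= rk u by move: uW; rewrite inE => /andP[].
have [j ej] : exists j, rk u = a + j by exists (rk u - a); move: au; clear; lia.
pose I := seg a (a + j.+1).
have IB : I \subset u |: B.
  apply/subsetP => w wI; rewrite in_setU1; case: (w =P u) => //= wu.
  apply: contraT => wB; have := umin w; rewrite /P wB.
  have ltwu : rk w < rk u.
    have : rk w != rk u by rewrite (inj_eq rk_inj); apply/eqP.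
    by move: wI; rewrite inE ej; clear; lia.
  have -> : w \in seg a #|T| by move: wI; rewrite !inE rk_lt; clear; lia.
  by move=> /(_ isT); move: ltwu; clear; lia.
have uI : u \in I by rewrite inE ej; clear; lia.
have eIB : I :|: B = u |: B.
  apply/eqP; rewrite eqEsubset subUset IB subsetUr /= subUset sub1set.
  by rewrite in_setU uI subsetUr.
have aj : a + j.+1 <= #|T| by have := rk_lt u; rewrite ej; clear; lia.
have cI : #|I| = j.+1 by rewrite card_seg //; clear; lia.
have cuB : #|u |: B| = #|B|.+1 by rewrite cardsU1 uB.
have uBD : u |: B \in D.
  rewrite -eIB; apply: iD => //; rewrite -/I.
  have := cardsID I (u |: B); rewrite (setIidPr IB) cI cuB.
  have -> : (u |: B) :\: I = B :\: I by rewrite setDUl (_ : [set u] :\: I = set0) ?set0U //; apply/eqP; rewrite setD_eq0 sub1set.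
  by move: Bm; clear; lia.
have [|G GD /andP[uG mG]] := IH (u |: B) _ uBD.
  by rewrite cuB; move: le; clear; lia.
by exists G; rewrite // mG (subset_trans (subsetUr _ _) uG).
Qed.

Lemma weight_compress_le x y F : rk x < rk y -> weight rk (compress x y F) <= weight rk F.
Proof.
move=> ltxy; have xy : x != y by apply: contraTneq ltxy => ->; rewrite ltnn.
case: (classic (closed_swap x y F)) => [cl|/(weight_compress ltxy)/ltnW //].
suff -> : compress x y F = F by [].
apply/eqP; rewrite eqEcard card_compress // leqnn andbT.
exact: compress_closed_sub.
Qed.

Variables (r m : nat).
Notation V := (seg 0 r.+1).

(** Invariant of the joint compression; [D0] and [k] remember the original face numbers and the size
    of the family. *)
Definition admissible D0 k D AA : Prop :=
  [/\ is_complex D, D \subset powerset (~: V), forall i, fnum D i = fnum D0 i,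
      initial r.+1 m D &
  [/\ AA \subset faces_of (with_V V D) r, #|AA| = k, intersecting AA &
      forall S : {set T}, S \subset V -> #|S| = r -> S \in AA]].

Lemma mem_V u : (u \in V) = (rk u < r.+1).
Proof. by rewrite inE. Qed.

Lemma swap_outside x y B : x \notin V -> y \notin V ->
  swap x y B :\: V = swap x y (B :\: V).
Proof.
move=> xV yV; apply/setP => u; rewrite in_setD !in_swap in_setD.
by case: (u =P x) => [->|_]; rewrite ?xV //= andbCA.
Qed.

Lemma movable_outside x y B : x \notin V -> y \notin V ->
  movable x y (B :\: V) = movable x y B.
Proof. by move=> xV yV; rewrite /movable !in_setD xV yV. Qed.

Lemma with_V_compress x y D : x \notin V -> y \notin V -> x != y ->
  compress x y (with_V V D) = with_V V (compress x y D).
Proof.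
move=> xV yV xy; apply/setP => B; rewrite in_with_V !in_compress // !in_with_V.
by rewrite !movable_outside // !swap_outside.
Qed.

Lemma with_V_closed_in x y D : is_complex D -> x \in V -> closed_swap x y (with_V V D).
Proof.
move=> cD xV B; rewrite !in_with_V => BD _; apply: complexS cD BD _.
apply/subsetP => u; rewrite in_setD in_swap in_setD; case: (u =P x) => [->|_] /=.
  by rewrite xV.
by case/and3P => -> _ ->.
Qed.

Lemma with_V_closed_out x y D : x \notin V -> y \notin V ->
  closed_swap x y D -> closed_swap x y (with_V V D).
Proof.
move=> xV yV cl B; rewrite !in_with_V swap_outside // -(movable_outside B xV yV).
exact: cl.
Qed.

Lemma compress_r_subsets x y AA : rk x < rk y ->
  (forall S : {set T}, S \subset V -> #|S| = r -> S \in AA) ->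
  forall S : {set T}, S \subset V -> #|S| = r -> S \in compress x y AA.
Proof.
move=> ltxy full S SV cS; have xy : x != y by apply: contraTneq ltxy => ->; rewrite ltnn.
have SA := full S SV cS; rewrite in_compress // SA /= if_same.
case: ifP => // /andP[yS xS]; apply: full; last by rewrite card_swap.
apply/subsetP => u; rewrite in_swap => /orP[/eqP ->|/andP[_ /(subsetP SV)] //].
by have := subsetP SV y yS; rewrite !mem_V; move: ltxy; clear; lia.
Qed.

Lemma admissible_compress_out D0 k D AA x y : r < rk x -> rk x < rk y ->
  admissible D0 k D AA -> admissible D0 k (compress x y D) (compress x y AA).
Proof.
move=> rx ltxy [cD DV fD iD [AD cA iA full]].
have xy : x != y by apply: contraTneq ltxy => ->; rewrite ltnn.
have xV : x \notin V by rewrite mem_V -leqNgt.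
have yV : y \notin V by rewrite mem_V -leqNgt; move: rx ltxy; clear; lia.
split.
- exact: compress_complex.
- apply/subsetP => _ /imsetP[B BD ->].
  have BV : B \subset ~: V by have := subsetP DV B BD; rewrite inE.
  rewrite inE /move_set; case: ifP => _ //; apply/subsetP => u.
  by rewrite in_swap => /orP[/eqP ->|/andP[_ /(subsetP BV)] //]; rewrite in_setC.
- by move=> i; rewrite fnum_compress.
- exact: compress_initial.
split.
- apply/subsetP => B BA; rewrite mem_faces -with_V_compress //.
  have AV : AA \subset with_V V D.
    by apply: subset_trans AD _; apply/subsetP => C; rewrite mem_faces => /andP[].
  rewrite (subsetP (compressS xy AV)) //=; apply/eqP.
  apply: (compress_size xy (F := AA)) BA => C /(subsetP AD).
  by rewrite mem_faces => /andP[_ /eqP].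
- by rewrite card_compress.
- exact: compress_intersecting.
- exact: compress_r_subsets.
Qed.

(** The join with the simplex on [V] is closed under swaps towards a vertex of [V], so only the
    family has to change. *)
Lemma admissible_compress_in D0 k D AA x y : rk x <= r -> rk x < rk y ->
  admissible D0 k D AA -> admissible D0 k D (compress x y AA).
Proof.
move=> xr ltxy [cD DV fD iD [AD cA iA full]].
have xy : x != y by apply: contraTneq ltxy => ->; rewrite ltnn.
have xV : x \in V by rewrite mem_V.
split=> //; split.
- apply: compress_closed_sub => // B; rewrite !mem_faces => /andP[BD cB] mB.
  by rewrite with_V_closed_in //= card_swap //; case/andP: mB.
- by rewrite card_compress.
- exact: compress_intersecting.
- exact: compress_r_subsets.
Qed.

Lemma not_shifted F : ~ shifted rk F -> exists x y, rk x < rk y /\ ~ closed_swap x y F.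
Proof.
move=> ns; apply: NNPP => none; apply: ns => x y ltxy; apply: NNPP => ncl.
by apply: none; exists x, y.
Qed.

(** Induction on the total weight of [D] and [AA]. Outside [V] both are compressed at once, to keep
    the members of [AA] faces of the join. *)
Lemma admissible_shifted D0 k D AA : admissible D0 k D AA ->
  exists D' AA', [/\ admissible D0 k D' AA', shifted rk AA' & shifted rk (with_V V D')].
Proof.
move: {2}(weight rk D + weight rk AA) (leqnn (weight rk D + weight rk AA)) => n.
elim: n D AA => [|n IH] D AA le adm.
  have wD x y F : rk x < rk y -> weight rk F = 0 -> closed_swap x y F.
    move=> ltxy w0; apply: NNPP => /(weight_compress ltxy); rewrite w0; by [].
  exists D, AA; split=> // x y ltxy; first by apply: wD => //; move: le; clear; lia.
  have [cD _ _ _ _] := adm.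
  have [xr|rx] := leqP (rk x) r; first by apply: with_V_closed_in; rewrite // mem_V.
  apply: with_V_closed_out; rewrite ?mem_V; try (move: rx ltxy; clear; lia).
  by apply: wD => //; move: le; clear; lia.
case: (classic (shifted rk AA /\ shifted rk (with_V V D))) => [[sA sD]|ns].
  by exists D, AA.
have [x [y [ltxy [xr|[rx ncl]]]]] : exists x y, rk x < rk y /\
    ((rk x <= r /\ ~ closed_swap x y AA) \/
     (r < rk x /\ (~ closed_swap x y AA \/ ~ closed_swap x y D))).
- case: (classic (shifted rk AA)) => [sA|/not_shifted[x [y [ltxy ncl]]]].
    case: (classic (shifted rk (with_V V D))) => [sD|/not_shifted[x [y [ltxy ncl]]]].
      by case: ns.
    exists x, y; split=> //; right; have [cD _ _ _ _] := adm.
    have [xr|rx] := leqP (rk x) r.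
      by case: ncl; apply: with_V_closed_in; rewrite // mem_V.
    split=> //; right => cl; apply: ncl; apply: with_V_closed_out => //;
     rewrite ?mem_V; move: rx ltxy; clear; lia.
  exists x, y; split=> //; have [xr|rx] := leqP (rk x) r; [by left|right].
  by split=> //; left.
- case: xr => xr ncl; apply: (IH D (compress x y AA)).
    by have := weight_compress ltxy ncl; move: le; clear; lia.
  exact: admissible_compress_in.
apply: (IH (compress x y D) (compress x y AA)); last exact: admissible_compress_out.
have := weight_compress_le D ltxy; have := weight_compress_le AA ltxy.
by case: ncl => /(weight_compress ltxy); move: le; clear; lia.
Qed.

End Joint.

(** * From nontrivial to complete intersecting families *)

Section Nontrivial.
Variables (T : finType) (D : {set {set T}}) (r : nat) (v : 'I_r.+1 -> T).
Hypotheses (cD : is_complex D) (r2 : 2 <= r) (v_inj : injective v).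
Hypothesis extD : forall B, B \in D -> #|B| <= 2 * r ->
  exists C, [/\ C \in D, B \subset C & #|C| = 2 * r].
Hypothesis sD : shifted_wrt D v.
Implicit Types (x y z u w : T) (B C S R X : {set T}) (A F : {set {set T}}) (i j : 'I_r.+1).

Definition vset : {set T} := [set v i | i : 'I_r.+1].
Notation V := vset.

(** All vertices outside [V] share the position [r.+1]: the complex allows swaps towards [V], but
    none among the other vertices is assumed. *)
Definition vpos u : nat := if [pick i | v i == u] is Some i then i else r.+1.

Lemma vpos_v i : vpos (v i) = i.
Proof.
rewrite /vpos; case: pickP => [j /eqP/v_inj -> //|/(_ i)]; by rewrite eqxx.
Qed.

Lemma mem_vset i : v i \in V.
Proof. exact: imset_f. Qed.

Lemma vsetP u : reflect (exists i, u = v i) (u \in V).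
Proof. by apply: (iffP imsetP) => [[i _ ->]|[i ->]]; exists i. Qed.

Lemma vpos_out u : u \notin V -> vpos u = r.+1.
Proof.
rewrite /vpos => uV; case: pickP => // i /eqP e; by rewrite -e mem_vset in uV.
Qed.

Lemma card_vset : #|V| = r.+1.
Proof. by rewrite card_imset // card_ord. Qed.

Lemma closed_swap_v i w : i < vpos w -> closed_swap (v i) w D.
Proof.
move=> iw B BD /andP[wB vB]; rewrite /swap setUC; apply: sD => //.
apply/imsetP => -[j]; rewrite inE => ji e.
by move: iw; rewrite e vpos_v ltnNge ji.
Qed.

(** At stage [n] there are more than [n] elements outside [C], so one of them is not among the first
    [n] vertices and can be exchanged for the next one. *)
Lemma shift_into C B n : n <= r.+1 -> B \in D -> C \subset B -> [disjoint C & V] ->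
  n <= #|B :\: C| ->
  exists B', [/\ B' \in D, C \subset B', #|B'| = #|B| & forall i, i < n -> v i \in B'].
Proof.
move=> + BD CB dCV; elim: n => [|n IH] nr nB; first by exists B; split.
have [B' [B'D CB' cB' vB']] := IH (ltnW nr) (ltnW nB).
pose i : 'I_r.+1 := Ordinal nr.
case: (boolP (v i \in B')) => viB.
  exists B'; split=> // j; rewrite ltnS leq_eqVlt => /orP[/eqP e|]; last exact: vB'.
  by rewrite (_ : j = i) //; apply: val_inj.
pose L := [set v j | j : 'I_r.+1 & j < n].
have cL : #|L| <= n.
  rewrite card_imset //; apply: (@leq_trans #|[set widen_ord (ltnW nr) j | j : 'I_n]|).
    apply/subset_leq_card/subsetP => j; rewrite inE => jn; apply/imsetP.
    by exists (Ordinal jn) => //; apply: val_inj.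
  by apply: leq_trans (leq_imset_card _ _) _; rewrite card_ord.
have [w wB wCL] : exists2 w, w \in B' & w \notin C :|: L.
  apply/subsetPn/negP => /subset_leq_card; rewrite cB'.
  have := cardsID C B; rewrite (setIidPr CB) => <-.
  have := cardsUI C L; move: cL nB; clear; lia.
move: wCL; rewrite in_setU negb_or => /andP[wC wL].
have iw : i < vpos w.
  case: (boolP (w \in V)) => [/vsetP[j ej]|/vpos_out -> //].
  rewrite ej vpos_v ltn_neqAle; apply/andP; split.
    by apply/eqP => /val_inj e; rewrite ej -e (negPf viB) in wB.
  rewrite leqNgt; apply: contra wL => jn; rewrite ej; apply: imset_f.
  by rewrite inE.
have mB : movable (v i) w B' by rewrite /movable wB.
exists (swap (v i) w B'); split.
- exact: closed_swap_v.
- apply/subsetP => u uC; rewrite in_swap (subsetP CB') // andbT.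
  by rewrite (contraNneq _ wC) ?orbT // => <-.
- by rewrite card_swap.
move=> j; rewrite in_swap ltnS leq_eqVlt => /orP[/eqP e|jn].
  by rewrite (_ : j = i) ?eqxx //; apply: val_inj.
rewrite vB' // andbT; apply/orP; right; apply: contraNneq wL => <-.
by apply: imset_f; rewrite inE.
Qed.

(** A face of size [2 r] over [C] has at least [2 r - (r - 1) = r + 1] elements outside [C], enough
    to be exchanged for all of [V]. *)
Lemma face_with_V C : C \in D -> [disjoint C & V] -> #|C| < r -> C :|: V \in D.
Proof.
move=> CD dCV Cr; have [|B [BD CB cB]] := extD CD; first by move: Cr; clear; lia.
have [||B' [B'D CB' _ vB']] := @shift_into C B r.+1 _ BD CB dCV; first by [].
  by have := cardsID C B; rewrite (setIidPr CB) cB; move: Cr; clear; lia.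
apply: complexS cD B'D _; rewrite subUset CB'; apply/subsetP => _ /vsetP[i ->].
exact: vB'.
Qed.

Lemma V_face : V \in D.
Proof.
rewrite -[V]set0U; apply: face_with_V; rewrite ?cards0 ?complex_set0 //; last by apply: ltnW.
by rewrite disjoints_subset sub0set.
Qed.

Definition complete A := forall S : {set T}, S \subset V -> #|S| = r -> S \in A.

Lemma r_subsets A : (forall i, V :\ v i \in A) -> complete A.
Proof.
move=> h S SV cS; have : 0 < #|V :\: S|.
  by have := cardsID S V; rewrite (setIidPr SV) card_vset cS; clear; lia.
case/card_gt0P => w; rewrite in_setD => /andP[wS /vsetP[i ei]].
have -> // : S = V :\ v i; apply/eqP; rewrite eqEcard subsetD1 SV -ei wS /=.
by have := cardsD1 w V; rewrite card_vset ei mem_vset cS; clear; lia.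
Qed.

Lemma fill A X R B :
  (forall i u, v i \notin X -> u \notin X -> i < vpos u -> closed_swap (v i) u A) ->
  B \in A -> R \subset V -> [disjoint R & X] -> #|R| = #|B :\: X| ->
  (forall i u, v i \in R -> u \notin R -> u \notin X -> i < vpos u) ->
  (B :&: X) :|: R \in A.
Proof.
move=> clA + RV dRX + first; move: {2}#|R :\: B| (leqnn #|R :\: B|) => n.
elim: n B => [|n IH] B le BA cR.
  move: le; rewrite leqn0 cards_eq0 setD_eq0 => RB.
  have -> : R = B :\: X.
    apply/eqP; rewrite eqEcard cR leqnn andbT; apply/subsetP => u uR.
    by rewrite in_setD (subsetP RB) // (disjointFr dRX).
  by rewrite setID.
case: (boolP (R \subset B)) => [RB|/subsetPn[a aR aB]].
  apply: IH => //; rewrite (_ : R :\: B = set0) ?cards0 //.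
  by apply/eqP; rewrite setD_eq0.
have [u uBX uR] : exists2 u, u \in B :\: X & u \notin R.
  apply/subsetPn; apply: contra aB => BR.
  have e : B :\: X = R by apply/eqP; rewrite eqEcard BR cR leqnn.
  by move: aR; rewrite -e in_setD => /andP[].
move: uBX; rewrite in_setD => /andP[uX uB].
have /vsetP[i ei] := subsetP RV a aR; have aX : a \notin X by rewrite (disjointFr dRX).
have mB : movable a u B by rewrite /movable uB.
have sB : swap a u B \in A.
  by rewrite ei in aR aB aX mB *; apply: clA => //; apply: first.
have ne : u != a by apply: contraNneq aB => <-.
have eX : swap a u B :&: X = B :&: X.
  apply/setP => w; rewrite !in_setI in_swap; case: (w =P a) => [->|_] /=.
    by rewrite (negPf aX) andbF.
  by case: (w =P u) => [->|] //=; rewrite (negPf uX) andbF.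
rewrite -eX; apply: IH => //.
  apply: leq_trans (_ : #|(R :\: B) :\ a| <= _); last first.
    by have := cardsD1 a (R :\: B); rewrite in_setD aB aR; move: le; clear; lia.
  apply/subset_leq_card/subsetP => w; rewrite !in_setD in_set1 in_swap negb_or negb_and.
  case/andP => /andP[-> /orP[|-> ->//]]; rewrite negbK => /eqP ->.
  by rewrite (negPf uR).
have := cardsID X B; have := cardsID X (swap a u B).
by rewrite eX card_swap // cR; [clear; lia|case/andP: mB..].
Qed.

(** A member missing the first vertex can be pushed onto [V :\ v ord0]; exchanging [v i] for the
    first vertex then gives the other [r]-subsets. *)
Lemma stable_complete A : (forall i u, i < vpos u -> closed_swap (v i) u A) ->
  (forall B, B \in A -> #|B| = r) -> (exists2 B, B \in A & v ord0 \notin B) ->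
  complete A.
Proof.
move=> clA Ar [B BA vB]; apply: r_subsets.
have H : V :\ v ord0 \in A.
  have e0 : B :&: [set v ord0] = set0.
    by apply/eqP; rewrite setI_eq0 disjoint_sym disjoints1.
  rewrite -[V :\ v ord0]set0U -e0; apply: fill => //.
  - by move=> i u _ _; apply: clA.
  - exact: subD1set.
  - by rewrite disjoint_sym disjoints1 setD11.
  - have -> : B :\: [set v ord0] = B by apply/setDidPl; rewrite disjoint_sym disjoints1.
    by have := cardsD1 (v ord0) V; rewrite mem_vset card_vset (Ar _ BA); clear; lia.
  move=> i u _; rewrite in_setD1 in_set1 => + u0; rewrite u0 /= => /vpos_out ->.
  exact: ltn_ord.
move=> i; case: (eqVneq i ord0) => [-> //|i0].
have m0 : movable (v ord0) (v i) (V :\ v ord0).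
  by rewrite /movable !in_setD1 eqxx mem_vset (inj_eq v_inj) i0.
have lt0 : (ord0 : 'I_r.+1) < vpos (v i) by rewrite vpos_v lt0n -(inj_eq val_inj) in i0 *.
have := clA _ _ lt0 _ H m0; congr (_ \in A); apply/setP => u.
rewrite in_swap !in_setD1; case: (u =P v ord0) => [->|_] //=.
by rewrite mem_vset (inj_eq v_inj) eq_sym i0.
Qed.

(** The last clause keeps the family nontrivial, and it is not affected by compressions that leave
    [x] and [y] alone. *)
Definition spread A x y :=
  [/\ A \subset faces_of D r, intersecting A,
      (forall B, B \in A -> (x \in B) || (y \in B)),
      (forall B, B \in faces_of D r -> x \in B -> y \in B -> B \in A) &
      (exists2 B, B \in A & x \notin B) /\ (exists2 B, B \in A & y \notin B)].

(** The size is only bounded below, since faces may be added on the way. *)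
Definition completable k := exists A,
  [/\ A \subset faces_of D r, intersecting A, k <= #|A| & complete A].

Lemma compress_faces A i u : i < vpos u -> A \subset faces_of D r -> v i != u ->
  compress (v i) u A \subset faces_of D r.
Proof.
move=> iu AD xu; apply: compress_closed_sub => // B; rewrite !mem_faces.
case/andP => BD cB mB; rewrite closed_swap_v //= card_swap //; by case/andP: mB.
Qed.

Lemma vpos_neq i u : i < vpos u -> v i != u.
Proof. by apply: contraTneq => <-; rewrite vpos_v ltnn. Qed.

Lemma spread_compress A x y i u : spread A x y -> i < vpos u ->
  v i \notin [set x; y] -> u \notin [set x; y] -> spread (compress (v i) u A) x y.
Proof.
move=> [AD iA hit all [[B1 B1A xB1] [B2 B2A yB2]]] iu; rewrite !in_set2 !negb_or.
move=> /andP[vx vy] /andP[ux uy]; have vu := vpos_neq iu.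
have same z B : z != v i -> z != u -> (z \in move_set (v i) u A B) = (z \in B).
  move=> zv zu; rewrite /move_set; case: ifP => // _.
  by rewrite in_swap (negPf zv) zu.
have sx B : (x \in move_set (v i) u A B) = (x \in B) by rewrite same // eq_sym.
have sy B : (y \in move_set (v i) u A B) = (y \in B) by rewrite same // eq_sym.
split.
- exact: compress_faces.
- exact: compress_intersecting.
- by move=> _ /imsetP[B BA ->]; rewrite sx sy hit.
- move=> B BD xB yB; have BA := all B BD xB yB.
  rewrite in_compress // BA /= if_same; case: ifP => // mB; apply: all.
  + rewrite mem_faces closed_swap_v //=; last by move: BD; rewrite mem_faces => /andP[].
    by rewrite card_swap; case/andP: mB => //; move: BD; rewrite mem_faces => /andP[].
  + by rewrite in_swap xB andbT eq_sym (negPf vx) eq_sym ux.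
  + by rewrite in_swap yB andbT eq_sym (negPf vy) eq_sym uy.
split.
  by exists (move_set (v i) u A B1); rewrite ?sx //; apply: imset_f.
by exists (move_set (v i) u A B2); rewrite ?sy //; apply: imset_f.
Qed.

(** Filling up a member without [x] and one without [y] by the first [r - 1] vertices [R] of [V]
    other than [x] and [y] gives [y |: R] and [x |: R]. If [y] is in [V], these are the [r]-subsets
    missing [x] or [y], and the others contain both. If not, sets with [y] stand in for sets with
    the last vertex [z], and one more compression from [y] to [z] corrects this. *)
Lemma spread_stable_complete A i y : spread A (v i) y -> v i != y ->
  (forall j u, v j \notin [set v i; y] -> u \notin [set v i; y] -> j < vpos u ->
     closed_swap (v j) u A) ->
  completable #|A|.
Proof.
move=> [AD iA hit all [[B1 B1A xB1] [B2 B2A yB2]]] xy clA; set x := v i.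
have yB1 : y \in B1 by have := hit _ B1A; rewrite (negPf xB1).
have xB2 : x \in B2 by have := hit _ B2A; rewrite (negPf yB2) orbF.
have Ar B : B \in A -> B \in D /\ #|B| = r.
  by move/(subsetP AD); rewrite mem_faces => /andP[? /eqP].
have e1 : B1 :&: [set x; y] = [set y].
  apply/setP => u; rewrite !inE; case: (u =P y) => [->|_]; first by rewrite yB1 orbT.
  by case: (u =P x) => [->|_]; rewrite /= ?andbF // (negPf xB1).
have e2 : B2 :&: [set x; y] = [set x].
  apply/setP => u; rewrite !inE; case: (u =P x) => [->|_]; first by rewrite xB2.
  by case: (u =P y) => [->|_]; rewrite /= ?andbF // (negPf yB2).
have c1 : #|B1 :\: [set x; y]| = r.-1.
  by have := cardsID [set x; y] B1; rewrite e1 cards1 (Ar _ B1A).2; clear; lia.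
have c2 : #|B2 :\: [set x; y]| = r.-1.
  by have := cardsID [set x; y] B2; rewrite e2 cards1 (Ar _ B2A).2; clear; lia.
have filled R : R \subset V -> x \notin R -> y \notin R -> #|R| = r.-1 ->
    (forall j u, v j \in R -> u \notin R -> u \notin [set x; y] -> j < vpos u) ->
    x |: R \in A /\ y |: R \in A.
  move=> RV xR yR cR first.
  have dR : [disjoint R & [set x; y]].
    rewrite disjoint_sym -setI_eq0 setIUl setU_eq0 !setI_eq0 !disjoints1 xR yR.
    by [].
  split; first by rewrite -e2; apply: fill; rewrite ?c2.
  by rewrite -e1; apply: fill; rewrite ?c1.
have xV : x \in V := mem_vset i.
case: (boolP (y \in V)) => yV.
  have [|||||xR yR] := @filled (V :\ x :\ y).
  - by rewrite subDset subsetU // subD1set orbT.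
  - by rewrite !in_setD1 eqxx andbF.
  - by rewrite in_setD1 eqxx.
  - have := cardsD1 x V; have := cardsD1 y (V :\ x).
    by rewrite in_setD1 eq_sym xy yV xV card_vset; clear; lia.
  - move=> j u _; rewrite !in_setD1 in_set2 negb_or => + /andP[ux uy].
    by rewrite ux uy /= => /vpos_out ->; apply: ltn_ord.
  exists A; split=> //; apply: r_subsets => j.
  case: (eqVneq (v j) x) => [->|jx].
    by have := yR; rewrite setD1K // in_setD1 eq_sym xy.
  case: (eqVneq (v j) y) => [->|jy].
    have := xR; congr (_ \in A); apply/setP => u; rewrite !inE.
    by case: (u =P x) => [->|] //=; rewrite xV xy.
  apply: all; rewrite ?in_setD1 ?xV ?yV ?andbT 1?eq_sym // mem_faces.
  rewrite (complexS cD V_face (subD1set _ _)) /=.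
  by have := cardsD1 (v j) V; rewrite mem_vset card_vset; clear; lia.
(* [z] is the last vertex of [V :\ x] *)
have [j0 [j0i j0last]] : exists j0 : 'I_r.+1, j0 != i /\ forall j, j != i -> j != j0 -> j < j0.
  case: (eqVneq i ord_max) => [->|ne].
    have lt : r.-1 < r.+1 by clear; lia.
    exists (Ordinal lt); split; first by rewrite -(inj_eq val_inj) /=; move: r2; clear; lia.
    move=> j; rewrite -!(inj_eq val_inj) /= => a b; have := ltn_ord j.
    by move: a b; clear; lia.
  exists ord_max; split; first by rewrite eq_sym.
  move=> j _; rewrite -(inj_eq val_inj) /= => a; have := ltn_ord j; move: a; clear; lia.
pose z := v j0; have zx : z != x by rewrite (inj_eq v_inj).
have zV : z \in V := mem_vset j0.
have yz : y != z by apply: contraNneq yV => ->.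
have yx : y != x by rewrite eq_sym.
pose R := V :\ x :\ z.
have cR : #|R| = r.-1.
  have := cardsD1 x V; have := cardsD1 z (V :\ x).
  by rewrite in_setD1 zx zV xV card_vset -/R; clear; lia.
have RV : R \subset V by rewrite subDset subsetU // subD1set orbT.
have memR u : (u \in R) = [&& u != z, u != x & u \in V] by rewrite !in_setD1.
have [||||xR yR] := @filled R RV.
- by rewrite memR eqxx andbF.
- by rewrite memR (negPf yV) !andbF.
- exact: cR.
- move=> j u; rewrite !memR => /and3P[jz jx _] + ; rewrite in_set2 negb_or.
  case: (boolP (u \in V)) => [/vsetP[l ->]|/vpos_out ->]; last by rewrite ltn_ord.
  rewrite andbT => + /andP[lx _]; rewrite lx andbT negbK => /eqP ->.
  by rewrite vpos_v; apply: j0last; rewrite -(inj_eq v_inj).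
have zyD : j0 < vpos y by rewrite vpos_out.
have zy : z != y by rewrite eq_sym.
(* Extend [y |: R] to a face of size [2 r > r + 1]; if [x] is missing there, it can replace an
   element outside [V] other than [y]. *)
have xyRD : x |: (y |: R) \in D.
  have [yRD cyR] := Ar _ yR.
  have [|G [GD sG cG]] := extD yRD; first by rewrite cyR; clear; lia.
  case: (boolP (x \in G)) => xG; first by apply: complexS cD GD _; rewrite subUset sub1set xG.
  have [w wG wyR] : exists2 w, w \in G & w \notin z |: (y |: R).
    apply/subsetPn/negP => /subset_leq_card; rewrite cG cardsU1 cyR.
    by move: r2; clear; case: (z \notin _); lia.
  move: wyR; rewrite in_setU1 negb_or => /andP[wz wyR].
  have wx : w != x by apply: contraNneq xG => <-.
  have wV : w \notin V.
    apply: contra wyR => wV; by rewrite in_setU1 memR wz wx wV orbT.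
  have iw : i < vpos w by rewrite vpos_out.
  have mG : movable x w G by rewrite /movable wG.
  apply: complexS cD (closed_swap_v iw GD mG) _.
  apply/subsetP => u; rewrite in_setU1 in_swap -/x => /orP[->//|uyR].
  by rewrite (subsetP sG) // andbT (contraNneq _ wyR) ?orbT // => <-.
exists (compress z y A); split.
- exact: compress_faces.
- exact: compress_intersecting.
- by rewrite card_compress.
apply: r_subsets => j; rewrite in_compress // /movable.
rewrite [y \in _]in_setD1 (negPf yV) andbF /= andbT.
case: (eqVneq (v j) z) => [->|jz].
  rewrite setD11; have := xR; congr (_ \in A); apply/setP => u.
  rewrite in_setU1 memR in_setD1; case: (u =P x) => [->|_] //=.
  by rewrite eq_sym zx xV.
rewrite in_setD1 zV eq_sym jz /=; apply/orP; right.
case: (eqVneq (v j) x) => [->|jx]; first exact: yR.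
have jR : v j \in R by rewrite memR jz jx mem_vset.
have eS : swap y z (V :\ v j) = (x |: (y |: R)) :\ v j.
  apply/setP => u; rewrite in_swap !in_setD1 !in_setU1 memR.
  case: (u =P y) => [->|_] /=; first by rewrite orbT andbT; apply/esym; apply: contraNneq yV => ->; exact: mem_vset.
  case: (u =P x) => [->|_] /=; first by rewrite xV eq_sym zx andbT.
  by rewrite andbCA.
apply: all.
- rewrite mem_faces eS (complexS cD xyRD (subD1set _ _)) /= -eS card_swap.
  + by have := cardsD1 (v j) V; rewrite mem_vset card_vset; clear; lia.
  + by rewrite in_setD1 zV eq_sym jz.
  + by rewrite in_setD1 (negPf yV) andbF.
- by rewrite eS in_setD1 setU11 eq_sym jx.
- by rewrite in_swap eqxx.
Qed.

Lemma spread_completable A i y : spread A (v i) y -> v i != y -> completable #|A|.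
Proof.
move: {2}(weight vpos A) (leqnn (weight vpos A)) => n.
elim: n A => [|n IH] A le sA xy.
  apply: (spread_stable_complete sA) => // j u vj ux ju; apply: NNPP => ncl.
  have ltju : vpos (v j) < vpos u by rewrite vpos_v.
  by have := weight_compress ltju ncl; move: le; clear; lia.
case: (classic (exists j u, [/\ v j \notin [set v i; y], u \notin [set v i; y],
    j < vpos u & ~ closed_swap (v j) u A])) => [[j [u [vj ux ju ncl]]]|none].
  have ltju : vpos (v j) < vpos u by rewrite vpos_v.
  rewrite -(card_compress A (vpos_neq ju)); apply: IH => //.
    by have := weight_compress ltju ncl; move: le; clear; lia.
  exact: spread_compress.
apply: (spread_stable_complete sA) => // j u vj ux ju; apply: NNPP => ncl.
by apply: none; exists j, u.
Qed.

Lemma nontrivial_completable A : A \subset faces_of D r -> intersecting A ->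
  ~ (exists c, forall B, B \in A -> c \in B) -> completable #|A|.
Proof.
move: {2}(weight vpos A) (leqnn (weight vpos A)) => n.
elim: n A => [|n IH] A le AD iA nt.
all: have missing c : exists2 B, B \in A & c \notin B.
1, 3: apply: NNPP => none; apply: nt; exists c => B BA; apply: contraT => cB;
  by case: none; exists B.
all: have Ar B : B \in A -> #|B| = r.
1, 3: by move/(subsetP AD); rewrite mem_faces => /andP[_ /eqP].
  exists A; split=> //; apply: stable_complete => // i u iu; apply: NNPP => ncl.
  have ltiu : vpos (v i) < vpos u by rewrite vpos_v.
  by have := weight_compress ltiu ncl; move: le; clear; lia.
case: (classic (exists i u, i < vpos u /\ ~ closed_swap (v i) u A))
    => [[i [u [iu ncl]]]|none]; last first.
  exists A; split=> //; apply: stable_complete => // i u iu; apply: NNPP => ncl.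
  by apply: none; exists i, u.
have ltiu : vpos (v i) < vpos u by rewrite vpos_v.
have vu := vpos_neq iu.
case: (classic (exists c, forall B, B \in compress (v i) u A -> c \in B)) => [[c hc]|nt'].
  (* The common vertex of the compressed family can only be [v i]: any other one would have been
     common to [A]. *)
  have hit B : B \in A -> (v i \in B) || (u \in B).
    move=> BA; have cx : c = v i.
      apply: NNPP => /eqP ncx; apply: nt; exists c => C CA.
      have := hc _ (imset_f (move_set (v i) u A) CA); rewrite /move_set.
      by case: ifP => // _; rewrite in_swap (negPf ncx) => /andP[].
    have := hc _ (imset_f (move_set (v i) u A) BA); rewrite /move_set cx.
    by case: ifP => [/andP[/andP[-> _] _]|_ ->]; rewrite ?orbT.
  pose A' := A :|: [set B in faces_of D r | (v i \in B) && (u \in B)].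
  have [C [CD iC kC fC]] : completable #|A'|; last first.
    exists C; split=> //; apply: leq_trans kC; apply/subset_leq_card; exact: subsetUl.
  have hit' B : B \in A' -> (v i \in B) || (u \in B).
    by rewrite in_setU => /orP[/hit //|]; rewrite in_set => /andP[_ /andP[-> _]].
  apply: (@spread_completable A' i u) => //; split.
  - rewrite subUset AD; apply/subsetP => B; rewrite in_set => /andP[]; by [].
  - have mix B C : B \in A' -> C \in [set B in faces_of D r | (v i \in B) && (u \in B)] ->
        B :&: C != set0.
      move=> /hit' hB; rewrite in_set => /andP[_ /andP[iC uC]]; apply/set0Pn.
      by case/orP: hB => h; [exists (v i)|exists u]; rewrite inE h.
    move=> B C BA'; have := BA'; rewrite {1}in_setU => /orP[BA|Bf].
      by rewrite in_setU => /orP[/(iA _ _ BA) //|]; apply: mix.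
    by move=> CA'; rewrite setIC; apply: mix.
  - exact: hit'.
  - by move=> B BD iB uB; rewrite in_setU in_set BD iB uB orbT.
  split.
    by have [B BA iB] := missing (v i); exists B; rewrite // in_setU BA.
  by have [B BA uB] := missing u; exists B; rewrite // in_setU BA.
rewrite -(card_compress A vu); apply: IH => //.
- by have := weight_compress ltiu ncl; move: le; clear; lia.
- exact: compress_faces.
- exact: compress_intersecting.
Qed.

End Nontrivial.

Local Open Scope ring_scope.

(** * Chains, contractions and depth *)

Section Chains.
Variables (T : finType) (K : fieldType).
Implicit Types (S A B : {set T}) (FF GG : {set {set T}}) (f g : T -> K).

Notation X := {ffun {set T} -> K^o}.
Implicit Types x y z : X.

Definition face_sign (w : T) S : K :=
  (-1) ^+ #|[set u in S | (enum_rank u < enum_rank w)%N]|.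

(** Interior product with the form [f]; for [f = 1] it is the simplicial boundary. Chains are
    functions on all subsets of [T], so contractions are endomorphisms of one space for all
    complexes. *)
Definition contr_fun f x : X :=
  [ffun S : {set T} => \sum_(w | w \notin S) f w * face_sign w S * x (w |: S)].

Fact contr_is_linear f : linear (contr_fun f).
Proof.
move=> a x y; apply/ffunP=> S; rewrite !ffunE scaler_sumr -big_split /=.
apply: eq_bigr => w _; rewrite !ffunE mulrDr; congr (_ + _).
by rewrite /GRing.scale /= mulrCA.
Qed.

HB.instance Definition _ f :=
  GRing.isLinear.Build K X X _ (contr_fun f) (contr_is_linear f).

Definition contr f : 'End(X) := linfun (contr_fun f).

Lemma contrE f x S :
  contr f x S = \sum_(w | w \notin S) f w * face_sign w S * x (w |: S).
Proof. by rewrite /contr lfunE /= ffunE. Qed.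

Lemma face_signU1 (w u : T) S : u \notin S ->
  face_sign w (u |: S) = (-1) ^+ (enum_rank u < enum_rank w)%N * face_sign w S.
Proof.
move=> uS; rewrite /face_sign -exprD; congr (_ ^+ _); case uw: (enum_rank u < enum_rank w)%N.
  have uN : u \notin [set v in S | (enum_rank v < enum_rank w)%N].
    by rewrite inE (negPf uS).
  have := cardsU1 u [set v in S | (enum_rank v < enum_rank w)%N].
  rewrite uN => <-; congr (#|pred_of_set _|); apply/setP=> v; rewrite !inE.
  by case: eqP => [->|//]; rewrite uw.
rewrite add0n; congr (#|pred_of_set _|); apply/setP=> v; rewrite !inE.
by case: eqP => [->|] /=; rewrite ?uw ?andbF.
Qed.

Lemma face_sign_sq w S : face_sign w S * face_sign w S = 1.
Proof. by rewrite -expr2 sqrr_sign. Qed.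

Lemma face_sign_swap w u S : w != u -> w \notin S -> u \notin S ->
  face_sign u S * face_sign w (u |: S) = - (face_sign w S * face_sign u (w |: S)).
Proof.
move=> wu wS uS; rewrite !face_signU1 //.
have : enum_rank w != enum_rank u by apply: contraNneq wu => /enum_rank_inj->.
rewrite neq_ltn => /orP[] lt; rewrite lt ltnNge (ltnW lt) /=.
  by rewrite expr1 expr0 mul1r mulN1r mulrN opprK mulrC.
by rewrite expr1 expr0 mul1r mulN1r mulrN mulrC.
Qed.

Lemma contr_anti f g x : contr f (contr g x) = - contr g (contr f x).
Proof.
apply/ffunP=> S; rewrite [RHS]ffunE !contrE.
have expand f' g' : \sum_(w | w \notin S) f' w * face_sign w S * contr g' x (w |: S)
   = \sum_(w | w \notin S) \sum_(u | (u != w) && (u \notin S))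
        f' w * g' u * (face_sign w S * face_sign u (w |: S)) * x (u |: (w |: S)).
  apply: eq_bigr => w _; rewrite contrE mulr_sumr.
  apply: eq_big => u; first by rewrite !inE negb_or.
  by move=> _; rewrite -!mulrA; congr (_ * _); rewrite mulrCA.
rewrite !expand (exchange_big_dep (fun u => u \notin S)) /=; last first.
  by move=> w u _ /andP[].
rewrite -sumrN; apply: eq_bigr => u uS; rewrite -sumrN.
apply: eq_big => [w|w /andP[wS /andP[uw _]]].
  by rewrite uS andbT eq_sym andbC.
rewrite setUCA (face_sign_swap uw) // mulrN mulNr.
by rewrite [g u * _]mulrC.
Qed.

(** In characteristic 2 this does not follow from [contr_anti]; the terms for the two orders of a
    pair of vertices are matched instead. *)
Lemma contr_sq f x : contr f (contr f x) = 0.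
Proof.
apply/ffunP=> S; rewrite !contrE ffunE.
pose E w u := f w * f u * (face_sign w S * face_sign u (w |: S)) * x (u |: (w |: S)).
rewrite (eq_bigr (fun w => \sum_(u | (u != w) && (u \notin S)) E w u)); last first.
  move=> w _; rewrite contrE mulr_sumr.
  apply: eq_big => u; first by rewrite !inE negb_or.
  by move=> _; rewrite /E -!mulrA; congr (_ * _); rewrite mulrCA.
pose lt (w u : T) := (enum_rank w < enum_rank u)%N.
rewrite (eq_bigr (fun w => \sum_(u | (u \notin S) && lt u w) E w u
                         + \sum_(u | (u \notin S) && lt w u) E w u)); last first.
  move=> w wS; rewrite (bigID (fun u => lt u w)) /=; congr (_ + _);
   apply: eq_bigl => u; rewrite /lt andbC.
    by case: ltnP => //=; rewrite ?andbF //; case: eqP => [->|]; rewrite ?ltnn //= andbT.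
  rewrite -leqNgt leq_eqVlt; case: (u \notin S); rewrite ?andbF //= andbT.
  case: (eqVneq u w) => [->|uw] /=; first by rewrite andbF ltnn.
  by rewrite andbT; case: eqP => //= /val_inj/enum_rank_inj ewu; rewrite ewu eqxx in uw.
rewrite big_split /= addrC; apply/eqP; rewrite addr_eq0; apply/eqP.
rewrite (exchange_big_dep (fun u => u \notin S)) /=; last by move=> w u _ /andP[].
rewrite -sumrN; apply: eq_bigr => u uS; rewrite -sumrN.
apply: eq_big => [w|w /andP[wS /andP[_ lwu]]]; first by rewrite uS.
rewrite /E setUCA face_sign_swap //; last first.
  by apply: contraTneq lwu => ->; rewrite /lt ltnn.
by rewrite mulrN mulNr [f u * _]mulrC.
Qed.

Lemma contrD f g x : contr (fun w => f w + g w) x = contr f x + contr g x.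
Proof.
apply/ffunP=> S; rewrite !ffunE !contrE -big_split /=; apply: eq_bigr => w _.
by rewrite -!mulrDl.
Qed.

Lemma contrZ a f x : contr (fun w => a * f w) x = a *: contr f x.
Proof.
apply/ffunP=> S; rewrite !ffunE !contrE scaler_sumr; apply: eq_bigr => w _.
by rewrite -!mulrA.
Qed.

Lemma eq_contr f g : f =1 g -> contr f =1 contr g.
Proof. by move=> fg x; apply/ffunP=> S; rewrite !contrE; apply: eq_bigr => w _; rewrite fg. Qed.

Definition outside_fun FF x : X := [ffun B : {set T} => if B \in FF then 0 else x B].

Fact outside_is_linear FF : linear (outside_fun FF).
Proof.
move=> a x y; apply/ffunP=> S; rewrite !ffunE.
by case: ifP => // _; rewrite ?scaler0 ?addr0.
Qed.

HB.instance Definition _ FF :=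
  GRing.isLinear.Build K X X _ (outside_fun FF) (outside_is_linear FF).

Definition chains_on FF : {vspace X} := lker (linfun (outside_fun FF)).

Lemma chains_onP FF x : reflect (forall B, B \notin FF -> x B = 0) (x \in chains_on FF).
Proof.
rewrite memv_ker lfunE /=; apply: (iffP eqP) => [/ffunP h B BF|h].
  by have := h B; rewrite !ffunE (negPf BF).
by apply/ffunP=> B; rewrite !ffunE; case: ifPn => // /h.
Qed.

Definition face_chain B : X := [ffun S : {set T} => (S == B)%:R].

Lemma face_chainE B S : face_chain B S = (S == B)%:R.
Proof. by rewrite ffunE. Qed.

Lemma mem_face_chain FF B : (face_chain B \in chains_on FF) = (B \in FF).
Proof.
apply/chains_onP/idP => [h|BF S SF].
  by apply: contraT => /h; rewrite face_chainE eqxx => /eqP; rewrite oner_eq0.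
by rewrite face_chainE; case: eqP => // e; rewrite e BF in SF.
Qed.

Lemma chains_on_sum FF x : x \in chains_on FF -> x = \sum_(B in FF) x B *: face_chain B.
Proof.
move/chains_onP=> h; apply/ffunP=> S; rewrite sum_ffunE.
case: (boolP (S \in FF)) => SF.
  rewrite (bigD1 S) //= !ffunE eqxx big1 ?addr0; first by rewrite /GRing.scale /= mulr1.
  by move=> B /andP[_ BS]; rewrite !ffunE eq_sym (negPf BS) scaler0.
rewrite h // big1 // => B BF; rewrite !ffunE; case: eqP => [e|]; last by rewrite scaler0.
by rewrite e BF in SF.
Qed.

Lemma chains_onS FF GG : FF \subset GG -> (chains_on FF <= chains_on GG)%VS.
Proof.
move=> sFG; apply/subvP => x /chains_onP h; apply/chains_onP => B BG; apply: h.
by apply: contra BG; apply: (subsetP sFG).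
Qed.

Lemma dim_chains_on FF : \dim (chains_on FF) = #|FF|.
Proof.
pose s := [seq face_chain B | B <- enum FF].
have sz : size s = #|FF| by rewrite size_map -cardE.
have fr : free s.

  suff : free (in_tuple s) by []; apply/freeP => k h [i ilt].
  have ltE : (i < size (enum FF))%N by rewrite size_map in ilt.
  have := congr1 (fun x : X => x (nth set0 (enum FF) i)) h.
  rewrite ffunE sum_ffunE (bigD1 (Ordinal ilt)) //= ffunE (nth_map set0) //.
  rewrite face_chainE eqxx /GRing.scale /= mulr1 big1 ?addr0 // => j ji.
  have ltj : (j < size (enum FF))%N by rewrite -(size_map (@face_chain)) ltn_ord.
  rewrite ffunE (nth_map set0) // face_chainE nth_uniq ?enum_uniq //.
  by rewrite eq_sym [_ == _ :> nat](negPf ji) /GRing.scale /= mulr0.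
have -> : chains_on FF = <<s>>%VS.
  apply/eqP; rewrite eqEsubv; apply/andP; split; apply/subvP=> x.
    move=> /chains_on_sum ->; apply: rpred_sum => B BF; apply: rpredZ.
    by apply: memv_span; apply: map_f; rewrite mem_enum.
  suff /subvP : (<<s>> <= chains_on FF)%VS by apply.
  apply/span_subvP => y /mapP[B]; rewrite mem_enum => BF ->; by rewrite mem_face_chain.
by rewrite -sz; apply/eqP; rewrite -[_ == _]/(free s).
Qed.

End Chains.

(** * Exactness of a single contraction *)

Section Exactness.
Variables (T : finType) (K : fieldType).
Implicit Types (S A B : {set T}) (D G : {set {set T}}) (f g : T -> K).
Notation X := {ffun {set T} -> K^o}.
Implicit Types x y z : X.

Definition chains G k : {vspace X} := chains_on K (faces_of G k).

Lemma chainsP G k x :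
  reflect (forall B, x B != 0 -> B \in G /\ #|B| = k) (x \in chains G k).
Proof.
apply: (iffP (chains_onP _ _)) => h B.
  move=> xB; have : B \in faces_of G k by apply: contraTT xB => /h ->; rewrite eqxx.
  by rewrite mem_faces => /andP[? /eqP].
rewrite mem_faces => BF; apply/eqP; apply: contraNT BF => /h[-> ->]; by rewrite eqxx.
Qed.

Lemma contr_chains G f k x : is_complex G ->
  x \in chains G k.+1 -> contr f x \in chains G k.
Proof.
move=> cG /chainsP h; apply/chainsP => S; rewrite contrE => neq0.
case: (pickP (fun w => (w \notin S) && (x (w |: S) != 0))) => [w /andP[wS xw]|z]; last first.
  move: neq0; rewrite big1 ?eqxx // => w wS.
  by have := z w; rewrite wS => /negbFE/eqP ->; rewrite mulr0.
have [wSG] := h _ xw; rewrite cardsU1 wS => -[card]; split=> //.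
by apply: complexS cG wSG _; apply: subsetUr.
Qed.

Lemma contr_chains0 G f x : x \in chains G 0 -> contr f x = 0.
Proof.
move=> /chainsP h; apply/ffunP => S; rewrite contrE ffunE; apply: big1 => w wS.
case: (eqVneq (x (w |: S)) 0) => [->|/h[_]]; first by rewrite mulr0.
by rewrite cardsU1 wS.
Qed.

Lemma eq_contr_in G f g k x : is_complex G -> x \in chains G k ->
  (forall w, [set w] \in G -> f w = g w) -> contr f x = contr g x.
Proof.
move=> cG /chainsP h fg; apply/ffunP => S; rewrite !contrE; apply: eq_bigr => w wS.
case: (eqVneq (x (w |: S)) 0) => [->|/h[wSG _]]; first by rewrite !mulr0.
by rewrite fg //; apply: complexS cG wSG _; rewrite sub1set setU11.
Qed.

Definition exact_at f G k :=
  forall x, x \in chains G k -> contr f x = 0 ->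
  exists2 y, y \in chains G k.+1 & contr f y = x.

(** As [k] counts vertices, the reduced homology of the link of [A] vanishes in dimensions below
    [m - #|A| - 1]; the bound does not refer to the dimension of the link. *)
Definition depth_ge G m :=
  forall A k, A \in G -> (k + #|A| < m)%N -> exact_at (fun=> 1) (link G A) k.

Lemma depth_ge_link G A m : is_complex G -> A \in G ->
  depth_ge G m -> depth_ge (link G A) (m - #|A|).
Proof.
move=> cG AG dG B k BL lt; rewrite link_link //; apply: dG.
  by move: BL; rewrite in_link // => /andP[].
move: BL; rewrite in_link // -setI_eq0 => /andP[/eqP dAB _].
have := cardsUI A B; rewrite dAB cards0; lia.
Qed.

Lemma depth_ge_exact G m k : is_complex G -> depth_ge G m -> (k < m)%N ->
  exact_at (fun=> 1) G k.
Proof.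
move=> cG dG lt; rewrite -(link0 cG); apply: dG; first exact: complex_set0.
by rewrite cards0 addn0.
Qed.

(** Conjugation by this diagonal map turns a nowhere vanishing form into the constant [1]. *)
Definition rescale f x : X := [ffun B : {set T} => x B * \prod_(w in B) f w].

Lemma rescale_chains G f k x : x \in chains G k -> rescale f x \in chains G k.
Proof.
move/chainsP => h; apply/chainsP => B; rewrite ffunE => neq0; apply: h.
by apply: contraNneq neq0 => ->; rewrite mul0r.
Qed.

Lemma contr_rescale f g x :
  contr g (rescale f x) = rescale f (contr (fun w => g w * f w) x).
Proof.
apply/ffunP => S; rewrite !ffunE !contrE mulr_suml; apply: eq_bigr => w wS.
rewrite ffunE big_setU1 //= -!mulrA; congr (_ * _).
by rewrite [RHS]mulrCA; congr (_ * _); rewrite mulrCA.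
Qed.

Lemma rescaleK f g x : (forall w, f w * g w = 1) -> rescale f (rescale g x) = x.
Proof.
move=> fg; apply/ffunP => S; rewrite !ffunE -mulrA -big_split /=.
by rewrite big1 ?mulr1 // => w _; rewrite mulrC.
Qed.

Definition at_vertex (w : T) : T -> K := fun u => (u == w)%:R.

Lemma contr_at w x S :
  contr (at_vertex w) x S = if w \in S then 0 else face_sign K w S * x (w |: S).
Proof.
rewrite contrE /at_vertex; case: ifPn => wS.
  apply: big1 => u uS; case: eqP => [e|]; last by rewrite !mul0r.
  by rewrite e wS in uS.
rewrite (bigD1 w) //= eqxx mul1r big1 ?addr0 // => u /andP[_ /negPf ->].
by rewrite !mul0r.
Qed.

Lemma contr_at_chains G w k x : is_complex G ->
  x \in chains G k.+1 -> contr (at_vertex w) x \in chains (link G [set w]) k.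
Proof.
move=> cG /chainsP h; apply/chainsP => S; rewrite contr_at.
case: ifPn => wS; first by rewrite eqxx.
case: (eqVneq (x (w |: S)) 0) => [->|/h[wSG]]; first by rewrite mulr0 eqxx.
by rewrite cardsU1 wS link1_face // => -[].
Qed.

(** Exterior multiplication by [w], a right inverse of the contraction at [w] on chains of the
    link. *)
Definition wedge1 w x : X :=
  [ffun S : {set T} => if w \in S then face_sign K w (S :\ w) * x (S :\ w) else 0].

Lemma wedge1_chains G w k x : is_complex G ->
  x \in chains (link G [set w]) k -> wedge1 w x \in chains G k.+1.
Proof.
move=> cG /chainsP h; apply/chainsP => S; rewrite ffunE.
case: ifPn => wS; last by rewrite eqxx.
case: (eqVneq (x (S :\ w)) 0) => [->|/h[]]; first by rewrite mulr0 eqxx.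
by rewrite link1_face ?setD11 // setD1K // (cardsD1 w S) wS => -> ->.
Qed.

Lemma contr_wedge1 G w k x : is_complex G ->
  x \in chains (link G [set w]) k -> contr (at_vertex w) (wedge1 w x) = x.
Proof.
move=> cG /chainsP h; apply/ffunP => S; rewrite contr_at ffunE.
case: ifPn => wS.
  case: (eqVneq (x S) 0) => [->//|/h[/linkP[_]]].
  by rewrite disjoints1 wS.
by rewrite setU11 setU1K // mulrA face_sign_sq mul1r.
Qed.

(** At a zero [w] of [f], the form [f + at_vertex w] has one zero fewer on [G], and [f] has one zero
    fewer on the link of [w], whose depth bound is lower by one. Each zero thus costs one degree. *)
Lemma exact_at_few_zeros (n : nat) G m f k : is_complex G -> depth_ge G m ->
  (#|[set w | ([set w] \in G) && (f w == 0%R)]| <= n)%N -> (k + n < m)%N ->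
  exact_at f G k.
Proof.
elim: n G m f k => [|n IHn] G m f k cG dG.
  rewrite leqn0 cards_eq0 => /eqP fG; rewrite addn0 => km x xG fx0.
  pose g w := if [set w] \in G then f w else 1.
  have g0 w : g w != 0.
    rewrite /g; case: ifPn => wG; last exact: oner_neq0.
    by have := in_set0 w; rewrite -fG inE wG /= => ->.
  have fg w : [set w] \in G -> f w = g w by rewrite /g => ->.
  have [|y yG ey] := depth_ge_exact cG dG km (rescale_chains g xG).
    rewrite contr_rescale (eq_contr (g := g)); last by move=> w; rewrite mul1r.
    rewrite -(eq_contr_in cG xG fg) fx0.
    by apply/ffunP => S; rewrite !ffunE mul0r.
  exists (rescale (fun w => (g w)^-1) y); first exact: rescale_chains.
  rewrite (eq_contr_in cG (rescale_chains _ yG) fg) contr_rescale.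
  rewrite (eq_contr (g := fun=> 1)) => [|w]; last by rewrite divff.
  by rewrite ey rescaleK // => w; rewrite mulVf.
move=> fz km; have [|] := leqP #|[set w | ([set w] \in G) && (f w == 0%R)]| n.
  by move=> le; apply: (IHn _ m) => //; lia.
move=> nlt; have /card_gt0P[w] : (0 < #|[set w | ([set w] \in G) && (f w == 0%R)]|)%N by lia.
rewrite inE => /andP[wG /eqP fw0].
have cL := link_complex cG wG.
have wZ : w \in [set w | ([set w] \in G) && (f w == 0)].
  by rewrite inE wG fw0 eqxx.
have exL j : (j.+1 + n < m)%N -> exact_at f (link G [set w]) j.
  move=> jm; apply: (IHn _ (m - 1)%N) => //; last by lia.
    by have := depth_ge_link cG wG dG; rewrite cards1.
  rewrite -ltnS; apply: leq_trans fz; rewrite [ltnRHS](cardsD1 w) wZ add1n ltnS.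
  apply: subset_leq_card; apply/subsetP => u.
  rewrite inE => /andP[/linkP[uG dwu _] fu]; rewrite in_setD1 inE uG fu andbT.
  by rewrite andbT; move: dwu; rewrite disjoints1 inE eq_sym.
move=> x xG fx0.
(* [Y] is chosen so that [x + contr f Y] is killed by [at_vertex w] too, hence by the form with
   fewer zeros. *)
have [Y YG eY] : exists2 Y, Y \in chains G k.+1 &
    contr (at_vertex w) (contr f Y) = - contr (at_vertex w) x.
  case: k km xG => [|k] km xG.
    by exists 0; rewrite ?mem0v // !linear0 (contr_chains0 _ xG) oppr0.
  have xL := contr_at_chains w cG xG.
  have km' : (k.+1 + n < m)%N by lia.
  have [|y yL ey] := exL k km' _ xL.
    by rewrite contr_anti fx0 linear0 oppr0.
  exists (wedge1 w y); first exact: wedge1_chains.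
  by rewrite contr_anti (contr_wedge1 cG yL) ey.
pose x1 := x + contr f Y.
have x1G : x1 \in chains G k by rewrite memvD // contr_chains.
have x1f : contr f x1 = 0 by rewrite linearD /= fx0 contr_sq addr0.
have x1w : contr (at_vertex w) x1 = 0 by rewrite linearD /= eY subrr.
have [|||y yG] := IHn G m (fun u => f u + at_vertex w u) k cG dG _ _ x1 x1G.
- rewrite -ltnS; apply: leq_trans fz; rewrite [ltnRHS](cardsD1 w) wZ add1n ltnS.
  apply: subset_leq_card; apply/subsetP => u; rewrite !inE /at_vertex.
  case/andP => uG; case: (u =P w) => [->|_]; last by rewrite addr0 uG.
  by rewrite fw0 add0r oner_eq0.
- by lia.
- by rewrite contrD x1f x1w addr0.
rewrite contrD => ey.
(* [x1] equals [contr f y] up to the chain [contr (at_vertex w) y] of the link, which is itself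
   [contr f] of a chain there. *)
have ywL := contr_at_chains w cG yG.
have km' : (k.+1 + n < m)%N by lia.
have [|y' y'L ey'] := exL k km' _ ywL.
  have e : contr f y = x1 - contr (at_vertex w) y by rewrite -ey addrK.
  by rewrite contr_anti e linearB /= x1w contr_sq subr0 oppr0.
exists (y + y' - Y).
  rewrite memvB // memvD //; apply: subvP y'L.
  apply: chains_onS; apply/subsetP => B; rewrite !mem_faces => /andP[BL ->].
  by rewrite (subsetP (link_sub _ _) _ BL).
by rewrite !(linearB, linearD) /= ey' ey /x1 addrK.
Qed.

End Exactness.

(** * Endomorphisms without eigenvalues *)

Section Annihilator.
Variable K : closedFieldType.

(** Cayley-Hamilton for a split polynomial, written as a fold so that its linear factors can be
    peeled off one by one. *)
Lemma split_annihilator_mx n (M : 'M[K]_n) :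
  {rs : seq K | foldr (fun r N => N *m (M - r%:M)) 1%:M rs = 0}.
Proof.
case: n M => [|n] M; first by exists [::]; apply: flatmx0.
have [rs e] := closed_field_poly_normal (char_poly M); exists rs.
rewrite -[RHS](Cayley_Hamilton M) e (monicP (char_poly_monic M)) scale1r.
elim: rs {e} => [|r rs] /=; first by rewrite big_nil [RHS]rmorph1.
move=> ->.
rewrite big_cons mulrC rmorphM /=; congr (_ *m _).
by rewrite rmorphB /= horner_mx_X horner_mx_C.
Qed.

Variable V : vectType K.
Implicit Types (s : 'End(V)) (A B : {vspace V}).

Lemma split_annihilator s :
  {rs : seq K | foldr (fun r g => (s - r *: \1) \o g)%VF \1%VF rs = 0}.
Proof.
pose e := vbasis {:V}; have eb : basis_of {:V} e := vbasisP _.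
have [rs ers] := split_annihilator_mx (passmx.mxof e e s); exists rs.
apply/eqP; rewrite -(passmx.mxof_eq0 eb eb) -ers; apply/eqP.
elim: rs {ers} => [|r rs IH] /=; first by rewrite passmx.mxof1 ?(basis_free eb).
rewrite (passmx.mxof_comp _ _ eb) IH addrC -scaleNr passmx.mxof_linear.
by rewrite passmx.mxof1 ?(basis_free eb) // scaleNr scalemx1 addrC.
Qed.

(* Over an algebraically closed field an endomorphism of [A / B] without
   eigenvalue acts on the zero space. *)
Lemma closed_pencil_sub s A B : (s @: B <= B)%VS ->
  (forall r, A <= (s - r *: \1) @: A + B)%VS -> (A <= B)%VS.
Proof.
move=> sB pencil.
have rB r : ((s - r *: \1) @: B <= B)%VS.
  apply/subvP => _ /memv_imgP[b bB ->].
  rewrite !(add_lfunE, opp_lfunE, scale_lfunE, id_lfunE).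
  by rewrite memvB ?memvZ // (subvP sB) ?memv_img.
have [rs ers] := split_annihilator s.
suff: (A <= foldr (fun r g => (s - r *: \1) \o g)%VF \1%VF rs @: A + B)%VS.
  by rewrite ers lim0g add0v.
elim: rs {ers} => [|r rs IH] /=; first by rewrite lim1g addvSl.
apply: subv_trans (pencil r) _; rewrite subv_add addvSr andbT limg_comp.
apply: subv_trans (limgS _ IH) _; rewrite limgD addvS //.
Qed.

End Annihilator.

(** * Exactness on the common kernel of the first powers *)

Section GenericForms.
Variables (T : finType) (K : closedFieldType) (t : T -> K).
Hypothesis t_inj : injective t.
Notation X := {ffun {set T} -> K^o}.
Variables (G : {set {set T}}) (m : nat).
Hypotheses (cG : is_complex G) (dG : depth_ge K G m).

Definition pcontr (p : {poly K}) : 'End(X) := contr (fun w => p.[t w]).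

Implicit Types (p q : {poly K}) (x y : X).

Lemma pcontrD p q x : pcontr (p + q) x = pcontr p x + pcontr q x.
Proof. by rewrite /pcontr -contrD; apply: eq_contr => w; rewrite hornerD. Qed.

Lemma pcontrZ a p x : pcontr (a *: p) x = a *: pcontr p x.
Proof. by rewrite /pcontr -contrZ; apply: eq_contr => w; rewrite hornerZ. Qed.

Lemma pcontr_anti p q x : pcontr p (pcontr q x) = - pcontr q (pcontr p x).
Proof. exact: contr_anti. Qed.

Lemma pcontr_sq p x : pcontr p (pcontr p x) = 0.
Proof. exact: contr_sq. Qed.

Lemma pcontr_chains p k x : x \in chains K G k.+1 -> pcontr p x \in chains K G k.
Proof. exact: contr_chains. Qed.

Fixpoint cycles (k l : nat) : {vspace X} :=
  if l is l'.+1 then (cycles k l' :&: lker (pcontr 'X^l'))%VS else chains K G k.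

Lemma mem_cyclesS k l x : (x \in cycles k l.+1) = (x \in cycles k l) && (pcontr 'X^l x == 0).
Proof. by rewrite /= memv_cap memv_ker. Qed.

Lemma pcontr_cycles p k l x : x \in cycles k.+1 l -> pcontr p x \in cycles k l.
Proof.
elim: l => [|l IH]; first exact: pcontr_chains.
rewrite !mem_cyclesS => /andP[/IH -> /eqP e] /=.
by rewrite pcontr_anti e linear0 oppr0.
Qed.

(** As [t] is injective, vertices where the form vanishes give distinct roots of [p]. *)
Lemma exact_pcontr p k : p != 0 -> (k + (size p).-1 < m)%N ->
  exact_at (fun w => p.[t w]) G k.
Proof.
move=> p0 lt; apply: (exact_at_few_zeros cG dG _ lt).
set Z := [set _ | _].
have : (size [seq t w | w <- enum Z] < size p)%N.
  apply: max_poly_roots => //.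
    by apply/allP => _ /mapP[w + ->]; rewrite mem_enum inE => /andP[_].
  by rewrite map_inj_uniq ?enum_uniq.
rewrite size_map -cardE; lia.
Qed.

(** The induction on [l] keeps [p] general: the step uses ['X^l] for a section and every
    [p - r *: 'X^l] for the pencil. Since [l.+1 < size p] there, these all have the size of [p], so
    the range of [k] does not depend on [r]. *)
Lemma cycles_exact l p k : (l < size p)%N -> (k + (size p).-1 < m)%N ->
  forall x, x \in cycles k l -> pcontr p x = 0 ->
  exists2 y, y \in cycles k.+1 l & pcontr p y = x.
Proof.
elim: l p k => [|l IHl] p k lp km.
  by apply: exact_pcontr; rewrite // -size_poly_gt0.
pose f := pcontr 'X^l; pose g := pcontr p.
have fsurj j : (j + l < m)%N -> forall x, x \in cycles j l.+1 ->
    exists2 y, y \in cycles j.+1 l & f y = x.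
  move=> jm x; rewrite mem_cyclesS => /andP[xc /eqP fx].
  by apply: IHl => //; rewrite size_polyXn //=.
(* a linear section of [f : cycles k.+1 l -> cycles k l.+1] *)
pose h := (f \o projv (cycles k.+1 l))%VF.
pose sec := (projv (cycles k.+1 l) \o h^-1)%VF.
have sec_cyc x : sec x \in cycles k.+1 l by rewrite comp_lfunE memv_proj.
have secK x : x \in cycles k l.+1 -> f (sec x) = x.
  move=> xc; have [|y yc fy] := fsurj k _ x xc; first by lia.
  have e : h (h^-1%VF x) = x.
    apply: limg_lfunVK; have -> : x = h y by rewrite comp_lfunE projv_id.
    exact: memv_img (memvf _).
  by rewrite -[RHS]e !comp_lfunE.
pose A := (cycles k l.+1 :&: lker g)%VS.
pose B := (g @: cycles k.+1 l.+1)%VS.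
suff /subvP AB : (A <= B)%VS.
  move=> x xc gx; have /AB/memv_imgP[y yc ->] : x \in A.
    by rewrite memv_cap xc memv_ker gx eqxx.
  by exists y.
have kerf n : n \in cycles k.+1 l -> f n = 0 -> n \in cycles k.+1 l.+1.
  by move=> nc fn; rewrite mem_cyclesS nc -/f fn eqxx.
(* [g \o sec] induces the connecting map of [A / B]; exactness for the forms
   [p - r *: 'X^l], known by induction, makes every [g \o sec - r] onto modulo [B]. *)
apply: (@closed_pencil_sub _ _ (g \o sec)%VF).
  apply/subvP => _ /memv_imgP[_ /memv_imgP[u uc ->] ->]; rewrite lfunE /=.
  have [|y yc fy] := fsurj k.+1 _ u uc; first by lia.
  have -> : g (sec (g u)) = g (sec (g u) + g y).
    by rewrite linearD /= pcontr_sq addr0.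
  apply: memv_img; apply: kerf.
    by rewrite memvD // pcontr_cycles.
  rewrite linearD /= secK ?pcontr_cycles // [f (g y)]pcontr_anti -/f -/g fy.
  by rewrite subrr.
move=> r; apply/subvP => x; rewrite memv_cap memv_ker mem_cyclesS.
case/andP => /andP[xc /eqP fx] /eqP gx.
have szq : size (p - r *: 'X^l) = size p.
  rewrite size_polyDl // size_polyN; apply: leq_ltn_trans (size_scale_leq _ _) _.
  by rewrite size_polyXn.
have [|||y yc ey] := IHl (p - r *: 'X^l) k _ _ x xc.
- by rewrite szq ltnW.
- by rewrite szq.
- by rewrite pcontrD -scaleNr pcontrZ -/f -/g gx fx scaler0 addr0.
move: ey; rewrite pcontrD -scaleNr pcontrZ -/f -/g => ey.
have uc : f y \in cycles k l.+1 by rewrite mem_cyclesS pcontr_cycles //= pcontr_sq eqxx.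
have gu : g (f y) = 0.
  rewrite pcontr_anti -/f -/g.
  have -> : g y = x + r *: f y by rewrite -ey scaleNr subrK.
  by rewrite linearD linearZ /= fx pcontr_sq scaler0 addr0 oppr0.
have -> : x = ((g \o sec) - r *: \1)%VF (f y) + g (y - sec (f y)).
  rewrite !(add_lfunE, opp_lfunE, scale_lfunE, id_lfunE, comp_lfunE) linearB /=.
  by rewrite [RHS]addrC subrKA -ey scaleNr.
apply: memv_add; first by apply: memv_img; rewrite memv_cap uc memv_ker gu eqxx.
apply: memv_img; apply: kerf; first by rewrite memvB.
by rewrite linearB /= secK // subrr.
Qed.

End GenericForms.

(** * Algebraic shifting *)

Section Wedge.
Variables (T : finType) (K : fieldType).
Notation X := {ffun {set T} -> K^o}.
Implicit Types (S A B : {set T}) (x y : X) (g : T -> K).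
Notation sgn := (face_sign K).

(** The sign of sorting [A] followed by [B]: it counts the pairs of [a] in [A] and a smaller element
    of [B]. *)
Definition cross_sign A B : K := \prod_(a in A) sgn a B.

Definition wedge x y : X :=
  [ffun S : {set T} => \sum_(A : {set T} | A \subset S) cross_sign A (S :\: A) * x A * y (S :\: A)].

Lemma cross_signU1l w A B : w \notin A -> cross_sign (w |: A) B = sgn w B * cross_sign A B.
Proof. by move=> wA; rewrite /cross_sign big_setU1. Qed.

Lemma face_sign_split w A S : A \subset S -> sgn w S = sgn w A * sgn w (S :\: A).
Proof.
move=> AS; rewrite /face_sign -exprD; congr (_ ^+ _).
rewrite -(cardsID A [set u in S | _]); congr (_ + _)%N.
  apply: eq_card => u; rewrite !inE andbC andbA; case: (boolP (u \in A)) => //= uA.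
  by rewrite (subsetP AS).
by apply: eq_card => u; rewrite !inE andbA.
Qed.

Lemma face_sign_above w A : w \notin A ->
  sgn w A * \prod_(a in A) (-1) ^+ (enum_rank w < enum_rank a)%N = (-1) ^+ #|A|.
Proof.
move=> wA; have -> : sgn w A = \prod_(a in A) (-1) ^+ (enum_rank a < enum_rank w)%N.
  rewrite prodrXr /face_sign; congr (_ ^+ _); rewrite -sum1_card big_mkcond /= [RHS]big_mkcond /=.
  by apply: eq_bigr => a _; rewrite !inE; case: (a \in A) => //=; case: ifP.
rewrite -big_split /= -prodr_const; apply: eq_bigr => a aA.
have : enum_rank w != enum_rank a by apply: contraNneq wA => /enum_rank_inj->.
rewrite neq_ltn => /orP[] lt; rewrite lt ltnNge (ltnW lt) /=.
  by rewrite mul1r.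
by rewrite mulr1.
Qed.

Lemma cross_signU1r w A B : w \notin A -> w \notin B ->
  cross_sign A (w |: B) = (-1) ^+ #|A| * sgn w A * cross_sign A B.
Proof.
move=> wA wB; rewrite -(face_sign_above wA) [_ * _ * sgn w A]mulrAC face_sign_sq mul1r /cross_sign -big_split /=.
by apply: eq_bigr => a aA; rewrite face_signU1.
Qed.

Lemma setU1D w S A : w \notin S -> A \subset S ->
  (w |: S) :\: (w |: A) = S :\: A.
Proof.
move=> wS AS; apply/setP => u; rewrite !inE.
by case: eqP => [->|]; rewrite //= (negPf wS) andbF.
Qed.

Lemma subsetU1_notin w S A : w \notin A -> (A \subset w |: S) = (A \subset S).
Proof.
move=> wA; apply/idP/idP => [sub|]; last by move/subset_trans; apply; apply: subsetUr.
apply/subsetP => u uA; have := subsetP sub _ uA; rewrite !inE.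
by case: (u =P w) => [e|//]; rewrite -e uA in wA.
Qed.

Lemma reindex_subsets w S (F : {set T} -> K) :
  \sum_(A : {set T} | (A \subset w |: S) && (w \in A)) F A =
  \sum_(A : {set T} | (A \subset S) && (w \notin A)) F (w |: A).
Proof.
rewrite (reindex_onto (fun A => w |: A) (fun A => A :\ w)) /=; last first.
  by move=> A /andP[_ wA]; rewrite setD1K.
apply: eq_bigl => A; rewrite setU11 andbT; case: (boolP (w \in A)) => wA.
  rewrite andbF; apply/negP => /andP[_ /eqP e].
  by have := setD11 w (w |: A); rewrite e wA.
rewrite setU1K // eqxx !andbT -(subsetU1_notin S wA).
by rewrite subUset sub1set setU11.
Qed.

(** For [w \notin S], the splittings of [w |: S] are sorted by the factor that receives [w]; the
    remaining terms on the right cancel. *)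
Lemma leibniz g k x y : x \in chains K [set: {set T}] k ->
  contr g (wedge x y) = wedge (contr g x) y + (-1) ^+ k *: wedge x (contr g y).
Proof.
move=> /chainsP xk; apply/ffunP => S; rewrite contrE !ffunE.
pose F1 w A := g w * (cross_sign A (S :\: A) * sgn w A) * x (w |: A) * y (S :\: A).
pose F2 w A := g w * ((-1) ^+ k * cross_sign A (S :\: A) * sgn w (S :\: A)) *
                 x A * y (w |: (S :\: A)).
have -> : \sum_(A : {set T} | A \subset S) cross_sign A (S :\: A) * contr g x A * y (S :\: A)
   = \sum_(A : {set T} | A \subset S) \sum_(w | w \notin A) F1 w A.
  apply: eq_bigr => A AS; rewrite contrE mulr_sumr mulr_suml.
  by apply: eq_bigr => w wA; rewrite /F1; ring.
have -> : (-1) ^+ k *: (\sum_(A : {set T} | A \subset S) cross_sign A (S :\: A) * x A * contr g y (S :\: A) : K^o)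
   = \sum_(A : {set T} | A \subset S) \sum_(w | w \notin S :\: A) F2 w A.
  rewrite scaler_sumr; apply: eq_bigr => A AS.
  rewrite contrE mulr_sumr scaler_sumr.
  by apply: eq_bigr => w wA; rewrite /F2 /GRing.scale /=; ring.
have split1 A : A \subset S -> \sum_(w | w \notin A) F1 w A =
   \sum_(w | w \notin S) F1 w A + \sum_(w | (w \in S) && (w \notin A)) F1 w A.
  move=> AS; rewrite (bigID (mem S)) /= addrC; congr (_ + _); apply: eq_bigl => w.
    by rewrite andbC; case: (boolP (w \in S)) => //= /(contra (subsetP AS w)) ->.
  by rewrite andbC.
have split2 A : A \subset S -> \sum_(w | w \notin S :\: A) F2 w A =
   \sum_(w | w \notin S) F2 w A + \sum_(w | (w \in S) && (w \in A)) F2 w A.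
  move=> AS; rewrite (bigID (mem S)) /= addrC; congr (_ + _); apply: eq_bigl => w.
    by rewrite inE andbC; case: (w \in S) => //=; rewrite andbF.
  by rewrite inE andbC; case: (w \in S) => //=; rewrite andbT negbK.
rewrite (eq_bigr _ split1) (eq_bigr _ split2) !big_split /= addrACA.
rewrite [X in _ = _ + X](_ : _ = 0) ?addr0.
  rewrite !(exchange_big_dep (fun w => w \notin S)) //= -big_split /=.
  apply: eq_bigr => w wS; rewrite ffunE (bigID (fun A => w \in A)) /= mulrDr.
  rewrite reindex_subsets !mulr_sumr; congr (_ + _).
    apply: eq_big => A.
      rewrite wS; case: (boolP (A \subset S)) => //= AS.
      exact: contra (subsetP AS w) wS.
    case/andP => AS wA; rewrite setU1D // cross_signU1l // /F1.
    rewrite (face_sign_split _ AS); have := face_sign_sq K w (S :\: A).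
    by move: (sgn w (S :\: A)) => a a1; rewrite -[cross_sign A _ in RHS]mul1r -a1; ring.
  apply: eq_big => A.
    rewrite wS andbT; case: (boolP (w \in A)) => wA /=; last first.
      by rewrite andbT subsetU1_notin.
    by rewrite andbF; apply/esym; apply: contraNF wS => AS; apply: (subsetP AS).
  case/andP => AS wA; rewrite subsetU1_notin // in AS.
  have -> : (w |: S) :\: A = w |: (S :\: A).
    by apply/setP => u; rewrite !inE; case: eqP => // ->; rewrite wA.
  rewrite cross_signU1r ?inE ?(negPf wS) ?andbF // (face_sign_split _ AS) /F2.
  case: (eqVneq (x A) 0) => [->|xA]; first by rewrite !(mulr0, mul0r).
  have [_ <-] := xk _ xA; have := face_sign_sq K w A.
  move: (sgn w A) => a a1; rewrite -[(-1) ^+ _ in RHS]mul1r -a1; ring.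
(* In these terms both factors contain [w]; those for [A] and [w |: A] cancel. *)
rewrite !(exchange_big_dep (fun w => w \in S)) /=; try by move=> ? ? _ /andP[].
rewrite -big_split /=; apply: big1 => w wS; rewrite wS /=.
have eS : w |: S = S by apply/setUidPr; rewrite sub1set.
have := reindex_subsets w S (F2 w); rewrite eS => ->; rewrite -big_split /=.
apply: big1 => A /andP[AS wA].
pose B0 := (S :\: A) :\ w.
have eB : S :\: A = w |: B0 by rewrite setD1K // inE wA wS.
have eB0 : S :\: (w |: A) = B0 by rewrite /B0 setDDl setUC.
have wB0 : w \notin B0 by rewrite setD11.
rewrite /F1 /F2 eB0 eB cross_signU1r // cross_signU1l //.
case: (eqVneq (x (w |: A)) 0) => [->|xA]; first by rewrite !(mulr0, mul0r) addr0.
have [_ <-] := xk _ xA; rewrite cardsU1 wA add1n exprS.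
have := face_sign_sq K w A; have := face_sign_sq K w B0.
move: (sgn w A) (sgn w B0) => a b b1 a1.
transitivity (g w * (-1) ^+ #|A| * cross_sign A B0 * x (w |: A) * y (w |: B0) * (a * a - b * b)); first by ring.
by rewrite a1 b1 subrr mulr0.
Qed.

End Wedge.

(** * The recursion behind algebraic shifting *)

Section Shifting.
Variables (T : finType) (K : closedFieldType) (t : T -> K).
Notation X := {ffun {set T} -> K^o}.
Implicit Types (S A B C W : {set T}) (x y : X) (p q : {poly K}).
Implicit Types (L M : {vspace X}) (s : seq (T * {poly K})).
Notation pc := (pcontr t).
Notation setTT := [set: {set T}].

(** Rank and nullity for each form: the image branch records [i], the kernel branch does not, and
    both spaces are killed by [p] from then on. In the end only constants are left, represented by
    the empty set. *)
Fixpoint leads s L : {set {set T}} :=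
  if s is (i, p) :: s' then
    [set i |: B | B in leads s' (pc p @: L)] :|: leads s' (L :&: lker (pc p))
  else if L == 0%VS then set0 else [set set0].

Lemma leadsP i p s L B : reflect
  ((exists2 C, C \in leads s (pc p @: L) & B = i |: C) \/ B \in leads s (L :&: lker (pc p)))
  (B \in leads ((i, p) :: s) L).
Proof.
rewrite /= inE; apply: (iffP orP) => -[] h; by [left; apply/imsetP|right].
Qed.

Lemma leadsS s L M : (L <= M)%VS -> leads s L \subset leads s M.
Proof.
elim: s L M => [|[i p] s IH] L M LM /=.
  case: (eqVneq L 0%VS) => [_|L0]; first exact: sub0set.
  case: (eqVneq M 0%VS) => // M0; by rewrite M0 subv0 (negPf L0) in LM.
apply: setUSS; first by apply: imsetS; apply: IH; apply: limgS.
by apply: IH; apply: capvS.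
Qed.

Lemma leads0 s : leads s 0 = set0.
Proof.
elim: s => [|[i p] s IH] /=; first by rewrite eqxx.
by rewrite limg0 cap0v IH imset0 setU0.
Qed.

Lemma leads_support s L B : B \in leads s L -> {subset B <= unzip1 s}.
Proof.
elim: s L B => [|[i p] s IH] L B.
  by rewrite /=; case: ifP => _; rewrite inE // => /eqP -> u; rewrite inE.
case/leadsP => [[C CS ->]|BS] u; rewrite !inE.
  by case/orP => [->//|/(IH _ _ CS) ->]; rewrite orbT.
by move=> /(IH _ _ BS) ->; rewrite orbT.
Qed.

(** To drop [u], take the kernel branch where [B] took the image branch: [pc p @: L] lies in [M] and
    is killed by [p]. *)
Lemma leads_del s L M B u : uniq (unzip1 s) ->
  (forall p, p \in unzip2 s -> (pc p @: L <= M)%VS) ->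
  B \in leads s L -> u \in B -> B :\ u \in leads s M.
Proof.
elim: s L M B => [|[i p] s IH] L M B.
  by move=> _ _ /=; case: ifP => _; rewrite inE // => /eqP ->; rewrite inE.
rewrite [uniq _]/= => /andP[is_ us] clo /leadsP[[C CS ->]|BS] uB; apply/leadsP.
  have iC : i \notin C by apply: contra is_; apply: leads_support CS i.
  move: uB; rewrite !inE; case: (u =P i) => [->|ui] /= uC.
    right; rewrite setU1K //; apply: (subsetP (leadsS s _)) CS.
    rewrite subv_cap clo ?inE ?eqxx //=; apply/subvP => _ /memv_imgP[x _ ->].
    by rewrite memv_ker pcontr_sq.
  left; exists (C :\ u).
    apply: IH CS uC => // q qs; apply/subvP => _ /memv_imgP[_ /memv_imgP[x xL ->] ->].
    rewrite pcontr_anti memvN memv_img // (subvP (clo q _)) ?memv_img //.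
    by rewrite inE qs orbT.
  apply/setP => w; rewrite !inE; case: (w =P i) => // ->.
  by rewrite andbT; apply/eqP => e; case: ui.
right; apply: IH BS uB => // q qs.
apply/subvP => _ /memv_imgP[x + ->]; rewrite !memv_cap !memv_ker => /andP[xL /eqP px].
by rewrite pcontr_anti px linear0 oppr0 eqxx andbT (subvP (clo q _)) ?memv_img // inE qs orbT.
Qed.

(** This makes the recursion end in spaces of dimension at most one. *)
Definition spanning W (Q : pred {poly K}) :=
  forall x, x \in chains_on K (powerset W) -> (forall q, Q q -> pc q x = 0) ->
  x \in chains_on K [set set0].

Definition with_head p (P : pred {poly K}) : pred {poly K} := fun q => (q == p) || P q.

Definition with_rest (P : pred {poly K}) s : pred {poly K} :=
  fun q => P q || (q \in unzip2 s).

(** In the inductions [P] collects the forms already processed. *)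
Definition killed W (P : pred {poly K}) L :=
  (L <= chains_on K (powerset W))%VS /\ (forall q, P q -> (L <= lker (pc q))%VS).

Lemma pcontr_powerset W p L :
  (L <= chains_on K (powerset W))%VS -> (pc p @: L <= chains_on K (powerset W))%VS.
Proof.
move=> LW; apply/subvP => _ /memv_imgP[x /(subvP LW)/chains_onP xW ->].
apply/chains_onP => B; rewrite inE => BW; rewrite contrE; apply: big1 => w wB.
rewrite xW ?mulr0 // inE; apply: contra BW; apply: subset_trans.
exact: subsetUr.
Qed.

Lemma killed_img W P p L : killed W P L -> killed W (with_head p P) (pc p @: L).
Proof.
case=> LW kL; split; first exact: pcontr_powerset.
move=> q /orP[/eqP ->|qP]; apply/subvP => _ /memv_imgP[x xL ->]; rewrite memv_ker.
  by rewrite pcontr_sq.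
have := subvP (kL q qP) x xL; rewrite memv_ker => /eqP e.
by rewrite pcontr_anti e linear0 oppr0.
Qed.

Lemma killed_ker W P p L : killed W P L -> killed W (with_head p P) (L :&: lker (pc p)).
Proof.
case=> LW kL; split; first exact: subv_trans (capvSl _ _) LW.
move=> q /orP[/eqP ->|qP]; first exact: capvSr.
exact: subv_trans (capvSl _ _) (kL q qP).
Qed.

Lemma spanning_sub W (P Q : pred {poly K}) :
  subpred P Q -> spanning W P -> spanning W Q.
Proof. by move=> PQ sP x xW kx; apply: sP => // q /PQ; apply: kx. Qed.

Lemma spanning_next W (P : pred {poly K}) i p s :
  spanning W (with_rest P ((i, p) :: s)) ->
  spanning W (with_rest (with_head p P) s).
Proof.
apply: spanning_sub => q; rewrite /with_rest /with_head inE.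
by case/orP => [->|/orP[->|->]]; rewrite ?orbT.
Qed.

Lemma killed_all W (P : pred {poly K}) L : killed W P L -> spanning W P ->
  (L <= chains_on K [set set0])%VS.
Proof.
case=> LW kL sP; apply/subvP => x xL; apply: sP; first exact: (subvP LW).
by move=> q /kL /subvP/(_ x xL); rewrite memv_ker => /eqP.
Qed.

Lemma spanning_nil W (P : pred {poly K}) :
  spanning W (with_rest P [::]) -> spanning W P.
Proof. by apply: spanning_sub => q; case/orP. Qed.

(** The vertex [i] separates the two branches, and the dimensions of image and kernel add up to that
    of [L]. *)
Lemma card_leads W P s L : uniq (unzip1 s) -> killed W P L ->
  spanning W (with_rest P s) -> #|leads s L| = \dim L.
Proof.
elim: s P L => [|[i p] s IH] P L.
  move=> _ kL /spanning_nil sW /=.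
  case: (eqVneq L 0%VS) => [->|L0]; first by rewrite cards0 dimv0.
  rewrite cards1; apply/eqP; rewrite eqn_leq lt0n dimv_eq0 L0 /=.
  by have := dimvS (killed_all kL sW); rewrite dim_chains_on cards1.
rewrite [uniq _]/= => /andP[is_ us] kL sW /=.
rewrite cardsU (_ : _ :&: _ = set0) ?cards0 ?subn0; last first.
  apply/setP => B; rewrite !inE; apply/negP => /andP[/imsetP[C _ ->] BS].
  by have := leads_support BS (setU11 i C); rewrite (negPf is_).
rewrite card_in_imset; last first.
  move=> B C BS CS e.
  have iN D M : D \in leads s M -> i \notin D.
    by move=> DS; apply: contra is_; apply: leads_support DS i.
  by rewrite -(setU1K (iN _ _ BS)) e setU1K ?(iN _ _ CS).
have sW' := spanning_next sW.
rewrite (IH (with_head p P) _ us (killed_img p kL) sW').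
by rewrite (IH (with_head p P) _ us (killed_ker p kL) sW') addnC limg_ker_dim.
Qed.

Notation graded k L := (L <= chains K setTT k)%VS.

Lemma setTT_complex : is_complex setTT.
Proof. by split=> [|A B]; rewrite ?inE //; apply/set0Pn; exists set0; rewrite inE. Qed.

Lemma graded_img k p L : graded k.+1 L -> graded k (pc p @: L).
Proof.
move=> gL; apply/subvP => _ /memv_imgP[x /(subvP gL) xk ->].
exact: contr_chains setTT_complex xk.
Qed.

Lemma graded0_img p L : graded 0 L -> (pc p @: L = 0)%VS.
Proof.
move=> gL; apply/eqP; rewrite -subv0; apply/subvP => _ /memv_imgP[x /(subvP gL) xk ->].
by rewrite memv0 /pcontr (contr_chains0 _ xk).
Qed.

Lemma nonzero_const L x : (L <= chains_on K [set set0])%VS -> x \in L -> x != 0 ->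
  x set0 != 0.
Proof.
move=> LE /(subvP LE)/chains_onP xE; apply: contraNneq => x0; apply/eqP/ffunP => B.
rewrite [RHS]ffunE; case: (eqVneq B set0) => [->//|B0].
by apply: xE; rewrite inE.
Qed.

Lemma leads_size W P s L k B : killed W P L ->
  spanning W (with_rest P s) -> graded k L ->
  B \in leads s L -> uniq (unzip1 s) -> #|B| = k.
Proof.
elim: s P L k B => [|[i p] s IH] P L k B.
  move=> kL /spanning_nil sW gL /=; case: (eqVneq L 0%VS) => [_|L0]; rewrite inE //.
  move=> /eqP -> _; rewrite cards0; rewrite -vpick0 in L0.
  have vL := memv_pick L.
  have := nonzero_const (killed_all kL sW) vL L0.
  by move/chainsP: (subvP gL _ vL) => /[apply] -[_ <-]; rewrite cards0.
move=> kL /spanning_next sW gL /leadsP[[C CS ->]|BS] /andP[is_ us].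
  case: k gL => [|k] gL; first by rewrite (graded0_img p gL) leads0 inE in CS.
  rewrite cardsU1 (IH _ _ k C (killed_img p kL) sW (graded_img p gL) CS us).
  by rewrite (contra (leads_support CS (x := i)) is_).
apply: (IH _ _ k B (killed_ker p kL) sW _ BS us).
exact: subv_trans (capvSl _ _) gL.
Qed.

(* Contracting a vanishing product [x /\ y] of a factor [x] and a factor [y]
   killed by the contraction leaves a vanishing product, so the two recursions
   defining [leads] can be run in parallel until both spaces consist of constants;
   the product of two nonzero constants does not vanish. *)
Lemma leads_meet W P s L M k l B C : killed W P L -> killed W P M ->
  spanning W (with_rest P s) -> graded k L -> graded l M ->
  (forall x y, x \in L -> y \in M -> wedge x y = 0) ->
  B \in leads s L -> C \in leads s M -> B :&: C != set0.
Proof.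
elim: s P L M k l B C => [|[i p] s IH] P L M k l B C.
  move=> kL kM /spanning_nil sW _ _ wLM /=.
  case: (eqVneq L 0%VS) => [_|L0]; rewrite inE // => _.
  case: (eqVneq M 0%VS) => [_|M0]; rewrite inE // => _.
  rewrite -vpick0 in L0; rewrite -vpick0 in M0.
  have vL := memv_pick L; have vM := memv_pick M.
  have x0 := nonzero_const (killed_all kL sW) vL L0.
  have y0 := nonzero_const (killed_all kM sW) vM M0.
  have /ffunP/(_ set0) := wLM _ _ vL vM; rewrite !ffunE.
  rewrite (bigD1 set0) //= big1 ?addr0; last first.
    by move=> A; rewrite subset0 => /andP[/eqP ->]; rewrite eqxx.
  rewrite /cross_sign big_set0 mul1r set0D => /eqP; rewrite mulf_eq0.
  by rewrite (negPf x0) (negPf y0).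
move=> kL kM /spanning_next sW gL gM wLM.
have gLk : graded k (L :&: lker (pc p)) by apply: subv_trans (capvSl _ _) gL.
have gMk : graded l (M :&: lker (pc p)) by apply: subv_trans (capvSl _ _) gM.
case/leadsP => [[B' BS ->]|BS]; case/leadsP => [[C' CS ->]|CS].
- by apply/set0Pn; exists i; rewrite !inE eqxx.
- case: k gL gLk => [|k] gL gLk; first by rewrite (graded0_img p gL) leads0 inE in BS.
  apply: contraNneq (IH _ _ _ k l _ _ (killed_img p kL) (killed_ker p kM) sW
    (graded_img p gL) gMk _ BS CS) => [e|x' y /memv_imgP[x xL ->]].
    by rewrite -subset0 -e; apply: setSI; apply: subsetUr.
  rewrite memv_cap memv_ker => /andP[yM /eqP py].
  have := leibniz (fun w => p.[t w]) y (subvP gL x xL).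
  rewrite (wLM _ _ xL yM) linear0 -!/(pcontr t p) py.
  rewrite [X in _ *: X](_ : _ = 0) ?scaler0 ?addr0 //.
  by apply/ffunP => S; rewrite !ffunE big1 // => A _; rewrite ffunE mulr0.
- case: l gM gMk => [|l] gM gMk; first by rewrite (graded0_img p gM) leads0 inE in CS.
  apply: contraNneq (IH _ _ _ k l _ _ (killed_ker p kL) (killed_img p kM) sW
    gLk (graded_img p gM) _ BS CS) => [e|x y' xLk /memv_imgP[y yM ->]].
    by rewrite -subset0 -e; apply: setIS; apply: subsetUr.
  move: xLk; rewrite memv_cap memv_ker => /andP[xL /eqP px].
  have := leibniz (fun w => p.[t w]) y (subvP gL x xL).
  rewrite (wLM _ _ xL yM) linear0 -!/(pcontr t p) px.
  rewrite [X in _ = X + _](_ : _ = 0) ?add0r; last first.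
    by apply/ffunP => S; rewrite !ffunE big1 // => A _; rewrite ffunE mulr0 mul0r.
  by move/eqP; rewrite eq_sym scaler_eq0 signr_eq0 /= => /eqP.
- apply: (IH _ _ _ k l _ _ (killed_ker p kL) (killed_ker p kM) sW gLk gMk _ BS CS).
  by move=> x y; rewrite !memv_cap => /andP[xL _] /andP[yM _]; apply: wLM.
Qed.

End Shifting.

(** * Shifting with the powers of [t] *)

Section AlgebraicShift.
Variables (T : finType) (K : closedFieldType) (t : T -> K).
Hypothesis t_inj : injective t.
Notation X := {ffun {set T} -> K^o}.
Implicit Types (S A B C W : {set T}) (x y : X) (p q : {poly K}).
Implicit Types (L M : {vspace X}) (s : seq (T * {poly K})) (us ws : seq T).
Implicit Types (F G H : {set {set T}}).
Notation pc := (pcontr t).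

Fixpoint powers j us : seq (T * {poly K}) :=
  if us is u :: us' then (u, 'X^j) :: powers j.+1 us' else [::].

Lemma unzip1_powers j us : unzip1 (powers j us) = us.
Proof. by elim: us j => //= u us IH j; rewrite IH. Qed.

Lemma powers_cat j us vs : powers j (us ++ vs) = powers j us ++ powers (j + size us) vs.
Proof.
elim: us j => [|u us IH] j /=; first by rewrite addn0.
by rewrite IH addSnnS.
Qed.

Lemma mem_unzip2_powers j us i : (i < size us)%N ->
  'X^(j + i) \in unzip2 (powers j us).
Proof.
elim: us j i => // u us IH j [|i] /= lt; rewrite inE; first by rewrite addn0 eqxx.
by rewrite -addSnnS IH ?orbT.
Qed.

Lemma pcontr_sum p x : pc p x = \sum_(i < size p) p`_i *: pc 'X^i x.
Proof.
rewrite -{1}[p]coefK poly_def (big_morph (fun q => pc q x) (id1 := 0) (op1 := +%R)).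
- by apply: eq_bigr => i _; rewrite pcontrZ.
- by move=> q r; rewrite pcontrD.
by apply/ffunP => S; rewrite contrE ffunE big1 // => w _; rewrite horner0 !mul0r.
Qed.

(** The chain is killed by every polynomial of size at most [size ws], in particular by the Lagrange
    polynomial vanishing at all [t u] with [u] in [W] other than [w]; evaluating at [B :\ w]
    isolates the coefficient of [B]. *)
Lemma powers_spanning ws W : uniq ws -> ws =i W ->
  spanning t W (fun q => q \in unzip2 (powers 0 ws)).
Proof.
move=> uws wsW x /chains_onP xW kx; apply/chains_onP => B; rewrite inE => B0.
have [w wB] := set0Pn _ B0.
case: (boolP (B \subset W)) => [BW|BW]; last by apply: xW; rewrite inE.
pose p : {poly K} := \prod_(u <- rem w ws) ('X - (t u)%:P).
have wW : w \in ws by rewrite wsW (subsetP BW).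
have szp : size p = size ws.
  by rewrite size_prod_XsubC size_rem // prednK //; case: (ws) wW.
have px : pc p x = 0.
  rewrite pcontr_sum szp big1 // => i _; rewrite kx ?scaler0 //.
  by have := @mem_unzip2_powers 0 _ i (ltn_ord i).
have /ffunP/(_ (B :\ w)) := px; rewrite contrE ffunE (bigD1 w) ?setD11 //=.
rewrite setD1K // big1 ?addr0 => [/eqP|u /andP[uB uw]].
  rewrite !mulf_eq0 signr_eq0 orbF; case/orP => [|/eqP //].
  rewrite horner_prod prodf_seq_eq0 => /hasP[u].
  rewrite (mem_rem_uniq _ uws) inE => /andP[uw _] /=.
  by rewrite hornerXsubC subr_eq0 (inj_eq t_inj) eq_sym (negPf uw).
case: (boolP (u \in W)) => uW; last first.
  rewrite xW ?mulr0 // inE; apply: contra uW => /subsetP; apply; exact: setU11.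
rewrite (_ : p.[t u] = 0) ?mul0r //; apply/eqP.
rewrite horner_prod prodf_seq_eq0; apply/hasP; exists u.
  by rewrite (mem_rem_uniq _ uws) inE uw wsW.
by rewrite hornerXsubC subrr eqxx.
Qed.

(** [kers] and [imgs] follow the branches of [leads] that always take the kernel or always the
    image. *)
Fixpoint kers s L := if s is (_, p) :: s' then kers s' (L :&: lker (pc p))%VS else L.
Fixpoint imgs s L := if s is (_, p) :: s' then imgs s' (pc p @: L)%VS else L.

Lemma imgsS s L M : (L <= M)%VS -> (imgs s L <= imgs s M)%VS.
Proof. by elim: s L M => [|[i p] s IH] L M LM //=; apply: IH; apply: limgS. Qed.

Lemma leads_skip s1 s2 L B : B \in leads t (s1 ++ s2) L ->
  {in B, forall u, u \notin unzip1 s1} -> B \in leads t s2 (kers s1 L).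
Proof.
elim: s1 L => [|[i p] s1 IH] L //= BS Bs.
case/leadsP: BS => [[C _ e]|BS].
  by have := Bs i; rewrite e setU11 inE eqxx => /(_ isT).
by apply: IH BS _ => u /Bs; rewrite inE negb_or => /andP[].
Qed.

Lemma leads_add s1 s2 L B : B \in leads t s2 (imgs s1 L) ->
  [set u in unzip1 s1] :|: B \in leads t (s1 ++ s2) L.
Proof.
elim: s1 L => [|[i p] s1 IH] L /=; first by rewrite set_nil set0U.
move=> /IH BS; apply/leadsP; left; exists ([set u in unzip1 s1] :|: B) => //.
by rewrite set_cons setUA.
Qed.

Section Complex.
Variables (G : {set {set T}}) (m : nat).
Hypotheses (cG : is_complex G) (dG : depth_ge K G m).

Lemma kers_powers us k l :
  kers (powers l us) (cycles t G k l) = cycles t G k (l + size us).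
Proof.
by elim: us l => [|u us IH] l /=; rewrite ?addn0 // (IH l.+1) addSnnS.
Qed.

Lemma cycles_imgs us k l : (k + l + size us <= m)%N ->
  (cycles t G k (l + size us) <= imgs (powers l us) (cycles t G (k + size us) l))%VS.
Proof.
elim: us l => [|u us IH] l /= le; first by rewrite !addn0 subvv.
rewrite -addSnnS; apply: subv_trans (IH l.+1 _) _; first by lia.
apply: imgsS; apply/subvP => x; rewrite mem_cyclesS => /andP[xc /eqP px].
have [|| y yc <-] := cycles_exact t_inj cG dG (l := l) (p := 'X^l) _ _ xc px.
- by rewrite size_polyXn.
- by rewrite size_polyXn /=; lia.
by rewrite memv_img // addnS.
Qed.

End Complex.

Section AShift.
Variables (ws : seq T) (W : {set T}).
Hypotheses (ws_uniq : uniq ws) (wsW : ws =i W).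
Notation s := (powers 0 ws).

Definition ashift F := leads t s (chains_on K F).

Let us1 : uniq (unzip1 s).
Proof. by rewrite unzip1_powers. Qed.

Let spanW : spanning t W (with_rest pred0 s).
Proof. exact: powers_spanning. Qed.

Let killedW F : F \subset powerset W -> killed t W pred0 (chains_on K F).
Proof. by move=> FW; split=> //; apply: chains_onS. Qed.

Let gradedF F k : (forall B, B \in F -> #|B| = k) -> (chains_on K F <= chains K [set: {set T}] k)%VS.
Proof. by move=> h; apply: chains_onS; apply/subsetP => B /h e; rewrite mem_faces inE e eqxx. Qed.

Lemma ashiftS F H : F \subset H -> ashift F \subset ashift H.
Proof. by move=> FH; apply: leadsS; apply: chains_onS. Qed.

Lemma ashift_subW F B : B \in ashift F -> B \subset W.
Proof.
by move=> /leads_support h; apply/subsetP => u /h; rewrite unzip1_powers wsW.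
Qed.

Lemma card_ashift F : F \subset powerset W -> #|ashift F| = #|F|.
Proof. by move=> FW; rewrite (card_leads us1 (killedW FW) spanW) dim_chains_on. Qed.

Lemma ashift_size F k B : F \subset powerset W -> (forall B, B \in F -> #|B| = k) ->
  B \in ashift F -> #|B| = k.
Proof.
by move=> FW Fk BF; apply: leads_size (killedW FW) spanW (gradedF Fk) BF us1.
Qed.

(** A nonzero term in the product of a chain on [F] and a chain on [H] would need disjoint members,
    so all these products vanish. *)
Lemma ashift_meet F H k l B C : F \subset powerset W -> H \subset powerset W ->
  (forall B, B \in F -> #|B| = k) -> (forall B, B \in H -> #|B| = l) ->
  (forall B C, B \in F -> C \in H -> B :&: C != set0) ->
  B \in ashift F -> C \in ashift H -> B :&: C != set0.
Proof.
move=> FW HW Fk Hl meet; apply: leads_meet (killedW FW) (killedW HW) spanW (gradedF Fk) (gradedF Hl) _.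
move=> x y /chains_onP xF /chains_onP yH; apply/ffunP => S; rewrite !ffunE big1 // => A _.
case: (boolP (A \in F)) => AF; last by rewrite xF // mulr0 mul0r.
case: (boolP (S :\: A \in H)) => SH; last by rewrite yH // mulr0.
by have := meet _ _ AF SH; rewrite setIDA setIC -setIDA setDv setI0 eqxx.
Qed.

Lemma ashift_del F H B u : (forall B u, B \in F -> u \in B -> B :\ u \in H) ->
  B \in ashift F -> u \in B -> B :\ u \in ashift H.
Proof.
move=> FH; apply: leads_del us1 _ => p _.
apply/subvP => _ /memv_imgP[x /chains_onP xF ->]; apply/chains_onP => S SH.
rewrite contrE big1 // => w wS; rewrite xF ?mulr0 //.
by apply: contra SH => /FH/(_ (setU11 _ _)); rewrite setU1K.
Qed.

Definition ashift_complex G := [set C : {set T} | C \in ashift (faces_of G #|C|)].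

Section AShiftComplex.
Variable G : {set {set T}}.
Hypotheses (cG : is_complex G) (GW : G \subset powerset W).

Let facesW k : faces_of G k \subset powerset W.
Proof. by apply: subset_trans GW; apply/subsetP => B; rewrite mem_faces => /andP[]. Qed.

Let faces_card k B : B \in faces_of G k -> #|B| = k.
Proof. by rewrite mem_faces => /andP[_ /eqP]. Qed.

Lemma faces_ashift k : faces_of (ashift_complex G) k = ashift (faces_of G k).
Proof.
apply/setP => B; rewrite mem_faces inE; apply/andP/idP => [[+ /eqP <-//]|BF].
by have e := ashift_size (facesW k) (@faces_card k) BF; rewrite e eqxx.
Qed.

Lemma fnum_ashift k : fnum (ashift_complex G) k = fnum G k.
Proof. by rewrite /fnum faces_ashift card_ashift. Qed.

Lemma ashift_complex_is_complex : is_complex (ashift_complex G).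
Proof.
have clo B u : B \in ashift_complex G -> u \in B -> B :\ u \in ashift_complex G.
  rewrite !inE => BG uB; have := uB; apply: ashift_del BG => C v.
  rewrite !mem_faces => /andP[CG /eqP eC] vC.
  rewrite (complexS cG CG) ?subD1set //=.
  by have := cardsD1 v C; have := cardsD1 u B; rewrite uB vC; lia.
split.
  have := fnum_ashift 0; rewrite {2}/fnum (_ : faces_of G 0 = [set set0]).
    rewrite cards1 => e; apply/set0Pn.
    have /card_gt0P[B] : (0 < #|faces_of (ashift_complex G) 0|)%N by rewrite [#|_|]e.
    by rewrite mem_faces => /andP[BG _]; exists B.
  apply/setP => B; rewrite mem_faces cards_eq0 inE.
  by case: eqP => [->|_]; rewrite ?andbF // complex_set0.
move=> A B; move: {2}#|A| (leqnn #|A|) => n; elim: n A => [|n IH] A le AG BA.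
  move: le; rewrite leqn0 cards_eq0 => /eqP e; rewrite e subset0 in BA.
  by rewrite (eqP BA) -e.
case: (eqVneq B A) => [->//|BneA].
have /properP[_ [u uA uB]] : B \proper A by rewrite properEneq BneA.
apply: (IH (A :\ u)); last by rewrite subsetD1 BA.
  by have := cardsD1 u A; rewrite uA; lia.
exact: clo.
Qed.

(** [D] avoids the first [j] vertices, so it is recorded in the all-kernel branch, that is, from
    [cycles t G #|D| j]. By exactness these cycles lie in the all-image branch starting [j] degrees
    higher, which records [I] in addition. *)
Lemma ashift_initial m C j : depth_ge K G m -> C \in ashift_complex G ->
  (j <= size ws)%N -> (#|C :\: [set u in take j ws]| + j <= m)%N ->
  [set u in take j ws] :|: (C :\: [set u in take j ws]) \in ashift_complex G.
Proof.
move=> dG CG jw; set I := [set u in _]; set D := C :\: I => le.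
have DG : D \in ashift_complex G by apply: complexS ashift_complex_is_complex CG (subsetDl _ _).
have cardI : #|I| = j.
  rewrite cardsE (card_uniqP _) ?take_uniq // size_take.
  by case: ltnP => //; lia.
have cID : #|I :|: D| = (#|D| + j)%N.
  have := cardsUI I D; rewrite (_ : I :&: D = set0) ?cards0 ?cardI; first by lia.
  by apply/setP => u; rewrite !inE; case: (u \in take j ws).
have sz : size (take j ws) = j by rewrite size_take; case: ltnP => //; lia.
have ews : powers 0 ws = powers 0 (take j ws) ++ powers j (drop j ws).
  by rewrite -{1}(cat_take_drop j ws) powers_cat add0n sz.
rewrite inE cID /ashift ews.
have -> : I = [set u in unzip1 (powers 0 (take j ws))] by rewrite unzip1_powers.
apply: leads_add.
have skip : {in D, forall u, u \notin unzip1 (powers 0 (take j ws))}.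
  by move=> u; rewrite unzip1_powers !inE => /andP[].
move: DG; rewrite inE /ashift ews => DS; have {DS skip} := leads_skip DS skip.
have := kers_powers G (take j ws) #|D| 0; rewrite /= add0n sz => ->.
apply: (subsetP (leadsS t _ _)).
have := cycles_imgs cG dG (us := take j ws) (k := #|D|) (l := 0).
by rewrite sz addn0 add0n; apply.
Qed.

End AShiftComplex.
End AShift.
End AlgebraicShift.

(** * Homology over the given field and over an algebraically closed field *)

Lemma rat_rmorphism (F : fieldType) : [pchar F] =i pred0 ->
  {f : {rmorphism rat -> F} | True}.
Proof.
move=> /pcharf0P F0.
have intr0 (z : int) : (z%:~R == 0 :> F) = (z == 0).
  by case: z => n; rewrite ?NegzE ?mulrNz ?oppr_eq0 -pmulrn F0.
have ratrE (a b : int) : b != 0 -> ratr (a%:~R / b%:~R) = a%:~R / b%:~R :> F.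
  move=> b0; set x := _ / _ : rat; rewrite /ratr.
  have b0Q : b%:~R != 0 :> rat by rewrite intr_eq0.
  have d0Q : (denq x)%:~R != 0 :> rat by rewrite intr_eq0 denq_eq0.
  have e : numq x * b = a * denq x.
    apply: (@intr_inj rat); rewrite !intrM.
    apply/eqP; rewrite -eqr_div // divq_num_den.
    by [].
  have d0 : (denq x)%:~R != 0 :> F by rewrite intr0 denq_eq0.
  have bF : b%:~R != 0 :> F by rewrite intr0.
  by apply/eqP; rewrite eqr_div // -!intrM e.
have add : zmod_morphism (@ratr F).
  move=> x y; rewrite -{1}(divq_num_den x) -{1}(divq_num_den y).
  have dx : denq x != 0 by rewrite denq_eq0.
  have dy : denq y != 0 by rewrite denq_eq0.
  have -> : (numq x)%:~R / (denq x)%:~R - (numq y)%:~R / (denq y)%:~R =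
    (numq x * denq y - numq y * denq x)%:~R / (denq x * denq y)%:~R :> rat.
    by rewrite intrB !intrM; field; rewrite !intr_eq0 dx dy.
  rewrite ratrE ?mulf_neq0 // /ratr intrB !intrM; field.
  by rewrite !intr0 dx dy.
have mul : monoid_morphism (@ratr F).
  split; first by rewrite /ratr divr1.
  move=> x y; rewrite -{1}(divq_num_den x) -{1}(divq_num_den y).
  have dx : denq x != 0 by rewrite denq_eq0.
  have dy : denq y != 0 by rewrite denq_eq0.
  rewrite mulf_div -!intrM ratrE ?mulf_neq0 // /ratr !intrM; field.
  by rewrite !intr0 dx dy.
pose f : {rmorphism rat -> F} := HB.pack (@ratr F)
  (GRing.isZmodMorphism.Build rat F _ add) (GRing.isMonoidMorphism.Build rat F _ mul).
by exists f.
Qed.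

Lemma Fp_rmorphism (F : fieldType) p : p \in [pchar F] ->
  {f : {rmorphism 'F_p -> F} | True}.
Proof.
move=> pF; have pr := pcharf_prime pF.
pose g (x : 'F_p) : F := (x : nat)%:R.
have gE n : g n%:R = n%:R.
  by rewrite /g val_Fp_nat // GRing.natr_mod_pchar.
have add : zmod_morphism g.
  move=> x y; rewrite -[x]natr_Zp -[y]natr_Zp.
  (* The difference is written as the image of a natural number, so that [gE] applies. *)
  have -> : (x%:R - y%:R : 'F_p) = (x + (p - 1) * y)%:R.
    rewrite natrD natrM natrB ?prime_gt0 // pchar_Fp_0 //.
    by rewrite sub0r mulN1r.
  rewrite !gE natrD natrM natrB ?prime_gt0 // (pcharf0 pF).
  by rewrite sub0r mulN1r.
have mul : monoid_morphism g.
  split; first exact: (gE 1%N).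
  by move=> x y; rewrite -[x]natr_Zp -[y]natr_Zp -natrM !gE natrM.
pose f : {rmorphism 'F_p -> F} := HB.pack g
  (GRing.isZmodMorphism.Build 'F_p F _ add) (GRing.isMonoidMorphism.Build 'F_p F _ mul).
by exists f.
Qed.

Lemma map_bd (P F : fieldType) (f : {rmorphism P -> F}) (T : finType)
  (D : {set {set T}}) k : map_mx f (bd P D k) = bd F D k.
Proof.
apply/matrixP => i j; rewrite !mxE /=; case: ifP => _; last by rewrite rmorph0.
by rewrite rmorph_sum; apply: eq_bigr => x _; rewrite /bsign rmorph_sign.
Qed.

Lemma hvanish_map (P F : fieldType) (f : {rmorphism P -> F}) (T : finType)
  (D : {set {set T}}) k : hvanish F D k = hvanish P D k.
Proof. by rewrite /hvanish -!(map_bd f) -map_kermx map_submx. Qed.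

(** [K] is an algebraic closure of the prime field of [F]; both fields are compared with that common
    subfield, over which the boundary matrices are defined. *)
Lemma closed_field_same_homology (F : fieldType) :
  exists K : closedFieldType, forall (T : finType) (D : {set {set T}}) k,
    hvanish F D k = hvanish K D k.
Proof.
have via (P : countFieldType) (f : {rmorphism P -> F}) :
    exists K : closedFieldType, forall (T : finType) (D : {set {set T}}) k,
    hvanish F D k = hvanish K D k.
  have [K [g _]] := countable_algebraic_closure P; exists K => T D k.
  by rewrite (hvanish_map f) (hvanish_map g).
case: (classic (exists p, p \in [pchar F])) => [[p pF]|char0].
  have [f _] := Fp_rmorphism pF; exact: (via 'F_p f).
suff /rat_rmorphism[f _] : [pchar F] =i pred0 by exact: (via rat f).
by move=> p; apply/negP => pF; apply: char0; exists p.
Qed.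

(** * Boundary matrices as contraction by the constant form *)

Section Boundary.
Variables (T : finType) (F : fieldType) (D : {set {set T}}).
Notation X := {ffun {set T} -> F^o}.

Definition chain_row k (x : X) : 'rV[F]_(#|faces_of D k|) := \row_i x (face i).

Lemma bd_chain k (x : X) : is_complex D -> x \in chains F D k.+1 ->
  chain_row k.+1 x *m bd F D k.+1 = chain_row k (contr (fun=> 1) x).
Proof.
move=> cD /chainsP xD; apply/rowP => j; rewrite !mxE contrE.
pose J := face j.
have JF : J \in faces_of D k by apply: enum_valP.
rewrite (eq_bigr (fun i : 'I_#|faces_of D k.+1| => (fun B => \sum_(w | (w \notin J) &&
   (B == w |: J)) bsign F B w * x B) (enum_val i))); last first.
  move=> i _; rewrite !mxE -/(face i) -/J; move: (face i) => B /=.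
  case: ifPn => [/andP[JB /cards1P[u eu]]|hB].
    rewrite eu big_set1 mulrC.
    have eB : B = u |: J by rewrite -(setID B J) (setIidPr JB) eu setUC.
    have uJ : u \notin J by have := set11 u; rewrite -eu inE => /andP[].
    rewrite (big_pred1 u) // => w /=; apply/andP/eqP => [[wJ /eqP eBw]|->]; last first.
      by rewrite -eB eqxx.
    by apply/eqP; rewrite -in_set1 -eu inE wJ eBw setU11.
  rewrite mulr0 big1 // => w /andP[wJ /eqP eB]; case/negP: hB.
  rewrite eB subsetUr /= setDUl setDv setU0.
  by rewrite (setDidPl _) ?cards1 // disjoints1.
rewrite -(@big_enum_val _ _ _ _ (mem (faces_of D k.+1)) (fun B => \sum_(w | (w \notin J) &&
   (B == w |: J)) bsign F B w * x B)) /=.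
rewrite (exchange_big_dep (fun w => w \notin J)) /=; last by move=> B w _ /andP[].
apply: eq_bigr => w wJ; rewrite mul1r.
have -> : face_sign F w J = bsign F (w |: J) w.
  rewrite /face_sign /bsign; congr (_ ^+ #|pred_of_set _|); apply/setP => u; rewrite !inE.
  by case: (u =P w) => [->|]; rewrite ?ltnn ?andbF.
case: (boolP (w |: J \in faces_of D k.+1)) => wJF.
  rewrite (big_pred1 (w |: J)) // => B /=; rewrite wJ /=.
  by case: (B =P w |: J) => [->|_]; rewrite ?wJF ?andbF.
rewrite big_pred0 => [|B]; last first.
  by case: (B =P w |: J) => [->|_]; rewrite ?(negPf wJF) ?andbF.
case: (eqVneq (x (w |: J)) 0) => [->|/xD[xJ ck]]; first by rewrite mulr0.
by rewrite mem_faces xJ ck eqxx in wJF.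
Qed.

Lemma chain_row_inj k (x y : X) : x \in chains F D k -> y \in chains F D k ->
  chain_row k x = chain_row k y -> x = y.
Proof.
move=> /chains_onP xD /chains_onP yD /rowP e; apply/ffunP => B.
case: (boolP (B \in faces_of D k)) => BD; last by rewrite xD ?yD.
by have := e (enum_rank_in BD B); rewrite !mxE /face enum_rankK_in.
Qed.

Lemma chain_row_surj k (r : 'rV[F]_#|faces_of D k|) :
  exists2 x, x \in chains F D k & chain_row k x = r.
Proof.
pose x : X := [ffun B => if [pick i | face i == B] is Some i then r 0 i else 0].
exists x.
  apply/chains_onP => B BD; rewrite ffunE; case: pickP => // i /eqP e.
  by rewrite -e /face enum_valP in BD.
apply/rowP => j; rewrite mxE ffunE; case: pickP => [i /eqP/enum_val_inj -> //|].
by move=> /(_ j); rewrite eqxx.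
Qed.

Lemma hvanish_exact k : is_complex D -> hvanish F D k -> exact_at (fun=> 1 : F) D k.
Proof.
move=> cD hv x xD xc.
have xker : (chain_row k x <= kermx (bd F D k))%MS.
  (* For [k = 0] the target is indexed by size [0.-1 = 0], and the matrix is zero because the empty
     face has no vertex to lose. *)
  apply/sub_kermxP; case: k xD xc {hv} => [|k] xD xc.
    apply/rowP => j; rewrite !mxE big1 // => i _; rewrite !mxE.
    have /cards0_eq e : #|face i| = 0%N.
      by have := enum_valP i; rewrite mem_faces => /andP[_ /eqP].
    by rewrite /= e set0D cards0 andbF mulr0.
  rewrite bd_chain // xc; apply/rowP => j; by rewrite !mxE ffunE.
have /submxP[r er] := submx_trans xker hv.
have [y yD ey] := chain_row_surj r.
exists y => //; apply: (chain_row_inj (contr_chains _ cD yD) xD).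
by rewrite -bd_chain // ey er.
Qed.

End Boundary.

(** * Purity of complexes with acyclic links *)

Section Purity.
Variables (T : finType) (K : fieldType).
Implicit Types (A B S : {set T}) (D : {set {set T}}).
Notation X := {ffun {set T} -> K^o}.

Lemma leq_maxsz D B : B \in D -> (#|B| <= maxsz D)%N.
Proof. by move=> BD; rewrite /maxsz (bigD1 B) //= leq_maxl. Qed.

Lemma maxsz_attained D : is_complex D -> exists2 B, B \in D & #|B| = maxsz D.
Proof.
case=> /set0Pn[A AD] _; have D0 : (0 < #|D|)%N by apply/card_gt0P; exists A.
by have [B BD e] := eq_bigmax_cond (fun B : {set T} => #|B|) D0; exists B.
Qed.

Lemma maxsz_link_lt D u : is_complex D -> [set u] \in D ->
  (maxsz (link D [set u]) < maxsz D)%N.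
Proof.
move=> cD uD; have [B BL <-] := maxsz_attained (link_complex cD uD).
case/linkP: BL => _; rewrite disjoints1 => uB uBD.
by apply: leq_trans (leq_maxsz uBD); rewrite cardsU1 uB.
Qed.

Definition acyclic_links D := forall A k, A \in D ->
  (k < maxsz (link D A))%N -> exact_at (fun=> 1 : K) (link D A) k.

Lemma acyclic_links_link D A : is_complex D -> A \in D -> acyclic_links D ->
  acyclic_links (link D A).
Proof.
move=> cD AD h B k BL; rewrite link_link //; apply: h.
by case/linkP: BL.
Qed.

(* Splitting the constant weight as [P + ~~ P] leaves only the terms indexed by
   an edge between [P] and its complement, also in characteristic 2. *)
Lemma indicator_edge D (P : pred T) y : y \in chains K D 2 ->
  (forall v w, [set v; w] \in D -> P v = P w) ->
  contr (fun w => (P w)%:R) (contr (fun=> 1) y) set0 = 0.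
Proof.
move=> /chainsP yD edge; pose f w : K := (P w)%:R; pose g w : K := (~~ P w)%:R.
rewrite (eq_contr (f := fun=> 1) (g := fun w => f w + g w)); last first.
  by move=> w; rewrite /f /g; case: (P w); rewrite /= ?(addr0, add0r).
rewrite contrD linearD /= contr_sq add0r contrE big1 // => w _.
rewrite contrE mulr_sumr big1 // => v _.
rewrite /f /g; case: (eqVneq (y (v |: (w |: set0))) 0) => [->|/yD[]]; first by rewrite !mulr0.
rewrite setU0 => /edge ->; case: (P w); rewrite /= ?(mul0r, mulr0) //.
Qed.

(** The difference of the two vertices is a boundary, and by [indicator_edge] the weight [P] takes
    the value zero on it. *)
Lemma exact_at1_connected D (P : pred T) u v : is_complex D ->
  exact_at (fun=> 1 : K) D 1 -> [set u] \in D -> [set v] \in D ->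
  (forall v w, [set v; w] \in D -> P v = P w) -> P u = P v.
Proof.
move=> cD ex uD vD edge; pose x : X := face_chain K [set u] - face_chain K [set v].
have xD : x \in chains K D 1.
  by rewrite memvB // mem_face_chain mem_faces cards1 ?uD ?vD.
have dl1 (f : T -> K) z S : contr f (face_chain K [set z]) S = (S == set0)%:R * f z.
  rewrite contrE; case: (eqVneq S set0) => [->|S0]; last first.
    rewrite mul0r big1 // => w wS; rewrite face_chainE; case: eqP => [e|]; last by rewrite mulr0.
    have : #|w |: S| = 1%N by rewrite e cards1.
    by rewrite cardsU1 wS => -[/eqP]; rewrite cards_eq0 (negPf S0).
  rewrite mul1r (bigD1 z) ?inE //= big1 ?addr0.
    rewrite face_chainE setU0 eqxx mulr1 /face_sign (_ : [set _ in _ | _] = set0) ?cards0 ?mulr1 //.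
    by apply/setP => w; rewrite !inE.
  by move=> w /andP[_ /negPf wz]; rewrite face_chainE setU0 (inj_eq set1_inj) wz mulr0.
have [|y yD ey] := ex x xD.
  by apply/ffunP => S; rewrite linearB !ffunE /= !dl1 subrr.
have := indicator_edge yD edge; rewrite ey linearB !ffunE /= !dl1 eqxx !mul1r.
move/eqP; rewrite subr_eq0; case: (P u); case: (P v) => //.
  by rewrite oner_eq0.
by rewrite eq_sym oner_eq0.
Qed.

(** The point is that every vertex link has the largest possible dimension. Some vertex has such a
    link, the property is constant along edges by induction in the links of both ends, and [D] is
    connected once it has an edge. *)
Lemma acyclic_links_pure D A : is_complex D -> acyclic_links D -> A \in D ->
  (maxsz (link D A) + #|A|)%N = maxsz D.
Proof.
move: {2}(maxsz D) (leqnn (maxsz D)) => n; elim: n D A => [|n IH] D A le cD aD AD.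
  have : (#|A| <= 0)%N by apply: leq_trans (leq_maxsz AD) le.
  by rewrite leqn0 cards_eq0 => /eqP ->; rewrite link0 // cards0 addn0.
have IHv u B : [set u] \in D -> B \in link D [set u] ->
    (maxsz (link D (u |: B)) + #|B|)%N = maxsz (link D [set u]).
  move=> uD BL; rewrite -link_link //; apply: IH => //.
  - by have := maxsz_link_lt cD uD; lia.
  - exact: link_complex.
  - exact: acyclic_links_link.
suff top u : [set u] \in D -> (maxsz (link D [set u])).+1 = maxsz D.
  case: (eqVneq A set0) => [->|/set0Pn[u uA]]; first by rewrite link0 // cards0 addn0.
  have uD : [set u] \in D by apply: complexS cD AD _; rewrite sub1set.
  have BL : A :\ u \in link D [set u].
    by rewrite in_link // disjoints1 setD11 setD1K.
  rewrite -(top u uD) -(IHv u _ uD BL) setD1K // (cardsD1 u A) uA; lia.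
move=> uD; have [G GD eG] := maxsz_attained cD.
have ltu := maxsz_link_lt cD uD.
have [v vG] : exists v, v \in G by apply/card_gt0P; lia.
have vD : [set v] \in D by apply: complexS cD GD _; rewrite sub1set.
have topv : (maxsz (link D [set v])).+1 == maxsz D.
  rewrite eqn_leq maxsz_link_lt //= -eG (cardsD1 v G) vG ltnS; apply: leq_maxsz.
  by rewrite in_link // disjoints1 setD11 setD1K.
have [le1|gt1] := leqP (maxsz D) 1; first by lia.
pose P w := (maxsz (link D [set w])).+1 == maxsz D.
suff e : P u = P v by apply/eqP; rewrite -[_ == _]/(P u) e.
apply: (exact_at1_connected cD) => //.
  by rewrite -(link0 cD); apply: aD; rewrite ?link0 // complex_set0.
move=> v1 w vw; case: (eqVneq v1 w) => [->//|ne].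
have v1D : [set v1] \in D by apply: complexS cD vw _; rewrite subsetUl.
have wD : [set w] \in D by apply: complexS cD vw _; rewrite subsetUr.
have wL : [set w] \in link D [set v1] by rewrite in_link // disjoints1 inE ne.
have vL : [set v1] \in link D [set w].
  by rewrite in_link // disjoints1 inE eq_sym ne setUC.
rewrite /P -(IHv v1 [set w] v1D wL) -(IHv w [set v1] wD vL).
by rewrite [[set w; v1]]setUC !cards1.
Qed.

(** By purity, [k < maxsz (link D A)] is the same as [k + #|A| < maxsz D]. *)
Lemma acyclic_links_depth D : is_complex D -> acyclic_links D ->
  depth_ge K D (maxsz D).
Proof.
move=> cD aD A k AD lt; have := acyclic_links_pure cD aD AD => e.
by apply: aD => //; lia.
Qed.

End Purity.

Local Open Scope nat_scope.

(** * The bound for complete families *)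

Lemma closed_field_injection (T : finType) (K : closedFieldType) :
  exists t : T -> K, injective t.
Proof.
have [s us ss] : exists2 s : seq K, uniq s & size s = #|T|.
  elim: #|T| => [|n [s us ss]]; first by exists [::].
  (* The value at each [z] in [s] is [1], so a root is new; the factor ['X] keeps [p] nonconstant
     for empty [s]. *)
  pose p : {poly K} := (\prod_(z <- s) ('X - z%:P) * 'X + 1)%R.
  have szp : size p = n.+2.
    have q0 : (\prod_(z <- s) ('X - z%:P) != 0 :> {poly K})%R.
      by rewrite monic_neq0 // monic_prod_XsubC.
    by rewrite size_polyDl size_mulX // size_prod_XsubC ss ?size_poly1.
  have /closed_rootP[x rx] : size p != 1 by rewrite szp.
  exists (x :: s) => /=; last by rewrite ss.
  rewrite us andbT; apply/negP => xs; move: rx; rewrite /root !hornerE.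
  rewrite (_ : (\prod_(z <- s) ('X - z%:P)).[x] = 0)%R; last first.
    by apply/rootP; rewrite root_prod_XsubC.
  by rewrite mul0r add0r oner_eq0.
exists (fun u => nth 0%R s (enum_rank u)) => u w /eqP.
rewrite nth_uniq ?ss ?ltn_ord // => /eqP/val_inj; exact: enum_rank_inj.
Qed.

(** Exactness at size 0 makes the empty face a boundary in the link of [C], so this link has a
    vertex to add. *)
Lemma depth_ge_extend (T : finType) (K : fieldType) (G : {set {set T}}) m B k :
  is_complex G -> depth_ge K G m -> B \in G -> #|B| <= k -> k <= m ->
  exists C, [/\ C \in G, B \subset C & #|C| = k].
Proof.
move=> cG dG BG; elim: k => [|k IH] Bk km.
  by exists B; split=> //; apply/eqP; rewrite -leqn0.
move: Bk; rewrite leq_eqVlt => /orP[/eqP e|Bk]; first by exists B; split.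
have [C [CG BC cC]] := IH Bk (ltnW km).
have dl0 : face_chain K set0 \in chains K (link G C) 0.
  rewrite mem_face_chain mem_faces cards0 eqxx andbT.
  by rewrite complex_set0 //; apply: link_complex.
have [||y yL ey] := dG C 0 CG _ (face_chain K set0) dl0.
- by rewrite add0n cC.
- exact: contr_chains0 dl0.
have : y != 0%R.
  apply/eqP => y0; move: ey; rewrite y0 linear0 => /ffunP/(_ set0).
  by rewrite !ffunE eqxx => /esym/eqP; rewrite oner_eq0.
case: (pickP (fun S => y S != 0%R)) => [S yS _|y0]; last first.
  by case/eqP; apply/ffunP => S; rewrite ffunE; have /negbFE/eqP := y0 S.
have /chainsP/(_ S yS)[/linkP[_ dCS CSG] cS] := yL.
exists (C :|: S); split=> //; first exact: subset_trans BC (subsetUl _ _).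
have := cardsUI C S; move: dCS; rewrite -setI_eq0 => /eqP ->; rewrite cards0 cC cS.
by clear; lia.
Qed.

Section Core.
Variables (T : finType) (K : closedFieldType) (V : {set T}) (o : T) (r : nat).
Implicit Types (S B C : {set T}) (F : {set {set T}}).
Hypotheses (r2 : 2 <= r) (oV : o \in V) (cV : #|V| = r.+1).
Variables (G AA : {set {set T}}).
Hypotheses (cG : is_complex G) (GV : G \subset powerset (~: V)).
Hypotheses (dG : depth_ge K G r.-1).
Hypotheses (AAr : forall B, B \in AA -> #|B| = r) (AAG : forall B, B \in AA -> B :\: V \in G).
Hypotheses (iA : intersecting AA).
Hypotheses (fullA : forall S : {set T}, S \subset V -> #|S| = r -> S \in AA).

Let ws := enum (~: V).
Let vs := o :: enum (V :\ o).
(** With [o] first and then the rest of [V], the segments in the definition of [star] become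
    [[set o]] and [V :\ o]. *)
Let order := vs ++ ws.
Definition vrank u := index u order.

Let mem_vs u : (u \in vs) = (u \in V).
Proof. by rewrite inE mem_enum !inE; case: (u =P o) => [->|]. Qed.

Let mem_ws u : (u \in ws) = (u \in ~: V).
Proof. by rewrite mem_enum. Qed.

Let order_uniq : uniq order.
Proof.
rewrite cat_uniq /= enum_uniq mem_enum !inE eqxx /= enum_uniq andbT.
by apply/hasPn => u; rewrite mem_enum inE [_ \in o :: _]mem_vs.
Qed.

Let mem_order u : u \in order.
Proof. by rewrite mem_cat mem_vs mem_ws inE orbN. Qed.

Let size_vs : size vs = r.+1.
Proof. by rewrite /= -cardE; have := cardsD1 o V; rewrite oV cV add1n => -[<-]. Qed.

Let size_ws : size ws = #|T| - r.+1.
Proof. by rewrite -cardE cardsCs setCK cV. Qed.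

Let vrank_inj : injective vrank.
Proof. by move=> u w e; rewrite -(nth_index o (mem_order u)) -/(vrank u) e nth_index. Qed.

Let size_order : size order = #|T|.
Proof. by rewrite -(card_uniqP order_uniq); apply: eq_card => u; rewrite mem_order. Qed.

Let vrank_lt u : vrank u < #|T|.
Proof. by rewrite -size_order index_mem. Qed.

Let segV : seg vrank 0 r.+1 = V.
Proof.
apply/setP => u; rewrite inE /= /vrank index_cat mem_vs -size_vs.
by case: ifP => uV; [rewrite index_mem mem_vs|rewrite ltnNge leq_addr].
Qed.

Let seg_o : seg vrank 0 1 = [set o].
Proof.
by apply/setP => u; rewrite !inE /vrank /= eq_sym; case: ifP.
Qed.

Let seg_rest : seg vrank 1 r.+1 = V :\ o.
Proof.
rewrite -segV -seg_o; apply/setP => u; rewrite !inE; clear; lia.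
Qed.

Let seg_ws j : seg vrank r.+1 (r.+1 + j) = [set u in take j ws].
Proof.
apply/setP => u; rewrite !inE /vrank index_cat mem_vs -size_vs.
case: (boolP (u \in V)) => uV.
  have -> : size vs <= index u vs = false by apply/negbTE; rewrite -ltnNge index_mem mem_vs.
  by apply/esym/negbTE/negP => /mem_take; rewrite mem_ws inE uV.
by rewrite leq_addr ltn_add2l in_take // mem_ws inE.
Qed.

Let fits : r.+1 + r.-1 <= #|T|.
Proof.
have [|C [CG _ cC]] := depth_ge_extend cG dG (complex_set0 cG) _ (leqnn _).
  by rewrite cards0.
have := subsetP GV C CG; rewrite inE => /subset_leq_card.
by have := cardsC V; rewrite cV cC; clear; lia.
Qed.

Let traceW S : trace_family V AA S \subset powerset (~: V).
Proof. by apply/subsetP => C; rewrite !inE => /andP[]. Qed.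

Let trace_faces (S : {set T}) : S \subset V -> trace_family V AA S \subset faces_of G (r - #|S|).
Proof.
move=> SV; apply/subsetP => C; rewrite in_set mem_faces => /andP[CV SCA].
have := AAG SCA; rewrite setUDV // => -> /=.
have := cardsID V (S :|: C); rewrite setUIV // setUDV // (AAr SCA).
by clear; lia.
Qed.

Let trace_nil (S : {set T}) : S \subset V -> r < #|S| -> trace_family V AA S = set0.
Proof.
move=> SV rS; apply/setP => C; rewrite in_set in_set0; apply/negP => /andP[CV SCA].
have := AAr SCA; have := subset_leq_card (subsetUl S C); move: rS; clear; lia.
Qed.

Lemma complete_family_bound : #|AA| <=
  #|[set B in faces_of (with_V V G) r | (o \in B) && ~~ [disjoint B & V :\ o]]| + 1.
Proof.
have [t t_inj] := closed_field_injection T K.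
have ws_uniq : uniq ws by apply: enum_uniq.
pose ht := ashift t ws; pose G1 := ashift_complex t ws G.
(* All trace families are shifted with the same forms, so members over disjoint traces still meet
   outside [V]. *)
pose A1 := glue V (fun S => ht (trace_family V AA S)).
have htW F : F \subset powerset (~: V) -> #|ht F| = #|F|.
  exact: (card_ashift t_inj ws_uniq mem_ws).
have htV F : ht F \subset powerset (~: V).
  by apply/subsetP => B /(ashift_subW mem_ws); rewrite inE.
have cG1 : is_complex G1 by apply: (ashift_complex_is_complex t_inj ws_uniq mem_ws).
have facesG1 k : faces_of G1 k = ht (faces_of G k) by apply: (faces_ashift t_inj ws_uniq mem_ws).
have A1P B : B \in A1 -> B :\: V \in faces_of G1 (r - #|B :&: V|) /\ #|B :&: V| <= r.
  rewrite in_glue => BA; have SV : B :&: V \subset V := subsetIr _ _.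
  split; first by rewrite facesG1; apply: (subsetP (ashiftS t ws (trace_faces SV))) BA.
  rewrite leqNgt; apply/negP => /(trace_nil SV) e.
  have : 0 < #|ht (trace_family V AA (B :&: V))| by apply/card_gt0P; exists (B :\: V).
  by rewrite htW // e cards0.
have trace_card S : S \subset V -> forall C, C \in trace_family V AA S -> #|C| = (r - #|S|).
  by move=> SV C /(subsetP (trace_faces SV)); rewrite mem_faces => /andP[_ /eqP].
have adm : admissible vrank r r.-1 G #|AA| G1 A1.
  split=> //.
  - by apply/subsetP => B; rewrite segV inE => BG; have := subsetP (htV _) _ BG.
  - by move=> i; apply: (fnum_ashift t_inj ws_uniq mem_ws).
  - move=> C j CG1 jT; rewrite seg_ws => le.
    rewrite (_ : _ :|: C = [set u in take j ws] :|: (C :\: [set u in take j ws])); last first.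
      by apply/setP => u; rewrite !inE; case: (u \in take j ws).
    apply: (ashift_initial t_inj ws_uniq mem_ws cG GV dG CG1) => //.
    by rewrite size_ws; move: jT; clear; lia.
  split.
  - apply/subsetP => B /A1P[]; rewrite !mem_faces in_with_V segV => /andP[-> /eqP cB] le /=.
    by have := cardsID V B; rewrite cB; move: le; clear; lia.
  - have := card_glue traceW; rewrite glue_trace => ->; rewrite card_glue //.
    by apply: eq_bigr => S _; apply: htW.
  - move=> B C BA CA; case: (boolP (B :&: V :&: (C :&: V) == set0)) => [/eqP BC0|BC]; last first.
      by apply: contraNneq BC => e; rewrite setIACA e set0I.
    have SB : B :&: V \subset V := subsetIr _ _; have SC : C :&: V \subset V := subsetIr _ _.
    have : (B :\: V) :&: (C :\: V) != set0.
      rewrite !in_glue in BA CA.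
      apply: (ashift_meet t_inj ws_uniq mem_ws _ _ (trace_card _ SB) (trace_card _ SC) _ BA CA) => //.
      move=> B' C'; rewrite !in_set => /andP[B'V SB'] /andP[C'V SC'].
      have := iA SB' SC'; apply: contraNneq => e.
      rewrite setIUl !setIUr BC0 set0U e setU0.
      have d1 : B :&: V :&: C' = set0.
        apply/eqP; rewrite setI_eq0 disjoint_sym disjoints_subset.
        by apply: subset_trans C'V _; rewrite setCS.
      have d2 : B' :&: (C :&: V) = set0.
        apply/eqP; rewrite setI_eq0 disjoints_subset.
        by apply: subset_trans B'V _; rewrite setCS.
      by rewrite d1 d2 setU0.
    by apply: contraNneq => e; rewrite -subset0 -e setISS ?subsetDl.
  (* The trace family over [S] contains only the empty set, and its shift keeps both cardinality and
     sizes. *)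
  - move=> S; rewrite segV => SV cS; rewrite in_glue.
    have -> : S :\: V = set0 by apply/eqP; rewrite setD_eq0.
    rewrite (setIidPl SV).
    have S0 : set0 \in trace_family V AA S by rewrite in_set sub0set setU0 fullA.
    have /card_gt0P[C Cht] : 0 < #|ht (trace_family V AA S)|.
      by rewrite htW //; apply/card_gt0P; exists set0.
    have := ashift_size t_inj ws_uniq mem_ws (traceW S) (trace_card S SV) Cht.
    by rewrite cS subnn => /cards0_eq e; rewrite -e.
have [D [A2 [[cD DV fD iD [A2D cA2 iA2 fullA2]] sA2 sD]]] := admissible_shifted adm.
rewrite segV in DV A2D sD fullA2.
have Da B : B \in D -> B \subset seg vrank r.+1 #|T|.
  move=> BD; apply/subsetP => u uB; rewrite inE vrank_lt andbT leqNgt.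
  have := subsetP DV B BD; rewrite inE => /subsetP/(_ u uB).
  by rewrite inE -segV inE.
have fD' := initial_facets_ge vrank_inj vrank_lt cD fits Da iD.
(* All of [V] and at least [r - 1] vertices outside: [(r + 1) + (r - 1) = 2 r]. *)
have fW2 : facets_ge (with_V V D) (2 * r).
  move=> B; rewrite in_with_V => /fD'[F FD /andP[BF mF]].
  have FV : F \subset ~: V by have := subsetP DV F FD; rewrite inE.
  exists (V :|: F); first by rewrite in_with_V setUDV.
  apply/andP; split.
    rewrite -(setID B V) setUSS ?subsetIr //.
  have := cardsID V (V :|: F); rewrite setUIV // setUDV // cV.
  by move: mF r2; clear; lia.
have HA2 : seg vrank 1 r.+1 \in A2.
  rewrite seg_rest; apply: fullA2; first exact: subD1set.
  by have := cardsD1 o V; rewrite oV cV add1n => -[<-].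
have := shifted_hilton_milner vrank_inj vrank_lt r2 (leqnn _) (with_V_complex V cD) _ sD fW2 A2D sA2 iA2 HA2.
rewrite cA2 => bound; apply: leq_trans (bound _) _.
  by move=> B _; apply/subsetP => u _; rewrite inE vrank_lt.
rewrite leq_add2r leq_eqVlt; apply/orP; left; apply/eqP.
pose P (S : {set T}) := (o \in S) && ~~ [disjoint S & V :\ o].
have PI B : P (B :&: V) = (o \in B) && ~~ [disjoint B & V :\ o].
  rewrite /P inE oV andbT; congr (_ && ~~ _).
  by rewrite -!setI_eq0 -setIA (setIidPr (subD1set V o)).
have -> : star vrank (with_V V D) r = [set B in faces_of (with_V V D) r | P (B :&: V)].
  apply/setP => B; rewrite /star in_set [in RHS]in_set PI seg_rest seg_o.
  by rewrite [[disjoint B & [set o]]]disjoint_sym disjoints1 negbK.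
(* Membership in the star is read off from the trace on [V], so its size is the same for [G]. *)
rewrite (card_with_V_faces r P DV GV fD); congr (#|pred_of_set _|).
by apply/setP => B; rewrite !in_set PI.
Qed.

End Core.

(** * Skeleta and the final count *)

Section Skeleton.
Variables (T : finType) (D : {set {set T}}).
Hypothesis cD : is_complex D.
Implicit Types (A B : {set T}).

Lemma mem_skel m B : (B \in skel D m) = (B \in D) && (#|B| <= m).
Proof. by rewrite inE. Qed.

Lemma skel_complex m : is_complex (skel D m).
Proof.
split; first by apply/set0Pn; exists set0; rewrite mem_skel complex_set0 // cards0.
move=> A B; rewrite !mem_skel => /andP[AD Am] BA; rewrite (complexS cD AD BA) /=.
exact: leq_trans (subset_leq_card BA) Am.
Qed.

Lemma faces_skel m k : k <= m -> faces_of (skel D m) k = faces_of D k.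
Proof.
move=> km; apply/setP => B; rewrite !mem_faces mem_skel.
by case: eqP => [->|]; rewrite ?km ?andbT ?andbF.
Qed.

Lemma maxsz_skel m : m <= maxsz D -> maxsz (skel D m) = m.
Proof.
move=> mD; apply/eqP; rewrite eqn_leq; apply/andP; split.
  by apply/bigmax_leqP => B; rewrite mem_skel => /andP[].
have [B BD cB] := maxsz_attained cD; rewrite -cB in mD.
have [s [us <- sB]] := card_geqP mD.
rewrite -(card_uniqP us) -cardsE; apply: leq_maxsz; rewrite mem_skel.
rewrite cardsE (card_uniqP us) leqnn andbT; apply: complexS cD BD _.
by apply/subsetP => u; rewrite inE => /sB.
Qed.

Lemma skel_shifted t (v : 'I_t -> T) m : shifted_wrt D v -> shifted_wrt (skel D m) v.
Proof.
move=> sD i B w; rewrite !mem_skel => /andP[BD Bm] wB wv vB.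
rewrite sD //= setUC cardsU1 !inE (negPf vB) andbF.
by have := cardsD1 w B; rewrite wB; move: Bm; clear; lia.
Qed.

Lemma depth_cohen_macaulay (F : fieldType) d : (0 < d)%N ->
  depth F D = (d%:Z - 1)%R -> cohen_macaulay F (skel D d) /\ d <= maxsz D.
Proof.
move=> d0; rewrite /depth => /addIr [] e.
pose P (m : 'I_(maxsz D).+1) := cohen_macaulay F (skel D m).
(* A maximum over an empty range is [0], so [d0] provides an index attaining it. *)
have P0 : 0 < #|[pred m | P m]|.
  rewrite lt0n; apply: contraTneq d0 => P0; rewrite -e big_pred0 // => m.
  by apply: (card0_eq P0).
have [m Pm em] := eq_bigmax_cond (fun m : 'I_(maxsz D).+1 => m : nat) P0.
have {em} em : d = m by rewrite -em -e.
by rewrite em; split; [exact: Pm|rewrite -ltnS].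
Qed.

End Skeleton.

Lemma cohen_macaulay_acyclic (F : fieldType) (K : fieldType) (T : finType)
    (D : {set {set T}}) : is_complex D ->
  (forall (E : {set {set T}}) k, hvanish F E k = hvanish K E k) ->
  cohen_macaulay F D -> acyclic_links K D.
Proof.
move=> cD FK /forall_inP cm A k AD lt.
apply: hvanish_exact; first exact: link_complex.
by rewrite -FK; have /forallP/(_ (Ordinal lt)) := cm A AD.
Qed.

Lemma depth_ge_le (T : finType) (K : fieldType) (G : {set {set T}}) m n :
  m <= n -> depth_ge K G n -> depth_ge K G m.
Proof. by move=> mn dG A k AG lt; apply: dG => //; apply: leq_trans lt mn. Qed.

Lemma fnum_link1 (T : finType) (D : {set {set T}}) o r : is_complex D -> 0 < r ->
  fnum (link D [set o]) r.-1 = #|[set B in faces_of D r | o \in B]|.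
Proof.
move=> cD r0; rewrite /fnum.
rewrite -(card_in_imset (f := fun C => o |: C) (D := mem (faces_of (link D [set o]) r.-1))).
  apply: eq_card => B; rewrite in_set mem_faces; apply/imsetP/idP => [[C]|/andP[/andP[BD cB] oB]].
    rewrite mem_faces => /andP[/linkP[_ + oCD] /eqP cC] ->.
    by rewrite disjoints1 => oC; rewrite oCD setU11 cardsU1 oC cC andbT; move: r0; clear; lia.
  exists (B :\ o); last by rewrite setD1K.
  rewrite mem_faces link1_face ?setD11 // setD1K // BD /=.
  by have := cardsD1 o B; rewrite oB (eqP cB); clear; lia.
move=> B C; rewrite !mem_faces => /andP[/linkP[_ + _] _] /andP[/linkP[_ + _] _].
by rewrite !disjoints1 => oB oC e; rewrite -(setU1K oB) e setU1K.
Qed.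

Local Open Scope ring_scope.

Theorem theorem1p5 (F : fieldType) (T : finType) (D : {set {set T}})
    (d r : nat) (AA : {set {set T}}) (v : 'I_r.+1 -> T) :
  is_complex D ->
  depth F D = (d%:Z - 1)%R ->
  (2 <= r)%N -> (2 * r <= d)%N ->
  (forall A, A \in AA -> A \in D /\ #|A| = r) ->
  intersecting AA ->
  injective v ->
  (forall i, [set v i] \in D) ->
  shifted_wrt D v ->
  ~ (exists x, forall A, A \in AA -> x \in A) ->
  (#|AA|%:Z <=
     (fnum (link D [set v ord0]) r.-1)%:Z
     - (#|[set B in D | (#|B| == r) && (v ord0 \in B)
                         && [forall j : 'I_r.+1, (j != ord0) ==> (v j \notin B)]]|)%:Z
     + 1)%R.
Proof.
move=> cD dD r2 rd AAP iA v_inj _ sD nt.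
have d0 : (0 < d)%N by move: r2 rd; clear; lia.
have rled : (r <= d)%N by move: r2 rd; clear; lia.
have [cm dmax] := depth_cohen_macaulay d0 dD.
have [K FK] := closed_field_same_homology F.
(* The [d]-skeleton has the same [r]-faces, inherits shiftedness and is Cohen-Macaulay. *)
pose E := skel D d; have cE : is_complex E := skel_complex cD d.
have dE : depth_ge K E d.
  rewrite -{1}(maxsz_skel cD dmax); apply: acyclic_links_depth => //.
  exact: cohen_macaulay_acyclic cE (FK T) cm.
have facesE : faces_of E r = faces_of D r := faces_skel D rled.
have extE B : B \in E -> (#|B| <= 2 * r)%N ->
    exists C, [/\ C \in E, B \subset C & #|C| = (2 * r)%N].
  by move=> BE Br; apply: (depth_ge_extend cE dE BE Br).
have sE := skel_shifted (m := d) sD.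
have AAE : AA \subset faces_of E r.
  by apply/subsetP => B BA; rewrite facesE mem_faces; have [-> ->] := AAP _ BA; rewrite eqxx.
have [A1 [A1E iA1 leA1 fullA1]] := nontrivial_completable cE r2 v_inj extE sE AAE iA nt.
pose V := vset v; pose o := v ord0.
have oV : o \in V by apply: mem_vset.
have cV : #|V| = r.+1 by apply: card_vset.
have VE : V \in E := V_face cE r2 v_inj extE sE.
have A1P B : B \in A1 -> B \in E /\ #|B| = r.
  by move/(subsetP A1E); rewrite mem_faces => /andP[? /eqP].
have A1V B : B \in A1 -> B :\: V \in link E V.
  move=> BA; have [BE cB] := A1P _ BA; rewrite in_link //.
  have dV : [disjoint B :\: V & V] by rewrite disjoints_subset setDE subsetIr.
  rewrite disjoint_sym dV setUC /=; apply: (face_with_V cE v_inj extE sE) => //.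
    by apply: complexS cE BE (subsetDl _ _).
  (* [B] meets this member, hence meets [V], and so has fewer than [r] elements outside [V]. *)
  have VoA : V :\ o \in A1.
    by apply: fullA1; [exact: subD1set|have := cardsD1 o V; rewrite oV cV; clear; lia].
  have : (0 < #|B :&: V|)%N.
    rewrite card_gt0; apply: contraNneq (iA1 _ _ BA VoA) => BV0.
    by rewrite -subset0 -BV0 setIS // subD1set.
  by have := cardsID V B; rewrite cB; clear; lia.
have cG : is_complex (link E V) := link_complex cE VE.
have GV : link E V \subset powerset (~: V).
  by apply/subsetP => B /linkP[_ dB _]; rewrite inE -disjoints_subset disjoint_sym.
have dG : depth_ge K (link E V) r.-1.
  apply: depth_ge_le (depth_ge_link cE VE dE); rewrite cV; move: r2 rd; clear; lia.
have := complete_family_bound r2 oV cV cG GV dG (fun B BA => (A1P B BA).2) A1V iA1 fullA1.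
move=> bound; rewrite (fnum_link1 _ cD (ltnW r2)) -/o.
(* Splits the [r]-faces through [o] into those of the bound and those that are subtracted. *)
pose meets := [set B : {set T} | ~~ [disjoint B & V :\ o]].
rewrite -(cardsID meets [set B in faces_of D r | o \in B]).
have -> : [set B in D | (#|B| == r) && (o \in B) &&
    [forall j : 'I_r.+1, (j != ord0) ==> (v j \notin B)]] =
    [set B in faces_of D r | o \in B] :\: meets.
  apply/setP => B; rewrite in_setD !in_set negbK.
  rewrite [RHS]andbC !andbA; congr (_ && _).
  apply/forallP/idP => [h|dB j].
    rewrite disjoint_sym disjoints_subset; apply/subsetP => u.
    rewrite in_setD1 in_setC => /andP[uo /vsetP[j ej]]; rewrite ej.
    apply: (implyP (h j)); apply: contraNneq uo => j0; by rewrite ej j0.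
  apply/implyP => j0; apply/negP => vB.
  by have := disjointFr dB vB; rewrite in_setD1 (inj_eq v_inj) j0 mem_vset.
have : (#|[set B in faces_of (with_V V (link E V)) r | (o \in B) && ~~ [disjoint B & V :\ o]]|
    <= #|[set B in faces_of D r | o \in B] :&: meets|)%N.
  apply/subset_leq_card/subsetP => B; rewrite [X in is_true X -> _]in_set mem_faces in_with_V.
  case/andP => /andP[/linkP[_ _ VBE] cB] /andP[oB mB].
  have : B \in E.
    by apply: complexS cE VBE _; apply/subsetP => u uB; rewrite in_setU in_setD uB andbT orbN.
  rewrite mem_skel => /andP[BD _]; apply/setIP.
  by split; rewrite in_set // mem_faces BD cB.
move=> le; rewrite PoszD addrK -PoszD lez_nat.
by apply: leq_trans leA1 (leq_trans bound _); rewrite leq_add2r.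
Qed.
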